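(* The next breakpoint problem $P_{NB}(M)$ (as defined in the context) can be solved by a randomized algorithm with high probability in $O(n^2\log^3 n)$ time.
   Context: Let $G=(V,E)$ be an undirected graph with $n=|V|$ and $m=|E|$. A cut is a vertex set $C$ with $\emptyset\neq C\subsetneq V$; it cuts the edge set $\delta(C)=\{e\in E: e\cap C\neq\emptyset\neq e\setminus C\}$. Let $d\ge 1$ be a fixed constant and let $c^0,\dots,c^d:E\to\mathbb{Z}$ be cost functions (no sign condition). For $\mu\in\mathbb{R}^d$ put $c_\mu(e)=c^0(e)+\sum_{i=1}^d\mu_i c^i(e)$, $c_\mu(C)=\sum_{e\in\delta(C)}c_\mu(e)$ and $Z(\mu)=\min_C c_\mu(C)$. Let $M_0=\{\mu\in\mathbb{R}^d: c_\mu(e)\ge 0\ \forall e\in E\}$ and let $M\subset M_0$ be a nonempty simplex; all parameters considered lie in $M$. The function $Z$ is piecewise linear and concave and is assumed to have at least one breakpoint. Problem $P_{NB}(M)$: given $\mu^0\in M$ and a direction $\nu\in\mathbb{Z}^d$, find the next breakpoint of $Z$ after $\mu^0$ in direction $\nu$, i.e. the point $\mu^{NB}=\mu^0+\lambda^{NB}\nu\in M$ where $\lambda^{NB}>0$ is the smallest $\lambda>0$ at which $\lambda\mapsto Z(\mu^0+\lambda\nu)$ changes slope, or report that no such point exists. *)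

(* Defs.v *)
From HB Require Import structures.
From mathcomp Require Import all_boot all_order all_algebra.
From mathcomp Require Import all_classical all_reals all_analysis.

Set Implicit Arguments.
Unset Strict Implicit.
Unset Printing Implicit Defensive.

Import Order.TTheory GRing.Theory Num.Theory.
Import numFieldNormedType.Exports.

Local Open Scope ring_scope.

Section ParametricCuts.
Variables (R : realType) (d n : nat).
Implicit Types (E : {set {set 'I_n}}) (c : 'I_d.+1 -> {set 'I_n} -> int).
Implicit Types (mu nu x : 'rV[R]_d) (C e : {set 'I_n}).

Definition simple_graph E : Prop := forall e, e \in E -> #|e| = 2.

Definition is_cut C : bool := (C != finset.set0) && (C \proper [set: 'I_n]).

Definition cut_edges E C : {set {set 'I_n}} :=
  [set e in E | (e :&: C != finset.set0) && (e :\: C != finset.set0)].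

Definition edge_cost c mu e : R :=
  (c ord0 e)%:~R + \sum_(i < d) mu 0 i * (c (lift ord0 i) e)%:~R.

Definition cut_cost E c mu C : R := \sum_(e in cut_edges E C) edge_cost c mu e.

(* The starting point of the search, the singleton of the vertex 0, is a cut
   as soon as 2 <= n. *)
Definition min_cut_value E c mu : R :=
  cut_cost E c mu
    [arg min_(C < [set v : 'I_n | val v == 0%N] | is_cut C)
       cut_cost E c mu C]%O.

Definition nonneg_params E c mu : Prop :=
  forall e, e \in E -> 0 <= edge_cost c mu e.

Definition is_breakpoint (f : 'rV[R]_d -> R) mu : Prop :=
  ~ exists g : 'rV[R]_d,
      \forall x \near mu, f x = f mu + \sum_(i < d) g 0 i * (x 0 i - mu 0 i).

Definition changes_slope (h : R -> R) (l : R) : Prop :=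
  ~ exists s : R, \forall t \near l, h t = h l + s * (t - l).

(* The rows of P are the vertices of the simplex. *)
Definition affinely_independent (k : nat) (P : 'M[R]_(k.+1, d)) : Prop :=
  row_free (\matrix_(i < k) (row (lift ord0 i) P - row ord0 P)).

Definition in_simplex (k : nat) (P : 'M[R]_(k.+1, d)) x : Prop :=
  exists w : 'rV[R]_k.+1,
    [/\ forall i, 0 <= w 0 i, \sum_i w 0 i = 1 & x = w *m P].

Definition is_next_breakpoint (f : 'rV[R]_d -> R) (M : 'rV[R]_d -> Prop)
    mu0 nu x : Prop :=
  exists l : R,
    [/\ 0 < l, x = mu0 + l *: nu, M x,
        changes_slope (fun t => f (mu0 + t *: nu)) l
      & forall t, 0 < t < l -> ~ changes_slope (fun t => f (mu0 + t *: nu)) t].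

Record instance := Instance {
  edges : {set {set 'I_n}};
  cost : 'I_d.+1 -> {set 'I_n} -> int;
  sdim : nat;
  vertices : 'M[R]_(sdim.+1, d);
  start : 'rV[R]_d;
  direction : 'rV[int]_d
}.

Definition inst_value (I : instance) : 'rV[R]_d -> R :=
  min_cut_value (edges I) (cost I).

Definition inst_domain (I : instance) : 'rV[R]_d -> Prop :=
  in_simplex (vertices I).

Record admissible (I : instance) : Prop := Admissible {
  adm_graph : simple_graph (edges I);
  adm_simplex : affinely_independent (vertices I);
  adm_nonneg : forall mu, inst_domain I mu ->
    nonneg_params (edges I) (cost I) mu;
  adm_breakpoint : exists2 mu, inst_domain I mu & is_breakpoint (inst_value I) mu;
  adm_start : inst_domain I (start I)
}.

Definition inst_next_breakpoint (I : instance) x : Prop :=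
  is_next_breakpoint (inst_value I) (inst_domain I) (start I)
    (map_mx intr (direction I)) x.

End ParametricCuts.

(* A randomized real RAM with structured control flow.  Words are naturals
   reduced modulo a bound W (polynomial in the input size, i.e. words of
   logarithmic length); they serve as addresses and counters.  Reals are handled
   exactly, by field operations and comparisons only; there is no rounding and
   no conversion from reals to words. *)

Inductive word_op := WAdd | WSub | WMul | WDiv | WMod.
Inductive real_op := RAdd | RSub | RMul | RDiv.

(* The arguments are register numbers, except the second one of [WConst]; the
   first argument is the target, or the register holding the target address. *)
Inductive instr :=
| WConst of nat & nat
| WCopy of nat & nat
| WOp of word_op & nat & nat & nat
| WLoad of nat & nat
| WStore of nat & nat
| RCopy of nat & nat
| ROfWord of nat & nat
| ROp of real_op & nat & nat & nat
| RLoad of nat & nat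
| RStore of nat & nat
| Rand of nat & nat.

Inductive test :=
| TWordLt of nat & nat
| TWordEq of nat & nat
| TRealLt of nat & nat
| TRealEq of nat & nat.

Inductive cmd :=
| Do of instr
| If of test & seq cmd & seq cmd
| While of test & seq cmd.

Definition program := seq cmd.

Section Machine.
Variables (R : realType) (W : nat).

Record state := State {
  wreg : nat -> nat;
  rreg : nat -> R;
  wmem : nat -> nat;
  rmem : nat -> R
}.

Definition upd (T : Type) (f : nat -> T) (i : nat) (x : T) : nat -> T :=
  fun j => if j == i then x else f j.

Definition set_wreg (s : state) i x :=
  State (upd (wreg s) i (x %% W)%N) (rreg s) (wmem s) (rmem s).
Definition set_rreg (s : state) i x :=
  State (wreg s) (upd (rreg s) i x) (wmem s) (rmem s).
Definition set_wmem (s : state) a x :=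
  State (wreg s) (rreg s) (upd (wmem s) a x) (rmem s).
Definition set_rmem (s : state) a x :=
  State (wreg s) (rreg s) (wmem s) (upd (rmem s) a x).

Definition eval_wop (o : word_op) : nat -> nat -> nat :=
  match o with
  | WAdd => addn | WSub => subn | WMul => muln | WDiv => divn | WMod => modn
  end.

Definition eval_rop (o : real_op) (x y : R) : R :=
  match o with
  | RAdd => x + y | RSub => x - y | RMul => x * y | RDiv => x / y
  end.

Definition eval_test (t : test) (s : state) : bool :=
  match t with
  | TWordLt i j => (wreg s i < wreg s j)%N
  | TWordEq i j => wreg s i == wreg s j
  | TRealLt i j => rreg s i < rreg s j
  | TRealEq i j => rreg s i == rreg s j
  end.

(* The nonempty list of equally likely results of an instruction; [Rand i j]
   draws a uniform word below the contents of register j (0 if that is 0). *)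
Definition exec (a : instr) (s : state) : seq state :=
  match a with
  | WConst i x => [:: set_wreg s i x]
  | WCopy i j => [:: set_wreg s i (wreg s j)]
  | WOp o i j k => [:: set_wreg s i (eval_wop o (wreg s j) (wreg s k))]
  | WLoad i j => [:: set_wreg s i (wmem s (wreg s j))]
  | WStore i j => [:: set_wmem s (wreg s i) (wreg s j)]
  | RCopy i j => [:: set_rreg s i (rreg s j)]
  | ROfWord i j => [:: set_rreg s i (wreg s j)%:R]
  | ROp o i j k => [:: set_rreg s i (eval_rop o (rreg s j) (rreg s k))]
  | RLoad i j => [:: set_rreg s i (rmem s (wreg s j))]
  | RStore i j => [:: set_rmem s (wreg s i) (rreg s j)]
  | Rand i j => [seq set_wreg s i x | x <- iota 0 (maxn 1 (wreg s j))]
  end.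

(* A configuration is the list of commands still to be executed, together with
   the state; one step executes one instruction or evaluates one test. *)
Definition step (k : program) (s : state) : option (program * seq state) :=
  match k with
  | [::] => None
  | Do a :: k' => Some (k', exec a s)
  | If t p q :: k' => Some ((if eval_test t s then p else q) ++ k', [:: s])
  | While t p :: k' =>
      Some (if eval_test t s then p ++ k else k', [:: s])
  end.

Fixpoint prob_halts_within (T : nat) (Q : state -> Prop) (k : program)
    (s : state) {struct T} : R :=
  match step k s with
  | None => (`[< Q s >])%:R
  | Some (k', ss) =>
      if T is T'.+1 then
        (\sum_(s' <- ss) prob_halts_within T' Q k' s') / (size ss)%:R
      else 0
  end.

End Machine.

Section Encoding.
Variables (R : realType) (d n : nat).
Implicit Type I : instance R d n.

(* n, the number of vertices of the simplex, the adjacency matrix. *)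
Definition input_words I : seq nat :=
  [:: n; (sdim I).+1] ++
  [seq nat_of_bool ([set u; v] \in edges I) | u <- enum 'I_n, v <- enum 'I_n].

(* The starting point, the direction, the vertices of the simplex, the d.+1
   cost matrices (row by row, with 0 for the pairs that are not edges). *)
Definition input_reals I : seq R :=
  [seq start I 0 i | i <- enum 'I_d] ++
  [seq (direction I 0 i)%:~R | i <- enum 'I_d] ++
  [seq vertices I j i | j <- enum 'I_(sdim I).+1, i <- enum 'I_d] ++
  flatten [seq
    [seq if [set u; v] \in edges I then (cost I i [set u; v])%:~R else 0
       | u <- enum 'I_n, v <- enum 'I_n]
    | i <- enum 'I_d.+1].

Definition initial_state I : state R :=
  State (fun=> 0%N) (fun=> 0)
    (fun a => nth 0%N (input_words I) a) (fun a => nth 0 (input_reals I) a).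

(* Word register 0 tells whether a next breakpoint is reported, in which case
   the real registers 0, ..., d - 1 contain it. *)
Definition correct_output I (s : state R) : Prop :=
  (wreg s 0 = 1%N /\ inst_next_breakpoint I (\row_(i < d) rreg s i)) \/
  (wreg s 0 = 0%N /\ ~ exists x, inst_next_breakpoint I x).

(* The probability that p, run on I with words below W, halts within T steps
   with a correct output. *)
Definition success_prob (W T : nat) (p : program) I : R :=
  prob_halts_within W T (correct_output I) p (initial_state I).

End Encoding.

(* Main.v *)
Require Import Defs.
From HB Require Import structures.
From mathcomp Require Import all_boot all_order all_algebra.
From mathcomp Require Import all_classical all_reals all_analysis.
From mathcomp Require Import zify lra ring.
Import Order.TTheory GRing.Theory Num.Theory.
Import numFieldNormedType.Exports.
Set Implicit Arguments.
Unset Strict Implicit.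
Unset Printing Implicit Defensive.
Local Open Scope ring_scope.

(** On the ray [mu + l * nu] the cost of a cut [C] is a line [va C + l * vb C] in
    [l].  The part of the ray inside the simplex is [0 <= l <= lmax], with [lmax]
    read off the barycentric coordinates, and [Z] starts along the line of the cut
    [C0] that minimises [(va, vb)] lexicographically.  The next breakpoint is the
    least [l] at which some line of smaller slope meets that line; if there is none
    up to [lmax], there is no breakpoint.

    Both cuts are found by the recursive contraction algorithm of Karger and Stein.
    For [C0] one contracts with the costs at [mu] (with the slopes once these
    vanish).  For the crossing cut one contracts with the costs at the incumbent
    [l], which is lowered whenever a contracted vertex gives an earlier crossing: as
    long as none does, every contracted vertex costs at least as much as the sought
    cut at [l], and therefore a random contraction is unlikely to destroy it.

    The recursion is unrolled into a loop over a counter: at step [l] the matrix of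
    level [j] is recomputed from that of level [j + 1] whenever [4 ^ j] divides [l].
    One run takes O(n^2 log n) time and succeeds with probability of order
    1 / log n, and O(log^2 n) runs give high probability. *)

(** The machine draws only uniform integers, so an edge is chosen by comparing prefix sums of exact
    real weights with a multiple of their total; an outcome receives at most one draw more than its
    share, and [n ^ 4] equally likely draws make this error small enough to be absorbed by a
    slightly weaker survival bound. Graphs are stored as Laplacians: the same row and column
    additions contract costs and slopes, the cost of a contracted vertex stands on the diagonal, and
    slopes of either sign are harmless because the two matrices are combined only when a weight is
    needed. Sizes halve from level to level, which words can compute exactly; the target then
    survives a level with probability 1/4, and four branches make up for it. A branch that has lost
    the target must still run on well-formed matrices, so a validity invariant that always holds is
    kept apart from a lower bound on an expected value that counts only living levels. The delicate
    case is a total weight of zero, where no edge can be drawn and the answer must be certified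
    directly. *)

Arguments upd T f i x j /.

(** * A structured language and its compilation to machine code *)

Inductive wexpr :=
| WVar of nat
| WNum of nat
| WBin of word_op & wexpr & wexpr
| WMem of wexpr.

Inductive rexpr :=
| RVar of nat
| RWord of wexpr
| RBin of real_op & rexpr & rexpr
| RMem of wexpr.

Inductive htest :=
| LtW of wexpr & wexpr
| EqW of wexpr & wexpr
| LtR of rexpr & rexpr
| EqR of rexpr & rexpr.

(** Loops run for a number of iterations that is computed on entry and kept in a second register, so
    termination and running time follow by induction. *)
Inductive hcmd :=
| HSkip
| HSetW of nat & wexpr
| HSetR of nat & rexpr
| HStore of wexpr & rexpr
| HIf of htest & hcmd & hcmd
| HFor of nat & nat & wexpr & hcmd
| HRand of nat & wexpr
| HSeq of hcmd & hcmd.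

(* The temporaries of the compiled code are the registers from [k] on. *)
Fixpoint compile_w (e : wexpr) (k : nat) : program :=
  match e with
  | WVar i => [:: Do (WCopy k i)]
  | WNum c => [:: Do (WConst k c)]
  | WBin o a b => compile_w a k ++ compile_w b k.+1 ++ [:: Do (WOp o k k k.+1)]
  | WMem a => compile_w a k ++ [:: Do (WLoad k k)]
  end.

Fixpoint compile_r (e : rexpr) (k : nat) : program :=
  match e with
  | RVar i => [:: Do (RCopy k i)]
  | RWord a => compile_w a k ++ [:: Do (ROfWord k k)]
  | RBin o a b => compile_r a k ++ compile_r b k.+1 ++ [:: Do (ROp o k k k.+1)]
  | RMem a => compile_w a k ++ [:: Do (RLoad k k)]
  end.

Definition compile_t (t : htest) (k : nat) : program * test :=
  match t with
  | LtW a b => (compile_w a k ++ compile_w b k.+1, TWordLt k k.+1)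
  | EqW a b => (compile_w a k ++ compile_w b k.+1, TWordEq k k.+1)
  | LtR a b => (compile_r a k ++ compile_r b k.+1, TRealLt k k.+1)
  | EqR a b => (compile_r a k ++ compile_r b k.+1, TRealEq k k.+1)
  end.

Fixpoint compile (k : nat) (c : hcmd) : program :=
  match c with
  | HSkip => [::]
  | HSetW i e => compile_w e k ++ [:: Do (WCopy i k)]
  | HSetR i e => compile_r e k ++ [:: Do (RCopy i k)]
  | HStore a e => compile_w a k ++ compile_r e k.+1 ++ [:: Do (RStore k k.+1)]
  | HIf t a b =>
      (compile_t t k).1 ++ [:: If (compile_t t k).2 (compile k a) (compile k b)]
  | HFor i ib e a =>
      compile_w e k ++ [:: Do (WCopy ib k); Do (WConst i 0);
        While (TWordLt i ib)
          (compile k a ++ [:: Do (WConst k 1); Do (WOp WAdd i i k)])]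
  | HRand i e => compile_w e k ++ [:: Do (Rand i k)]
  | HSeq a b => compile k a ++ compile k b
  end.

(** A syntactic footprint for the frame condition. The temporaries of the compiled code are left
    out, since the simulation relation ignores them. *)
Fixpoint written_w (c : hcmd) : seq nat :=
  match c with
  | HSetW i _ | HRand i _ => [:: i]
  | HIf _ a b | HSeq a b => written_w a ++ written_w b
  | HFor i ib _ a => i :: ib :: written_w a
  | _ => [::]
  end.

Fixpoint written_r (c : hcmd) : seq nat :=
  match c with
  | HSetR i _ => [:: i]
  | HIf _ a b | HSeq a b => written_r a ++ written_r b
  | HFor _ _ _ a => written_r a
  | _ => [::]
  end.

Fixpoint stores (c : hcmd) : bool :=
  match c with
  | HStore _ _ => true
  | HIf _ a b | HSeq a b => stores a || stores b
  | HFor _ _ _ a => stores a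
  | _ => false
  end.

(** * A Hoare logic with expected values for compiled code *)

Section Logic.
Variables (R : realType) (W TB : nat).
Notation st := (state R).
Notation P := (@prob_halts_within R W).
Implicit Types (s : st) (c : hcmd) (v : R) (V : st -> R).

Definition setw s i x : st := State (upd (wreg s) i x) (rreg s) (wmem s) (rmem s).

Lemma prob_ge0 T Q k s : 0 <= P T Q k s.
Proof.
elim: T k s => [|T IH] k s /=; case: step => [[k' ss]|] //=; rewrite ?ler0n //.
by rewrite divr_ge0 ?ler0n // sumr_ge0 // => s' _; exact: IH.
Qed.

(** A run that has not halted counts as [0] and a halted one keeps its value, so more time never
    hurts. *)
Lemma prob_leS T Q k s : P T Q k s <= P T.+1 Q k s.
Proof.
elim: T k s => [|T IH] k s.
  rewrite /=; case: step => [[k' ss]|] //=.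
  by rewrite divr_ge0 ?ler0n // sumr_ge0 // => s' _; exact: (prob_ge0 0).
rewrite [leLHS]/= [leRHS]/=; case E: step => [[k' ss]|] //=.
by rewrite ler_wpM2r ?invr_ge0 ?ler0n // ler_sum // => s' _; exact: IH.
Qed.

Lemma prob_le T T' Q k s : (T <= T')%N -> P T Q k s <= P T' Q k s.
Proof.
move=> /subnK<-; elim: (T' - T)%N => [|m IH] //.
by apply: le_trans IH _; rewrite addSn; exact: prob_leS.
Qed.

Lemma prob_do T Q a k s s' : exec W a s = [:: s'] ->
  P T.+1 Q (Do a :: k) s = P T Q k s'.
Proof. by move=> E; rewrite /= E big_seq1 /= divr1. Qed.

Fixpoint weval s (e : wexpr) : nat :=
  match e with
  | WVar i => wreg s i
  | WNum c => c
  | WBin o a b => eval_wop o (weval s a) (weval s b)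
  | WMem a => wmem s (weval s a)
  end.

(** Under this condition the reduction modulo [W] is the identity on every intermediate value, so
    the machine computes as over the naturals. *)
Fixpoint wsafe s (e : wexpr) : bool :=
  match e with
  | WVar i => (i < TB)%N
  | WNum c => (c < W)%N
  | WBin o a b =>
      [&& wsafe s a, wsafe s b & (eval_wop o (weval s a) (weval s b) < W)%N]
  | WMem a => wsafe s a && (wmem s (weval s a) < W)%N
  end.

Fixpoint reval s (e : rexpr) : R :=
  match e with
  | RVar i => rreg s i
  | RWord a => (weval s a)%:R
  | RBin o a b => eval_rop o (reval s a) (reval s b)
  | RMem a => rmem s (weval s a)
  end.

Fixpoint rsafe s (e : rexpr) : bool :=
  match e with
  | RVar i => (i < TB)%N
  | RWord a | RMem a => wsafe s a
  | RBin o a b => rsafe s a && rsafe s b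
  end.

Definition teval s (t : htest) : bool :=
  match t with
  | LtW a b => (weval s a < weval s b)%N
  | EqW a b => weval s a == weval s b
  | LtR a b => reval s a < reval s b
  | EqR a b => reval s a == reval s b
  end.

Definition tsafe s (t : htest) : bool :=
  match t with
  | LtW a b | EqW a b => wsafe s a && wsafe s b
  | LtR a b | EqR a b => rsafe s a && rsafe s b
  end.

Definition agree k s s0 : Prop :=
  [/\ forall i, (i < k)%N -> wreg s0 i = wreg s i,
      forall i, (i < k)%N -> rreg s0 i = rreg s i,
      wmem s0 = wmem s & rmem s0 = rmem s].

Definition bounded s : Prop := forall i, (i < TB)%N -> (wreg s i < W)%N.

(* The machine state [s0] is described by the abstract state [s], whatever the
   temporaries of [s0] contain. *)
Definition sim s s0 : Prop := agree TB s s0 /\ bounded s.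

Lemma agree_refl k s : agree k s s.
Proof. by []. Qed.

Lemma agree_le k k' s s0 : (k' <= k)%N -> agree k s s0 -> agree k' s s0.
Proof.
move=> le [h1 h3 h4 h5]; split=> // i lti.
  by apply: h1; exact: leq_trans lti le.
by apply: h3; exact: leq_trans lti le.
Qed.

Lemma agree_trans k s1 s2 s3 : agree k s1 s2 -> agree k s2 s3 -> agree k s1 s3.
Proof.
move=> [h1 h3 h4 h5] [g1 g3 g4 g5]; split; rewrite ?g4 ?g5 // => i lti.
  by rewrite g1 ?h1.
by rewrite g3 ?h3.
Qed.

Lemma bounded_agree s s0 : agree TB s s0 -> bounded s -> bounded s0.
Proof. by move=> [h _ _ _] b i lti; rewrite h // b. Qed.

Lemma agree_weval s s0 e : agree TB s s0 -> wsafe s e -> weval s0 e = weval s e.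
Proof.
move=> [h1 h3 h4 h5]; elim: e => [i|c|o a IHa b IHb|a IHa] //=.
- exact: h1.
- by move=> /and3P[/IHa-> /IHb->].
- by move=> /andP[/IHa->]; rewrite h4.
Qed.

Lemma agree_wsafe s s0 e : agree TB s s0 -> wsafe s e -> wsafe s0 e.
Proof.
move=> A; elim: e => [i|c|o a IHa b IHb|a IHa] //=.
- by move=> /and3P[sa sb ?]; rewrite IHa ?IHb ?(agree_weval A).
- by move=> /andP[sa]; rewrite (agree_weval A) // IHa //; case: A => _ _ ->.
Qed.

Lemma agree_reval s s0 e : agree TB s s0 -> rsafe s e -> reval s0 e = reval s e.
Proof.
move=> A; elim: e => [i|a|o a IHa b IHb|a] //=.
- by case: A => _ h _ _; exact: h.
- by move=> sa; rewrite (agree_weval A).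
- by move=> /andP[/IHa-> /IHb->].
- by move=> sa; rewrite (agree_weval A) //; case: A => _ _ _ ->.
Qed.

Lemma agree_rsafe s s0 e : agree TB s s0 -> rsafe s e -> rsafe s0 e.
Proof.
move=> A; elim: e => [i|a|o a IHa b IHb|a] //=; try exact: agree_wsafe.
by move=> /andP[/IHa-> /IHb->].
Qed.

Lemma weval_lt s e : bounded s -> wsafe s e -> (weval s e < W)%N.
Proof. by move=> h; case: e => [i /h|c|o a b /and3P[]|a /andP[]]. Qed.

(** Code for expressions is deterministic and of fixed length; hence an exact equality of
    probabilities, behind which any continuation fits. *)
Lemma compile_w_ok e k s : (TB <= k)%N -> bounded s -> wsafe s e ->
  exists s1, [/\ agree k s s1, wreg s1 k = weval s e &
  forall T Q q, P (size (compile_w e k) + T) Q (compile_w e k ++ q) s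
                = P T Q q s1].
Proof.
elim: e k s => [i|c|o a IHa b IHb|a IHa] k s lek B /=.
- move=> lti; exists (set_wreg W s k (wreg s i)); split.
  + by split=> //= j ltj; rewrite (ltn_eqF ltj).
  + by rewrite /= eqxx modn_small ?B.
  + by move=> T Q q; rewrite /= big_seq1 divr1.
- move=> ltc; exists (set_wreg W s k c); split.
  + by split=> //= j ltj; rewrite (ltn_eqF ltj).
  + by rewrite /= eqxx modn_small.
  + by move=> T Q q; rewrite /= big_seq1 divr1.
- case/and3P => sa sb lt.
  have [s1 [A1 e1 p1]] := IHa k s lek B sa.
  have A1' := agree_le lek A1.
  have [|s2 [A2 e2 p2]] := IHb k.+1 s1 (leqW lek) (bounded_agree A1' B).
    exact: agree_wsafe A1' sb.
  exists (set_wreg W s2 k (eval_wop o (wreg s2 k) (wreg s2 k.+1))); split.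
  + apply: (agree_trans A1); apply: (agree_trans (agree_le (leqnSn k) A2)).
    by split=> //= j ltj; rewrite (ltn_eqF ltj).
  + rewrite /= eqxx e2 (agree_weval A1') //; case: A2 => -> // _ _ _.
    by rewrite e1 modn_small.
  + move=> T Q q; rewrite !size_cat -!catA -!addnA p1 p2 add1n.
    exact: prob_do.
- case/andP => sa lt.
  have [s1 [A1 e1 p1]] := IHa k s lek B sa.
  exists (set_wreg W s1 k (wmem s1 (wreg s1 k))); split.
  + apply: (agree_trans A1).
    by split=> //= j ltj; rewrite (ltn_eqF ltj).
  + by rewrite /= eqxx e1; case: A1 => _ _ -> _; rewrite modn_small.
  + by move=> T Q q; rewrite size_cat -catA -addnA p1 add1n; exact: prob_do.
Qed.

Lemma compile_r_ok e k s : (TB <= k)%N -> bounded s -> rsafe s e ->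
  exists s1, [/\ agree k s s1, rreg s1 k = reval s e &
  forall T Q q, P (size (compile_r e k) + T) Q (compile_r e k ++ q) s
                = P T Q q s1].
Proof.
elim: e k s => [i|a|o a IHa b IHb|a] k s lek B /=.
- move=> lti; exists (set_rreg s k (rreg s i)); split.
  + by split=> //= j ltj; rewrite (ltn_eqF ltj).
  + by rewrite /= eqxx.
  + by move=> T Q q; rewrite /= big_seq1 divr1.
- move=> sa.
  have [s1 [A1 e1 p1]] := compile_w_ok lek B sa.
  exists (set_rreg s1 k (wreg s1 k)%:R); split.
  + apply: (agree_trans A1).
    by split=> //= j ltj; rewrite (ltn_eqF ltj).
  + by rewrite /= eqxx e1.
  + by move=> T Q q; rewrite size_cat -catA -addnA p1 add1n; exact: prob_do.
- case/andP => sa sb.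
  have [s1 [A1 e1 p1]] := IHa k s lek B sa.
  have A1' := agree_le lek A1.
  have [|s2 [A2 e2 p2]] := IHb k.+1 s1 (leqW lek) (bounded_agree A1' B).
    exact: agree_rsafe A1' sb.
  exists (set_rreg s2 k (eval_rop o (rreg s2 k) (rreg s2 k.+1))); split.
  + apply: (agree_trans A1); apply: (agree_trans (agree_le (leqnSn k) A2)).
    by split=> //= j ltj; rewrite (ltn_eqF ltj).
  + rewrite /= eqxx e2 (agree_reval A1') //; case: A2 => _ -> // _ _.
    by rewrite e1.
  + move=> T Q q; rewrite !size_cat -!catA -!addnA p1 p2 add1n.
    exact: prob_do.
- move=> sa.
  have [s1 [A1 e1 p1]] := compile_w_ok lek B sa.
  exists (set_rreg s1 k (rmem s1 (wreg s1 k))); split.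
  + apply: (agree_trans A1).
    by split=> //= j ltj; rewrite (ltn_eqF ltj).
  + by rewrite /= eqxx e1; case: A1 => _ _ _ ->.
  + by move=> T Q q; rewrite size_cat -catA -addnA p1 add1n; exact: prob_do.
Qed.

Lemma compile_t_ok t k s : (TB <= k)%N -> bounded s -> tsafe s t ->
  exists s1, [/\ agree k s s1, eval_test (compile_t t k).2 s1 = teval s t &
  forall T Q q, P (size (compile_t t k).1 + T) Q ((compile_t t k).1 ++ q) s
                = P T Q q s1].
Proof.
move=> lek B.
have Hw a b : wsafe s a && wsafe s b ->
  exists s1, [/\ agree k s s1, wreg s1 k = weval s a, wreg s1 k.+1 = weval s b &
   forall T Q q, P (size (compile_w a k ++ compile_w b k.+1) + T) Q
     ((compile_w a k ++ compile_w b k.+1) ++ q) s = P T Q q s1].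
  case/andP=> sa sb.
  have [s1 [A1 e1 p1]] := compile_w_ok lek B sa.
  have A1' := agree_le lek A1.
  have [|s2 [A2 e2 p2]] := compile_w_ok (leqW lek) (bounded_agree A1' B) (e := b).
    exact: agree_wsafe A1' sb.
  exists s2; split.
  - exact: (agree_trans A1 (agree_le (leqnSn k) A2)).
  - by case: A2 => -> // _ _ _.
  - by rewrite e2 (agree_weval A1').
  - by move=> T Q q; rewrite size_cat -catA -addnA p1 p2.
have Hr a b : rsafe s a && rsafe s b ->
  exists s1, [/\ agree k s s1, rreg s1 k = reval s a, rreg s1 k.+1 = reval s b &
   forall T Q q, P (size (compile_r a k ++ compile_r b k.+1) + T) Q
     ((compile_r a k ++ compile_r b k.+1) ++ q) s = P T Q q s1].
  case/andP=> sa sb.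
  have [s1 [A1 e1 p1]] := compile_r_ok lek B sa.
  have A1' := agree_le lek A1.
  have [|s2 [A2 e2 p2]] := compile_r_ok (leqW lek) (bounded_agree A1' B) (e := b).
    exact: agree_rsafe A1' sb.
  exists s2; split.
  - exact: (agree_trans A1 (agree_le (leqnSn k) A2)).
  - by case: A2 => _ -> // _ _.
  - by rewrite e2 (agree_reval A1').
  - by move=> T Q q; rewrite size_cat -catA -addnA p1 p2.
by case: t => a b /=; [case/Hw|case/Hw|case/Hr|case/Hr] => s1 [A1 e1 e2 p];
  exists s1; split=> //; rewrite e1 e2.
Qed.

Definition frame c s s' : Prop :=
  [/\ forall i, i \notin written_w c -> wreg s' i = wreg s i,
      forall i, i \notin written_r c -> rreg s' i = rreg s i,
      wmem s' = wmem s & ~~ stores c -> rmem s' = rmem s].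

(* Within [t] steps [c] leads from [s] to a random state [s'] for which the
   expectation of [V s'] is at least [v]. *)
Definition hoare t c s v V : Prop :=
  forall k T Q,
    (forall s' s0, frame c s s' -> sim s' s0 -> V s' <= P T Q k s0) ->
    forall s0, sim s s0 -> v <= P (t + T) Q (compile TB c ++ k) s0.

(** The value [v] is arbitrary, so a deterministic fact composes with any expected value carried by
    the surrounding random code. *)
Definition surely t c s (Post : st -> Prop) : Prop :=
  forall v, 0 <= v -> hoare t c s v (fun s' => if `[< Post s' >] then v else 0).

(** Values are compared only where [V] is positive, since elsewhere the bound follows from the
    nonnegativity of probabilities. This is what allows [0] to encode excluded outcomes. *)
Lemma hoare_le t t' c s v v' V V' : hoare t c s v V -> (t <= t')%N -> v' <= v ->
  (forall s', frame c s s' -> bounded s' -> 0 < V s' -> V s' <= V' s') ->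
  hoare t' c s v' V'.
Proof.
move=> H let' lev leV k T Q HV s0 S0.
apply: (le_trans lev); apply: (@le_trans _ _ (P (t + T) Q (compile TB c ++ k) s0)).
  apply: H S0 => s' s1 F S1.
  have [V0|V0] := leP (V s') 0; first exact: le_trans V0 (prob_ge0 _ _ _ _).
  by apply: (le_trans (leV _ F _ V0)); [case: S1|exact: HV].
by apply: prob_le; rewrite leq_add2r.
Qed.

Lemma frame_trans c c' c'' s1 s2 s3 :
  {subset written_w c <= written_w c''} -> {subset written_w c' <= written_w c''} ->
  {subset written_r c <= written_r c''} -> {subset written_r c' <= written_r c''} ->
  (stores c || stores c' -> stores c'') ->
  frame c s1 s2 -> frame c' s2 s3 -> frame c'' s1 s3.
Proof.
move=> sw sw' sr sr' ss [h1 h2 h3 h4] [g1 g2 g3 g4]; split.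
- by move=> i ni; rewrite g1 ?h1 //; apply: contra ni; [exact: sw|exact: sw'].
- by move=> i ni; rewrite g2 ?h2 //; apply: contra ni; [exact: sr|exact: sr'].
- by rewrite g3.
- by move=> /(contra ss); rewrite negb_or => /andP[/h4 <- /g4].
Qed.

Lemma frame_sub c c'' s1 s2 :
  {subset written_w c <= written_w c''} -> {subset written_r c <= written_r c''} ->
  (stores c -> stores c'') -> frame c s1 s2 -> frame c'' s1 s2.
Proof.
move=> sw sr ss F; apply: (@frame_trans c c c'' s1 s1 s2) => //.
by rewrite orbb.
Qed.

Lemma hoare_seq t1 t2 c1 c2 s v V1 V2 :
  hoare t1 c1 s v V1 ->
  (forall s', frame c1 s s' -> bounded s' -> 0 < V1 s' -> hoare t2 c2 s' (V1 s') V2) ->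
  hoare (t1 + t2) (HSeq c1 c2) s v V2.
Proof.
move=> H1 H2 k T Q HV s0 S0; rewrite [compile _ _]/= -catA -addnA; apply: H1 S0 => s1 s1' F1 S1.
have [V0|V0] := leP (V1 s1) 0; first exact: le_trans V0 (prob_ge0 _ _ _ _).
have B1 : bounded s1 by case: S1.
apply: (H2 s1 F1 B1 V0) S1 => s2 s2' F2 S2; apply: HV S2.
by apply: frame_trans F1 F2 => //= i; rewrite mem_cat => ->; rewrite ?orbT.
Qed.

Lemma hoare_skip s v : hoare 0 HSkip s v (fun s' => if `[< s' = s >] then v else 0).
Proof.
move=> k T Q HV s0 S0; apply: le_trans (HV s s0 _ S0) => //.
by case: asboolP.
Qed.

Lemma hoare_setw i e s v : (0 <= v) -> (i < TB)%N -> wsafe s e ->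
  hoare (size (compile_w e TB)).+1 (HSetW i e) s v
    (fun s' => if `[< s' = setw s i (weval s e) >] then v else 0).
Proof.
move=> v0 lti se k T Q HV s0 [A0 B0].
have Bs0 := bounded_agree A0 B0.
have [s1 [A1 e1 p1]] := compile_w_ok (leqnn TB) Bs0 (agree_wsafe A0 se).
rewrite [compile _ _]/= -catA addSn -addnS p1 (prob_do _ _ _ (s' := set_wreg W s1 i (wreg s1 TB))) //.
apply: le_trans (HV (setw s i (weval s e)) _ _ _); first by case: asboolP.
- split=> //= j; rewrite inE => /negbTE ->//.
- have [g1 g2 g3 g4] := agree_trans A0 A1.
  rewrite e1 (agree_weval A0) //; split; last first.
    by move=> j ltj /=; case: eqP => // _; [exact: weval_lt|exact: B0].
  split=> //= j ltj.
  by case: eqP => // _; [rewrite modn_small // weval_lt|exact: g1].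
Qed.

Lemma hoare_setr i e s v : (0 <= v) -> (i < TB)%N -> rsafe s e ->
  hoare (size (compile_r e TB)).+1 (HSetR i e) s v
    (fun s' => if `[< s' = set_rreg s i (reval s e) >] then v else 0).
Proof.
move=> v0 lti se k T Q HV s0 [A0 B0].
have Bs0 := bounded_agree A0 B0.
have [s1 [A1 e1 p1]] := compile_r_ok (leqnn TB) Bs0 (agree_rsafe A0 se).
rewrite [compile _ _]/= -catA addSn -addnS p1 (prob_do _ _ _ (s' := set_rreg s1 i (rreg s1 TB))) //.
apply: le_trans (HV (set_rreg s i (reval s e)) _ _ _); first by case: asboolP.
- split=> //= j; rewrite inE => /negbTE ->//.
- have [g1 g2 g3 g4] := agree_trans A0 A1.
  rewrite e1 (agree_reval A0) //; split=> //.
  by split=> //= j ltj; case: eqP => // _; exact: g2.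
Qed.

Lemma hoare_store a e s v : (0 <= v) -> wsafe s a -> rsafe s e ->
  hoare (size (compile_w a TB) + size (compile_r e TB.+1)).+1 (HStore a e) s v
    (fun s' => if `[< s' = set_rmem s (weval s a) (reval s e) >] then v else 0).
Proof.
move=> v0 sa se k T Q HV s0 [A0 B0].
have Bs0 := bounded_agree A0 B0.
have [s1 [A1 e1 p1]] := compile_w_ok (leqnn TB) Bs0 (agree_wsafe A0 sa).
have A01 := agree_trans A0 A1.
have [|s2 [A2 e2 p2]] := compile_r_ok (leqnSn TB) (bounded_agree A01 B0) (e := e).
  exact: agree_rsafe A01 se.
rewrite [compile _ _]/= -!catA addSn -addnS -addnA p1 p2.
rewrite (prob_do _ _ _ (s' := set_rmem s2 (wreg s2 TB) (rreg s2 TB.+1))) //.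
apply: le_trans (HV (set_rmem s (weval s a) (reval s e)) _ _ _); first by case: asboolP.
- by [].
- have [g1 g2 g3 g4] := agree_trans A01 (agree_le (leqnSn _) A2).
  split=> //; split=> //=.
  rewrite e2 (agree_reval A01) // g4; case: A2 => -> // _ _ _.
  by rewrite e1 (agree_weval A0).
Qed.

Lemma hoare_if t a b s v V ta tb : tsafe s t ->
  (teval s t -> hoare ta a s v V) -> (~~ teval s t -> hoare tb b s v V) ->
  hoare ((size (compile_t t TB).1).+1 + (ta + tb)) (HIf t a b) s v V.
Proof.
move=> st Ha Hb k T Q HV s0 [A0 B0].
have Bs0 := bounded_agree A0 B0.
have st0 : tsafe s0 t.
  by case: t st {Ha Hb HV} => x y /= /andP[sx sy]; rewrite ?(agree_wsafe A0) ?(agree_rsafe A0).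
have te0 : teval s0 t = teval s t.
  by case: t st {st0 Ha Hb HV} => x y /= /andP[sx sy]; rewrite ?(agree_weval A0) ?(agree_reval A0).
have [s1 [A1 e1 p1]] := compile_t_ok (leqnn TB) Bs0 st0.
have S1 : sim s s1 by split=> //; exact: (agree_trans A0 A1).
rewrite [compile _ _]/= -catA addSn -addnS -addnA p1 /= big_seq1 divr1 e1 te0.
case: ifPn => ht.
  apply: le_trans (prob_le _ _ _ (_ : ta + T <= _)%N); last by lia.
  apply: (Ha ht) S1 => s' s0' F S'; apply: HV S'.
  by apply: frame_sub F => //= [i|i|]; rewrite ?mem_cat => ->.
apply: le_trans (prob_le _ _ _ (_ : tb + T <= _)%N); last by lia.
apply: (Hb ht) S1 => s' s0' F S'; apply: HV S'.
by apply: frame_sub F => //= [i|i|]; rewrite ?mem_cat => ->; rewrite orbT.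
Qed.

Lemma hoare_rand i e s V : (i < TB)%N -> wsafe s e -> (0 < weval s e)%N ->
  hoare (size (compile_w e TB)).+1 (HRand i e) s
    ((\sum_(x < weval s e) V (setw s i x)) / (weval s e)%:R) V.
Proof.
move=> lti se e0 k T Q HV s0 [A0 B0].
have Bs0 := bounded_agree A0 B0.
have [s1 [A1 e1 p1]] := compile_w_ok (leqnn TB) Bs0 (agree_wsafe A0 se).
rewrite [compile _ _]/= -catA addSn -addnS p1 /= e1 (agree_weval A0) //.
rewrite size_map size_iota big_map (maxn_idPr e0).
rewrite ler_wpM2r ?invr_ge0 ?ler0n // -(big_mkord xpredT (fun x => V (setw s i x))).
rewrite /index_iota subn0 big_seq_cond [leRHS]big_seq_cond ler_sum // => x.
rewrite mem_iota add0n leq0n /= andbT => ltx.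
have ltxW : (x < W)%N by apply: leq_trans ltx (ltnW _); exact: weval_lt.
apply: HV.
- by split=> //= j; rewrite inE => /negbTE ->.
- have [g1 g2 g3 g4] := agree_trans A0 A1.
  split; last by move=> j ltj /=; case: eqP => // _; exact: B0.
  split=> //= j ltj.
  by case: eqP => // _; [rewrite modn_small | exact: g1].
Qed.

(** [V x] is the expected value promised on entering iteration [x], a loop invariant with
    probabilities. The time [tb x] may depend on [x], on which the amortised analysis of a phase
    relies. Each iteration adds three steps for the test and the increment; the last three set both
    registers and make the failing test. *)
Lemma hoare_for i ib e c s N tb (V : nat -> st -> R) :
  (i < TB)%N -> (ib < TB)%N -> i != ib ->
  i \notin written_w c -> ib \notin written_w c ->
  wsafe s e -> weval s e = N ->
  (forall x s', (x < N)%N -> frame (HFor i ib e c) s s' -> bounded s' ->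
     wreg s' i = x -> wreg s' ib = N -> 0 < V x s' ->
     hoare (tb x) c s' (V x s') (fun s'' => V x.+1 (setw s'' i x.+1))) ->
  hoare (\sum_(x < N) (tb x + 3) + (size (compile_w e TB) + 3)) (HFor i ib e c) s
    (V 0%N (setw (setw s ib N) i 0)) (V N).
Proof.
move=> lti ltib nei ni nib se eN H k T Q HV s0 [A0 B0].
have Bs0 := bounded_agree A0 B0.
have [s1 [A1 e1 p1]] := compile_w_ok (leqnn TB) Bs0 (agree_wsafe A0 se).
have NW : (N < W)%N by rewrite -eN weval_lt.
rewrite [compile _ _]/= -catA.
have -> : (\sum_(x < N) (tb x + 3) + (size (compile_w e TB) + 3) + T =
  size (compile_w e TB) + (\sum_(x < N) (tb x + 3) + T.+1).+2)%N by lia.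
rewrite p1 ![_ ++ k]/=.
set s2 := setw (setw s ib N) i 0.
rewrite (@prob_do _ _ _ _ _ (set_wreg W s1 ib (wreg s1 TB))) //.
rewrite (@prob_do _ _ _ _ _ (set_wreg W (set_wreg W s1 ib (wreg s1 TB)) i 0)) //.
have [g1 g2 g3 g4] := agree_trans A0 A1.
have S2 : sim s2 (set_wreg W (set_wreg W s1 ib (wreg s1 TB)) i 0).
  split; last first.
    move=> j ltj /=; case: eqP => // _; first by apply: leq_trans NW.
    by case: eqP => // _; exact: B0.
  split=> //= j ltj.
  case: eqP => // _; first by rewrite modn_small //; apply: leq_trans NW.
  case: eqP => // _; last exact: g1.
  by rewrite e1 (agree_weval A0) // eN modn_small.
have F2 : frame (HFor i ib e c) s s2.
  by split=> //= j; rewrite !inE !negb_or => /and3P[/negbTE-> /negbTE->].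
have Ei : wreg s2 i = 0%N by rewrite /s2 /= eqxx.
have Eb : wreg s2 ib = N by rewrite /s2 /= eq_sym (negbTE nei) eqxx.
move: {g1 g2 g3 g4} (set_wreg _ _ i 0) S2 F2 Ei Eb; rewrite {}/s2.
move: (setw _ i 0) => s2 s2' S2 F2 Ei Eb.
have -> : (\sum_(x < N) (tb x + 3) = \sum_(0 <= x < N) (tb x + 3))%N by rewrite big_mkord.
set body := (compile TB c ++ _).
suff: forall m x s2 s2', (x + m = N)%N -> sim s2 s2' -> frame (HFor i ib e c) s s2 ->
   wreg s2 i = x -> wreg s2 ib = N ->
   V x s2 <= P (\sum_(x <= y < N) (tb y + 3) + T.+1) Q (While (TWordLt i ib) body :: k) s2'.
  by apply.
elim=> [|m IH] x t t' xm S F ei eb.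
  have E : x = N by rewrite -xm addn0.
  rewrite E big_geq // add0n /= big_seq1 divr1.
  have [[h1 _ _ _] _] := S.
  by rewrite !h1 // ei eb E ltnn; exact: HV S.
have ltx : (x < N)%N by rewrite -xm addnS ltnS leq_addr.
rewrite big_ltn //; set Sx := (\sum_(x.+1 <= _ < N) _)%N.
have -> : (tb x + 3 + Sx + T.+1 = (tb x + (Sx + T.+1).+2).+1)%N by lia.
rewrite [leRHS]/= big_seq1 divr1.
have [[h1 _ _ _] Bt] := S.
rewrite !h1 // ei eb ltx.
have [V0|V0] := leP (V x t) 0; first exact: le_trans V0 (prob_ge0 _ _ _ _).
rewrite {1}/body -catA.
apply: (H x t ltx F Bt ei eb V0) S => u u' Fu Su.
have [hw hr hm hs] := Fu.
have eiu : wreg u i = x by rewrite hw.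
have ebu : wreg u ib = N by rewrite hw.
rewrite (@prob_do _ _ _ _ _ (set_wreg W u' TB 1)) //.
rewrite (@prob_do _ _ _ _ _ (set_wreg W (set_wreg W u' TB 1) i
   ((wreg (set_wreg W u' TB 1) i) + (wreg (set_wreg W u' TB 1) TB)))) //.
have [[k1 k2 k3 k4] Bu] := Su.
apply: IH.
- by rewrite addSnnS.
- split; last first.
    by move=> j ltj /=; case: eqP => // _; [exact: leq_trans NW | exact: Bu].
  split=> //= j ltj.
  case: eqP => // [_|ne].
    rewrite (ltn_eqF lti) eqxx k1 // eiu (@modn_small 1) ?addn1 ?modn_small //.
      exact: leq_trans NW.
    by apply: leq_trans NW; rewrite ltnS; case: (N) ltx.
  by rewrite (ltn_eqF ltj) k1.
- have F' : frame (HFor i ib e c) s u.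
    apply: frame_trans F Fu => //= [j|]; last by rewrite orbb.
    by rewrite !inE => ->; rewrite !orbT.
  case: F' => q1 q2 q3 q4; split=> //= j nj; rewrite -q1 //.
  by move: nj; rewrite !inE !negb_or => /and3P[/negbTE-> _ _].
- by rewrite /= eqxx.
- by rewrite /= eq_sym (negbTE nei).
Qed.
End Logic.

(* A loop is charged for a single iteration of its body. *)
Fixpoint hcost (k : nat) (c : hcmd) : nat :=
  match c with
  | HSkip => 0
  | HSetW i e => (size (compile_w e k)).+1
  | HSetR i e => (size (compile_r e k)).+1
  | HStore a e => (size (compile_w a k) + size (compile_r e k.+1)).+1
  | HIf t a b => (size (compile_t t k).1).+1 + (hcost k a + hcost k b)
  | HFor _ _ e a => hcost k a + (size (compile_w e k) + 6)
  | HRand i e => (size (compile_w e k)).+1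
  | HSeq a b => hcost k a + hcost k b
  end.

(** * Deterministic commands and uniform time bounds *)

Section Surely.
Variables (R : realType) (W TB : nat).
Notation st := (state R).
Implicit Types (s : st) (c : hcmd) (Post : st -> Prop).
Notation surely := (@surely R W TB).
Notation hoare := (@hoare R W TB).
Notation bounded := (@bounded R W TB).

Lemma surely_hoare t c s Post v (V : st -> R) : surely t c s Post -> 0 <= v ->
  (forall s', frame c s s' -> bounded s' -> Post s' -> v <= V s') ->
  hoare t c s v V.
Proof.
move=> H v0 HV; apply: hoare_le (H v v0) _ _ _ => // s' F B.
by case: asboolP => [p _|]; [exact: HV|rewrite ltxx].
Qed.

Lemma surely_le t t' c s Post Post' : surely t c s Post -> (t <= t')%N ->
  (forall s', frame c s s' -> bounded s' -> Post s' -> Post' s') ->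
  surely t' c s Post'.
Proof.
move=> H le HP v v0; apply: hoare_le (H v v0) le _ _ => // s' F B.
case: asboolP => [p _|]; last by rewrite ltxx.
by rewrite (asboolT (HP _ F B p)).
Qed.

Lemma surely_seq t1 t2 c1 c2 s P1 P2 : surely t1 c1 s P1 ->
  (forall s', frame c1 s s' -> bounded s' -> P1 s' -> surely t2 c2 s' P2) ->
  surely (t1 + t2) (HSeq c1 c2) s P2.
Proof.
move=> H1 H2 v v0; apply: hoare_seq (H1 v v0) _ => s' F B.
by case: asboolP => [p _|]; [exact: H2|rewrite ltxx].
Qed.

Lemma surely_skip s Post : Post s -> surely 0 HSkip s Post.
Proof.
move=> p v v0; apply: hoare_le (@hoare_skip R W TB s v) _ _ _ => // s' _ _.
by case: asboolP => [->|]; rewrite ?ltxx ?(asboolT p).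
Qed.

Lemma surely_setw i e s Post : (i < TB)%N -> wsafe W TB s e ->
  Post (setw s i (weval s e)) -> surely (hcost TB (HSetW i e)) (HSetW i e) s Post.
Proof.
move=> lti se p v v0; apply: hoare_le (hoare_setw v0 lti se) _ _ _ => // s' _ _.
by case: asboolP => [->|]; rewrite ?ltxx ?(asboolT p).
Qed.

Lemma surely_setr i e s Post : (i < TB)%N -> rsafe W TB s e ->
  Post (set_rreg s i (reval s e)) -> surely (hcost TB (HSetR i e)) (HSetR i e) s Post.
Proof.
move=> lti se p v v0; apply: hoare_le (hoare_setr v0 lti se) _ _ _ => // s' _ _.
by case: asboolP => [->|]; rewrite ?ltxx ?(asboolT p).
Qed.

Lemma surely_store a e s Post : wsafe W TB s a -> rsafe W TB s e ->
  Post (set_rmem s (weval s a) (reval s e)) ->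
  surely (hcost TB (HStore a e)) (HStore a e) s Post.
Proof.
move=> sa se p v v0; apply: hoare_le (hoare_store v0 sa se) _ _ _ => // s' _ _.
by case: asboolP => [->|]; rewrite ?ltxx ?(asboolT p).
Qed.

Lemma surely_if t a b s Post ta tb : tsafe W TB s t ->
  (teval s t -> surely ta a s Post) -> (~~ teval s t -> surely tb b s Post) ->
  surely ((size (compile_t t TB).1).+1 + (ta + tb)) (HIf t a b) s Post.
Proof.
by move=> st Ha Hb v v0; apply: hoare_if => // h; [exact: Ha|exact: Hb].
Qed.

Lemma surely_setw_seq i e s Post c t : (i < TB)%N -> wsafe W TB s e ->
  surely t c (setw s i (weval s e)) Post ->
  surely (hcost TB (HSetW i e) + t) (HSeq (HSetW i e) c) s Post.
Proof.
move=> lti se H; apply: (surely_seq (P1 := eq (setw s i (weval s e)))).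
  exact: surely_setw.
by move=> s' _ _ <-.
Qed.

Lemma surely_setr_seq i e s Post c t : (i < TB)%N -> rsafe W TB s e ->
  surely t c (set_rreg s i (reval s e)) Post ->
  surely (hcost TB (HSetR i e) + t) (HSeq (HSetR i e) c) s Post.
Proof.
move=> lti se H; apply: (surely_seq (P1 := eq (set_rreg s i (reval s e)))).
  exact: surely_setr.
by move=> s' _ _ <-.
Qed.

Lemma surely_store_seq a e s Post c t : wsafe W TB s a -> rsafe W TB s e ->
  surely t c (set_rmem s (weval s a) (reval s e)) Post ->
  surely (hcost TB (HStore a e) + t) (HSeq (HStore a e) c) s Post.
Proof.
move=> sa se H; apply: (surely_seq (P1 := eq (set_rmem s (weval s a) (reval s e)))).
  exact: surely_store.
by move=> s' _ _ <-.
Qed.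

Lemma surely_for i ib e c s N tb (Inv : nat -> st -> Prop) :
  (i < TB)%N -> (ib < TB)%N -> i != ib ->
  i \notin written_w c -> ib \notin written_w c ->
  wsafe W TB s e -> weval s e = N ->
  Inv 0%N (setw (setw s ib N) i 0) ->
  (forall x s', (x < N)%N -> frame (HFor i ib e c) s s' -> bounded s' ->
     wreg s' i = x -> wreg s' ib = N -> Inv x s' ->
     surely tb c s' (fun s'' => Inv x.+1 (setw s'' i x.+1))) ->
  surely (N * (tb + 3) + (size (compile_w e TB) + 3)) (HFor i ib e c) s (Inv N).
Proof.
move=> lti ltib ne ni nib se eN I0 H v v0.
have := @hoare_for R W TB i ib e c s N (fun=> tb)
  (fun x s' => if `[< Inv x s' >] then v else 0) lti ltib ne ni nib se eN _.
rewrite (asboolT I0) sum_nat_const card_ord; apply.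
move=> x s' ltx F B ei eb; case: asboolP => [p _|]; last by rewrite ltxx.
exact: H.
Qed.

(** The factor [N.+1] absorbs the initialisation and the failing test, so that times keep the shape
    of a size times the constant [hcost]. *)
Lemma surely_forN i ib e c s N (Inv : nat -> st -> Prop) :
  (i < TB)%N -> (ib < TB)%N -> i != ib ->
  i \notin written_w c -> ib \notin written_w c ->
  wsafe W TB s e -> weval s e = N ->
  Inv 0%N (setw (setw s ib N) i 0) ->
  (forall x s', (x < N)%N -> frame (HFor i ib e c) s s' -> bounded s' ->
     wreg s' i = x -> wreg s' ib = N -> Inv x s' ->
     surely (hcost TB c) c s' (fun s'' => Inv x.+1 (setw s'' i x.+1))) ->
  surely (N.+1 * hcost TB (HFor i ib e c)) (HFor i ib e c) s (Inv N).
Proof.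
move=> h1 h2 h3 h4 h5 h6 h7 h8 h9.
apply: surely_le (surely_for h1 h2 h3 h4 h5 h6 h7 h8 h9) _ _ => //=.
rewrite mulSn; nia.
Qed.

Lemma surely_seqN N c1 c2 s P1 P2 : surely (N * hcost TB c1) c1 s P1 ->
  (forall s', frame c1 s s' -> bounded s' -> P1 s' -> surely (N * hcost TB c2) c2 s' P2) ->
  surely (N * hcost TB (HSeq c1 c2)) (HSeq c1 c2) s P2.
Proof. by move=> H1 H2; rewrite /= mulnDr; exact: surely_seq H1 H2. Qed.

Lemma surelyN N c s Post : surely (hcost TB c) c s Post ->
  surely (N.+1 * hcost TB c) c s Post.
Proof. by move=> H; apply: surely_le H _ _ => //; rewrite mulSn leq_addr. Qed.
End Surely.

(** * Drawing an edge with probability proportional to its weight *)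

Section Selection.
Variable R : realType.
Implicit Types (w : nat -> R) (l : seq nat).

(** Inverse transform sampling: the result is the last element whose preceding prefix sum is at most
    [th], and [cur] if there is none. The scan does not stop early because program loops have a
    fixed number of iterations. *)
Fixpoint scan w (th acc : R) (cur : nat) l : nat :=
  if l is x :: l' then scan w th (acc + w x) (if acc <= th then x else cur) l'
  else cur.

Lemma scan_over w th acc cur l : (forall x, x \in l -> 0 <= w x) -> th < acc ->
  scan w th acc cur l = cur.
Proof.
elim: l acc => //= x l IH acc w0 lt; rewrite leNgt lt /= IH //.
  by move=> y yl; rewrite w0 // inE yl orbT.
by rewrite ltr_wpDr // w0 // mem_head.
Qed.

Lemma scan_mem w th acc cur l : scan w th acc cur l \in cur :: l.
Proof.
elim: l acc cur => [|x l IH] acc cur /=; first exact: mem_head.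
have := IH (acc + w x) (if acc <= th then x else cur).
by rewrite !inE; case: (acc <= th) => /orP[->|->]; rewrite ?orbT.
Qed.

Lemma scan_mem0 w th cur l : 0 <= th -> l != [::] -> scan w th 0 cur l \in l.
Proof. by case: l => // x l h _ /=; rewrite h; exact: scan_mem. Qed.

Lemma scanP w th acc cur l : uniq l -> (forall x, x \in l -> 0 <= w x) ->
  acc <= th -> th < acc + \sum_(y <- l) w y ->
  let x := scan w th acc cur l in
  let a := acc + \sum_(y <- take (index x l) l) w y in
  x \in l /\ a <= th < a + w x.
Proof.
elim: l acc cur => [|z l IH] acc cur /=.
  by move=> _ _ h1; rewrite big_nil addr0 => /(le_lt_trans h1); rewrite ltxx.
case/andP=> zl ul w0 le_acc; rewrite big_cons addrA => lt_tot; rewrite le_acc.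
have [le2|lt2] := leP (acc + w z) th.
  have [|xl h] := IH (acc + w z) z ul _ le2 lt_tot.
    by move=> y yl; rewrite w0 // inE yl orbT.
  have [e|ne] := eqVneq z (scan w th (acc + w z) z l).
    by rewrite e xl in zl.
  by rewrite inE xl orbT /= big_cons addrA.
rewrite scan_over //; first by rewrite mem_head eqxx /= big_nil addr0 le_acc lt2.
by move=> y yl; rewrite w0 // inE yl orbT.
Qed.

Lemma count_interval (m : nat) (a b : R) : a <= b ->
  (\sum_(0 <= U < m) (a <= U%:R < b)%R)%N%:R <= b - a + 1.
Proof.
move=> leab; set c := fun m => (\sum_(0 <= U < m) (a <= U%:R < b)%R)%N.
(* Strengthened for the induction: once something has been counted, only integers from [a] on were,
   hence at most [m - a] of those below [m]. *)
suff [] : (c m)%:R <= b - a + 1 /\ (c m = 0%N \/ (c m)%:R <= m%:R - a) by [].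
elim: m => [|m [IH1 IH2]]; rewrite /c.
  by rewrite big_geq //; split; [lra|left].
rewrite big_nat_recr //= -/(c m); case: (boolP (_ <= _ < _)) => [/andP[h1 h2]|_]; last first.
  rewrite addn0; split=> //; case: IH2 => [|h]; [by left|right].
  by rewrite -natr1; lra.
rewrite addn1 -!natr1; case: IH2 => [->|h]; split; try (right); lra.
Qed.

(** The draws [U] that select [x] lie in an interval of length [m * w x / tot]; the extra [1] is the
    rounding error of sampling with [m] equally likely values. *)
Lemma scan_count w l cur x (m : nat) : uniq l -> (forall x, x \in l -> 0 <= w x) ->
  let tot := \sum_(y <- l) w y in 0 < tot -> x \in l -> (0 < m)%N ->
  (\sum_(0 <= U < m) (scan w (tot * U%:R / m%:R)%R 0%R cur l == x))%N%:R
   <= m%:R * w x / tot + 1.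
Proof.
move=> ul w0 tot tot0 xl m0.
have m0' : 0 < m%:R :> R by rewrite ltr0n.
set a := m%:R / tot * \sum_(y <- take (index x l) l) w y.
have := @count_interval m a (a + m%:R * w x / tot).
rewrite [a + _ - a]addrAC subrr add0r => H; apply: le_trans (H _).
  rewrite ler_nat !big_nat leq_sum // => U /andP[_ ltU].
  case: eqP => // E; set th := tot * _ / _ in E.
  have th0 : 0 <= th by rewrite /th divr_ge0 ?mulr_ge0 ?ler0n // ltW.
  have [|_] := @scanP w th 0 cur l ul w0 th0.
    by rewrite add0r /th ltr_pdivrMr // ltr_pM2l // ltr_nat.
  rewrite E add0r => /andP[h1 h2].
  suff -> : a <= U%:R < a + m%:R * w x / tot by [].
  have -> : U%:R = m%:R / tot * th.
    by rewrite /th; field; rewrite !lt0r_neq0.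
  have -> : a + m%:R * w x / tot =
    m%:R / tot * (\sum_(y <- take (index x l) l) w y + w x) by rewrite /a; ring.
  have k0 : 0 < m%:R / tot by rewrite divr_gt0.
  by rewrite /a ler_pM2l // ltr_pM2l // h1.
by rewrite lerDl divr_ge0 ?mulr_ge0 ?w0 ?ler0n // ltW.
Qed.

(* [wt] is the weight matrix of a graph on [0, r): first an endpoint is drawn
   with probability proportional to its degree, then one of its neighbours. *)
Variables (r m : nat) (wt : nat -> nat -> R).
Let others u := [seq y <- iota 0 r | y != u].
Definition wdeg x := \sum_(y <- iota 0 r | y != x) wt x y.
Definition wtot := \sum_(x <- iota 0 r) wdeg x.
Definition pick1 cur U := scan wdeg (wtot * U%:R / m%:R) 0 cur (iota 0 r).
Definition pick2 cur u U := scan (wt u) (wdeg u * U%:R / m%:R) 0 cur (others u).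

Lemma pick1_lt cur U : (0 < r)%N -> 0 <= wtot -> (pick1 cur U < r)%N.
Proof.
move=> r0 t0; have := @scan_mem0 wdeg (wtot * U%:R / m%:R) cur (iota 0 r).
rewrite mem_iota add0n; apply; first by rewrite divr_ge0 ?mulr_ge0 ?ler0n.
by rewrite -size_eq0 size_iota -lt0n.
Qed.

Lemma pick2_lt cur u U : (1 < r)%N -> 0 <= wdeg u ->
  (pick2 cur u U < r)%N /\ pick2 cur u U != u.
Proof.
move=> r1 t0; have := @scan_mem0 (wt u) (wdeg u * U%:R / m%:R) cur (others u).
rewrite /others mem_filter mem_iota add0n leq0n /= => h.
suff /andP[] : (pick2 cur u U != u) && (pick2 cur u U < r)%N by [].
apply: h; first by rewrite divr_ge0 ?mulr_ge0 ?ler0n.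
rewrite -size_eq0 size_filter -lt0n -has_count; apply/hasP.
case: (eqVneq u 0%N) => [->|ne]; first by exists 1%N; rewrite ?mem_iota.
by exists 0%N; rewrite ?mem_iota ?(ltnW r1) // eq_sym.
Qed.

Hypothesis wt_ge0 : forall x y, (x < r)%N -> (y < r)%N -> x != y -> 0 <= wt x y.
Hypothesis m_gt0 : (0 < m)%N.
Variable side : nat -> bool.
Let b x := \sum_(y <- iota 0 r | side y != side x) wt x y.
Hypothesis tot_gt0 : 0 < wtot.
(** For symmetric weights the sum of [b] counts every cut edge twice, so this says that the cut
    weighs at most the average degree. *)
Hypothesis cut_le : r%:R * \sum_(x <- iota 0 r) b x <= 2 * wtot.
Variables (cur1 : nat) (cur2 : nat -> nat).

Lemma wdeg_ge0 x : (x < r)%N -> 0 <= wdeg x.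
Proof.
move=> ltx; rewrite /wdeg big_seq_cond sumr_ge0 // => y.
by rewrite mem_iota => /andP[/andP[_ h] ne]; rewrite wt_ge0 // eq_sym.
Qed.

Let G x := (\sum_(0 <= U < m) (side (pick2 (cur2 x) x U) != side x))%N.

Lemma sum_iota_nat (p : nat -> bool) l z : uniq l -> z \in l -> p z ->
  (\sum_(y <- l | p y) (z == y) = 1)%N.
Proof.
move=> ul zl pz; rewrite big_mkcond (bigD1_seq z) //= pz eqxx big1 // => y ne.
by rewrite eq_sym (negbTE ne) if_same.
Qed.

(** Multiplying by the degree avoids a division by a degree that may be [0]. The term
    [r%:R * wdeg x] collects one rounding error for each neighbour on the other side. *)
Lemma bad_neighbour x : (x < r)%N -> (1 < r)%N -> 
  wdeg x * (G x)%:R <= m%:R * b x + r%:R * wdeg x.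
Proof.
move=> ltx r1; have d0 := wdeg_ge0 ltx.
have b0 : 0 <= b x.
  rewrite /b big_seq_cond sumr_ge0 // => y; rewrite mem_iota add0n => /andP[/= h1 h2].
  by rewrite wt_ge0 //; apply: contraNneq h2 => ->.
have [d00|dn0] := eqVneq (wdeg x) 0.
  by rewrite d00 mul0r mulr0 addr0 mulr_ge0.
have dp : 0 < wdeg x by rewrite lt0r dn0.
have E : wdeg x = \sum_(y <- others x) wt x y by rewrite /others big_filter.
have uo : uniq (others x) by rewrite filter_uniq // iota_uniq.
have o0 y : y \in others x -> 0 <= wt x y.
  by rewrite mem_filter mem_iota add0n => /andP[ne /= lty]; rewrite wt_ge0 // eq_sym.
have GE : (G x <= \sum_(y <- others x | side y != side x)
     \sum_(0 <= U < m) (pick2 (cur2 x) x U == y))%N.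
  rewrite exchange_big /= /G leq_sum // => U _.
  case: (boolP (side _ != _)) => // h; rewrite (@sum_iota_nat (fun y => side y != side x)) //.
  have [h1 h2] := @pick2_lt (cur2 x) x U r1 d0.
  by rewrite mem_filter h2 mem_iota add0n h1.
have H : (G x)%:R <= \sum_(y <- others x | side y != side x) (m%:R * wt x y / wdeg x + 1).
  apply: (@le_trans _ _ ((\sum_(y <- others x | side y != side x)
     \sum_(0 <= U < m) (pick2 (cur2 x) x U == y))%N%:R)); first by rewrite ler_nat.
  rewrite natr_sum big_seq_cond [leRHS]big_seq_cond ler_sum // => y /andP[yo _].
  have := @scan_count (wt x) (others x) (cur2 x) y m uo o0.
  by rewrite /= -E; apply.
apply: (@le_trans _ _ (wdeg x * \sum_(y <- others x | side y != side x) (m%:R * wt x y / wdeg x + 1))).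
  by rewrite ler_pM2l.
rewrite big_split /= mulrDr; apply: lerD.
  rewrite mulr_sumr /b mulr_sumr /others big_filter_cond /=.
  rewrite big_seq_cond [leRHS]big_seq_cond.
  rewrite (eq_bigl (fun i => (i \in iota 0 r) && (side i != side x))); last first.
    by move=> y /=; case: (eqVneq y x) => [->|] //=; rewrite eqxx !andbF.
  by rewrite le_eqVlt; apply/orP; left; apply/eqP/eq_bigr => y _; field.
rewrite mulrC ler_pM2r // (eq_bigr (fun=> 1%N%:R)) // -natr_sum ler_nat sum1_count.
by apply: leq_trans (count_size _ _) _; rewrite size_filter (leq_trans (count_size _ _)) // size_iota.
Qed.

(** Ideally [x] is drawn with probability [wdeg x / wtot] and a neighbour across the cut with
    probability [b x / wdeg x]; the products sum to the sum of [b] over [wtot], at most [2 / r]. The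
    rounding errors of the two draws contribute [r / m] each. *)
Lemma bad_pick : (1 < r)%N ->
  (\sum_(0 <= U1 < m) \sum_(0 <= U2 < m)
     (side (pick2 (cur2 (pick1 cur1 U1)) (pick1 cur1 U1) U2) != side (pick1 cur1 U1)))%N%:R
   <= (m%:R : R) ^+ 2 * (2 / r%:R + 2 * r%:R / m%:R).
Proof.
move=> r1.
have r0 : 0 < r%:R :> R by rewrite ltr0n (ltnW r1).
have m0 : 0 < m%:R :> R by rewrite ltr0n.
rewrite (_ : (\sum_(0 <= U1 < m) _ = \sum_(0 <= U1 < m) G (pick1 cur1 U1))%N) //.
have E : (\sum_(0 <= U1 < m) G (pick1 cur1 U1) =
   \sum_(x <- iota 0 r) (\sum_(0 <= U1 < m) (pick1 cur1 U1 == x)) * G x)%N.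
  rewrite [RHS](eq_bigr (fun x => \sum_(0 <= U1 < m) (pick1 cur1 U1 == x) * G x))%N; last first.
    by move=> x _; rewrite big_distrl.
  rewrite [RHS]exchange_big /=; apply: eq_bigr => U _.
  have lt := @pick1_lt cur1 U (ltnW r1) (ltW tot_gt0).
  rewrite (bigD1_seq (pick1 cur1 U)) ?iota_uniq ?mem_iota //= eqxx mul1n big1 ?addn0 //.
  by move=> y ne; rewrite eq_sym (negbTE ne).
have Gm x : (G x <= m)%N.
  rewrite /G; apply: (leq_trans (leq_sum _ (fun i _ => leq_b1 _))).
  by rewrite big_const_nat iter_addn_0 mul1n subn0.
rewrite E natr_sum.
apply: (@le_trans _ _ (\sum_(x <- iota 0 r) (m%:R / wtot * (m%:R * b x + r%:R * wdeg x) + m%:R))).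
  rewrite big_seq_cond [leRHS]big_seq_cond ler_sum // => x.
  rewrite andbT mem_iota add0n => /= ltx; rewrite natrM.
  apply: (@le_trans _ _ ((m%:R * wdeg x / wtot + 1) * (G x)%:R)).
    rewrite ler_wpM2r ?ler0n //.
    have := @scan_count wdeg (iota 0 r) cur1 x m (iota_uniq _ _).
    rewrite /= -/wtot mem_iota; apply=> // y; rewrite mem_iota add0n => /= lty.
    exact: wdeg_ge0.
  rewrite mulrDl mul1r lerD ?ler_nat //.
  have -> : m%:R * wdeg x / wtot * (G x)%:R = m%:R / wtot * (wdeg x * (G x)%:R) by ring.
  by rewrite ler_pM2l ?divr_gt0 // bad_neighbour.
rewrite big_split /= -mulr_sumr big_split /= -!mulr_sumr -/wtot.
rewrite big_const_seq count_predT size_iota iter_addr addr0 -[m%:R *+ r]mulr_natr.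
have cl : \sum_(x <- iota 0 r) b x <= 2 * wtot / r%:R.
  by rewrite ler_pdivlMr // mulrC.
have tne : wtot != 0 by rewrite lt0r_neq0.
apply: (@le_trans _ _ (m%:R / wtot * (m%:R * (2 * wtot / r%:R) + r%:R * wtot) + m%:R * r%:R)).
  apply: lerD => //; rewrite ler_wpM2l ?divr_ge0 ?ler0n ?(ltW tot_gt0) //.
  by apply: lerD => //; rewrite ler_wpM2l ?ler0n.
rewrite le_eqVlt; apply/orP; left; apply/eqP; field.
by rewrite tne !lt0r_neq0.
Qed.
End Selection.

(** * Laplacians and the contraction of vertices *)

Section Contraction.
Variables (R : realType) (n : nat).
Implicit Types (g : 'I_n -> 'I_n -> R) (S T C : {set 'I_n}) (f : 'I_n -> nat).
Implicit Types (M : nat -> nat -> R) (side : nat -> bool).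

(** A loop [g u u] cancels on the diagonal, so nothing has to be discarded when a contraction
    creates loops. *)
Definition laplacian g (u v : 'I_n) : R :=
  (if u == v then \sum_y g u y else 0) - g u v.

Definition block (L : 'I_n -> 'I_n -> R) S T : R := \sum_(u in S) \sum_(v in T) L u v.

Definition cutv g C : R := \sum_(u in C) \sum_(v in ~: C) g u v.

Lemma sum_laplacian g u T : \sum_(v in T) laplacian g u v =
  (if u \in T then \sum_y g u y else 0) - \sum_(v in T) g u v.
Proof.
rewrite /laplacian sumrB; congr (_ - _); rewrite -big_mkcondr /=.
case: ifP => uT; last first.
  by rewrite big_pred0 // => v; case: eqP => [<-|]; rewrite ?uT ?andbF.
rewrite (big_pred1 u) // => v; rewrite /= eq_sym.
by case: eqP => [->|]; rewrite ?uT ?andbF.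
Qed.

(** Weights inside [C] cancel between the degrees and the entries; what remains is the weight
    leaving [C]. *)
Lemma block_laplacian g C : block (laplacian g) C C = cutv g C.
Proof.
apply: eq_bigr => u uC; rewrite sum_laplacian uC.
rewrite (bigID (mem C)) /= addrAC subrr add0r.
by apply: eq_bigl => v; rewrite inE.
Qed.

Lemma block_disjoint g S T : [disjoint S & T] ->
  block (laplacian g) S T = - \sum_(u in S) \sum_(v in T) g u v.
Proof.
move=> d; rewrite -sumrN; apply: eq_bigr => u uS.
by rewrite sum_laplacian (disjointFr d uS) sub0r.
Qed.

Lemma block_row0 g S : block (laplacian g) S [set: 'I_n] = 0.
Proof.
apply: big1 => u _; rewrite sum_laplacian inE.
by rewrite [X in _ - X](eq_bigl xpredT) ?subrr // => v; rewrite inE.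
Qed.

Lemma sum_setU (F : 'I_n -> R) S S' : [disjoint S & S'] ->
  \sum_(u in S :|: S') F u = \sum_(u in S) F u + \sum_(u in S') F u.
Proof.
by move=> d; rewrite -bigU //; apply: eq_bigl => u; rewrite !inE.
Qed.

Lemma blockUl L S S' T : [disjoint S & S'] ->
  block L (S :|: S') T = block L S T + block L S' T.
Proof. by move=> d; rewrite /block sum_setU. Qed.

Lemma blockUr L S T T' : [disjoint T & T'] ->
  block L S (T :|: T') = block L S T + block L S T'.
Proof.
move=> d; rewrite /block -big_split /=; apply: eq_bigr => u _.
by rewrite sum_setU.
Qed.

Definition fiber f x : {set 'I_n} := [set w | f w == x].

Lemma disjoint_fiber f x y : x != y -> [disjoint fiber f x & fiber f y].
Proof.
move=> ne; apply/pred0P => w /=; rewrite !inE.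
by case: (eqVneq (f w) x) => [->|] //=; exact: negbTE.
Qed.

(** The vertices of the contracted graph are the fibres; surjectivity keeps them nonempty, so that
    each of them is a cut. *)
Definition labelling f r : Prop :=
  (forall w, (f w < r)%N) /\ (forall x, (x < r)%N -> exists w, f w = x).

Definition represents M g f r : Prop := forall x y, (x < r)%N -> (y < r)%N ->
  M x y = block (laplacian g) (fiber f x) (fiber f y).

Lemma sum_fibers f r (F : 'I_n -> R) side : (forall w, (f w < r)%N) ->
  \sum_(w | side (f w)) F w =
  \sum_(x <- iota 0 r | side x) \sum_(w in fiber f x) F w.
Proof.
move=> fr; under [RHS]eq_bigr do rewrite big_mkcond.
rewrite exchange_big /= [LHS]big_mkcond; apply: eq_bigr => w _.
rewrite big_mkcond (bigD1_seq (f w)) ?iota_uniq ?mem_iota ?fr //= inE eqxx.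
rewrite big1 ?addr0 // => x ne; rewrite inE eq_sym (negbTE ne).
by rewrite if_same.
Qed.

Lemma rep_fiber M g f r x : represents M g f r -> (x < r)%N ->
  M x x = cutv g (fiber f x).
Proof. by move=> h ltx; rewrite h // block_laplacian. Qed.

Lemma rep_off M g f r x y : represents M g f r -> (x < r)%N -> (y < r)%N ->
  x != y -> M x y = - \sum_(u in fiber f x) \sum_(v in fiber f y) g u v.
Proof.
by move=> h lx ly ne; rewrite h // block_disjoint // disjoint_fiber.
Qed.

Lemma rep_row M g f r x : represents M g f r -> (forall w, f w < r)%N ->
  (x < r)%N -> \sum_(y <- iota 0 r) M x y = 0.
Proof.
move=> h fr ltx; rewrite -[RHS](block_row0 g (fiber f x)) /block exchange_big /=.
rewrite (eq_bigl (fun w => xpredT (f w))); last by move=> w; rewrite inE.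
rewrite (sum_fibers _ xpredT fr) big_seq_cond [RHS]big_seq_cond.
apply: eq_big => // y; rewrite andbT mem_iota add0n => /= lty.
by rewrite h // /block exchange_big.
Qed.

(** Rows of a Laplacian sum to [0], so degrees are read off the diagonal without another pass. *)
Lemma rep_wdeg M g f r x : represents M g f r -> (forall w, f w < r)%N ->
  (x < r)%N -> wdeg r (fun x y => - M x y) x = M x x.
Proof.
move=> h fr ltx; rewrite /wdeg sumrN; have := rep_row h fr ltx.
rewrite (bigD1_seq x) ?iota_uniq ?mem_iota //= => /eqP.
by rewrite addr_eq0 => /eqP.
Qed.

Lemma rep_wtot M g f r : represents M g f r -> (forall w, f w < r)%N ->
  wtot r (fun x y => - M x y) = \sum_(x <- iota 0 r) M x x.
Proof.
move=> h fr; rewrite /wtot big_seq_cond [RHS]big_seq_cond; apply: eq_bigr => x.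
by rewrite andbT mem_iota add0n => /= ltx; rewrite (rep_wdeg h fr).
Qed.

Lemma cutv_setC g C : (forall u v, g u v = g v u) -> cutv g (~: C) = cutv g C.
Proof.
move=> sg; rewrite /cutv exchange_big /= finset.setCK; apply: eq_bigr => u _.
by apply: eq_bigr => v _; exact: sg.
Qed.

Definition sided C f side : Prop := forall u, (u \in C) = side (f u).

Lemma rep_cutv M g f r C side : represents M g f r -> (forall w, f w < r)%N ->
  sided C f side -> cutv g C =
  \sum_(x <- iota 0 r | side x) \sum_(y <- iota 0 r | ~~ side y) - M x y.
Proof.
move=> h fr sC; rewrite /cutv (eq_bigl (fun u => side (f u))) //.
rewrite (sum_fibers _ side fr) big_seq_cond [RHS]big_seq_cond.
apply: eq_bigr => x; rewrite mem_iota add0n => /andP[/= ltx sx].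
under eq_bigr => u _.
  rewrite (eq_bigl (fun v => ~~ side (f v))); last by move=> v; rewrite inE sC.
  rewrite (sum_fibers _ (fun y => ~~ side y) fr); over.
rewrite exchange_big /= big_seq_cond [RHS]big_seq_cond.
apply: eq_bigr => y; rewrite mem_iota add0n => /andP[/= lty sy].
rewrite (rep_off h) ?opprK //; apply: contraNneq sy => <-; exact: sx.
Qed.

Lemma rep_bad M g f r C side : (forall u v, g u v = g v u) ->
  represents M g f r -> (forall w, f w < r)%N -> sided C f side ->
  \sum_(x <- iota 0 r) \sum_(y <- iota 0 r | side y != side x) - M x y
  = 2 * cutv g C.
Proof.
move=> sg h fr sC.
have sC' : sided (~: C) f (fun x => ~~ side x) by move=> u; rewrite inE sC.
rewrite (_ : 2 * cutv g C = cutv g C + cutv g (~: C)); last first.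
  by rewrite cutv_setC //; ring.
rewrite (rep_cutv h fr sC) (rep_cutv h fr sC').
rewrite (bigID side) /=; congr (_ + _); apply: eq_bigr => x sx;
  by apply: eq_bigl => y; rewrite ?sx ?(negbTE sx) ?negbK; case: (side y).
Qed.

(** A vertex on the side of the cut contributes only a part of its degree. The lemma is used when
    the trace is [0], to conclude that all compatible cuts cost [0]. *)
Lemma rep_cut_le M g f r C side : represents M g f r -> (forall w, f w < r)%N ->
  sided C f side ->
  (forall x y, (x < r)%N -> (y < r)%N -> x != y -> 0 <= - M x y) ->
  cutv g C <= \sum_(x <- iota 0 r) M x x.
Proof.
move=> h fr sC M0; rewrite (rep_cutv h fr sC) [leLHS]big_mkcond.
rewrite big_seq_cond [leRHS]big_seq_cond.
apply: ler_sum => x; rewrite mem_iota add0n andbT => /= ltx.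
rewrite -(rep_wdeg h fr ltx) /wdeg.
have pos (Pr : pred nat) : (forall y, Pr y -> y != x) ->
    0 <= \sum_(y <- iota 0 r | Pr y) - M x y.
  move=> hP; rewrite big_seq_cond sumr_ge0 // => y.
  by rewrite mem_iota add0n => /andP[/= lty /hP ne]; rewrite M0 // eq_sym.
case: ifP => [sx|_]; last exact: pos.
rewrite [leRHS](bigID (fun y => side y)) /= -[leLHS]add0r lerD //.
  by apply: pos => y /andP[].
rewrite le_eqVlt; apply/orP; left; apply/eqP; apply: eq_bigl => y.
by case: (eqVneq y x) => [->|] //=; rewrite sx.
Qed.

(** Vertex [v] joins [u], and the last vertex takes over the freed number [v]. The second test is
    made on [z1] because [u] itself may be the last vertex. *)
Definition merge_label r u v z : nat :=
  let z1 := if z == v then u else z in if z1 == r.-1 then v else z1.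

(** The nested definitions are the four in-place passes of the program: add row [v] to row [u],
    likewise for columns, then move the last row and the last column to position [v]. *)
Definition merge_matrix r u v M : nat -> nat -> R :=
  let M1 x y := if x == u then M u y + M v y else M x y in
  let M2 x y := if y == u then M1 x u + M1 x v else M1 x y in
  let M3 x y := if x == v then M2 r.-1 y else M2 x y in
  fun x y => if y == v then M3 x r.-1 else M3 x y.

Lemma merge_labelling f r u v : labelling f r -> (u < r)%N -> (v < r)%N ->
  u != v -> labelling (merge_label r u v \o f) r.-1.
Proof.
move=> [fr fs] ur vr ne; split=> [w|x ltx] /=.
  have := fr w; rewrite /merge_label; case: (f w =P v) => ? /=; case: (_ =P r.-1) => ?; lia.
have ltx' : (x < r)%N by lia.
case: (x =P v) => [e|nx].
  have [|w ew] := fs r.-1; first by lia.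
  exists w; rewrite /merge_label ew; case: (r.-1 =P v) => ? /=; case: (_ =P r.-1) => ?; lia.
have [w ew] := fs x ltx'; exists w; rewrite /merge_label ew.
by rewrite (introF eqP nx) (introF eqP (_ : x <> r.-1)) //; lia.
Qed.

Lemma merge_fiber f r u v x : labelling f r -> (u < r)%N -> (v < r)%N -> u != v ->
  (x < r.-1)%N ->
  let S1 x := if x == u then fiber f u :|: fiber f v else fiber f x in
  fiber (merge_label r u v \o f) x = if x == v then S1 r.-1 else S1 x.
Proof.
move=> [fr _] ur vr ne ltx S1; apply/setP => w; have := fr w.
rewrite /S1 inE /= /merge_label.
by do !case: ifP; rewrite !inE => *; apply/idP/idP; lia.
Qed.

Lemma merge_represents M g f r u v : labelling f r -> (u < r)%N -> (v < r)%N ->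
  u != v -> represents M g f r ->
  represents (merge_matrix r u v M) g (merge_label r u v \o f) r.-1.
Proof.
move=> lf ur vr ne h x y ltx lty.
rewrite !(merge_fiber lf) //.
set S1 := fun x => if x == u then fiber f u :|: fiber f v else fiber f x.
have d : [disjoint fiber f u & fiber f v] by exact: disjoint_fiber.
have E1 z z' : (z < r)%N -> (z' < r)%N ->
  (if z == u then M u z' + M v z' else M z z') =
  block (laplacian g) (S1 z) (fiber f z').
  by move=> lz lz'; rewrite /S1; case: eqP => _; rewrite ?blockUl // !h.
have E2 z z' : (z < r)%N -> (z' < r)%N ->
  (if z' == u then (if z == u then M u u + M v u else M z u) +
                   (if z == u then M u v + M v v else M z v)
   else if z == u then M u z' + M v z' else M z z') =
  block (laplacian g) (S1 z) (S1 z').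
  move=> lz lz'; rewrite {2}/S1; case: (z' == u); last exact: E1.
  by rewrite blockUr // !E1.
have [lx ly lr] : [/\ x < r, y < r & r.-1 < r]%N by split; lia.
by rewrite /merge_matrix; case: (y == v); case: (x == v); exact: E2.
Qed.

(** Merging two vertices of the same side keeps the target a union of fibres; the number [v] now
    stands for the former last vertex, hence the new side function. *)
Lemma merge_sided f r u v C side : labelling f r -> (u < r)%N -> (v < r)%N ->
  u != v -> sided C f side -> side u = side v ->
  sided C (merge_label r u v \o f) (fun x => if x == v then side r.-1 else side x).
Proof.
move=> [fr _] ur vr ne sC suv w; have := fr w; rewrite sC /= /merge_label.
case: (f w =P v) => [->|n1] _.
  case: (u =P r.-1) => [e|n2]; first by rewrite eqxx -e suv.
  by rewrite (negbTE ne).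
case: (f w =P r.-1) => [->|n2]; first by rewrite eqxx.
by rewrite (introF eqP n1).
Qed.

Lemma fiber_cut f r x : labelling f r -> (2 <= r)%N -> (x < r)%N ->
  is_cut (fiber f x).
Proof.
move=> [fr fs] r2 ltx; apply/andP; split.
  have [w ew] := fs x ltx; apply/set0Pn; exists w; rewrite inE; exact/eqP.
rewrite properE finset.subsetT /=; apply/subsetPn.
have [|w ew] := fs (if x == 0 then 1 else 0)%N; first by case: ifP; lia.
exists w; rewrite ?inE // ew; case: (x) => //.
Qed.

(** Among at most three vertices one side of a cut is a single vertex, so a target that is still
    compatible has become visible on the diagonal. *)
Lemma small_sided f r C side : labelling f r -> (r <= 3)%N -> is_cut C ->
  sided C f side -> exists2 x, (x < r)%N & fiber f x = C \/ fiber f x = ~: C.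
Proof.
move=> [fr fs] r3 /andP[/set0Pn[w wC] /andP[_ /subsetPn[w' _ w'C]]] sC.
have := fr w; have := fr w'; rewrite !sC in wC w'C => l1 l2.
have key x : (x < r)%N -> (forall y, (y < r)%N -> y != x -> side y = ~~ side x) ->
   exists2 x, (x < r)%N & fiber f x = C \/ fiber f x = ~: C.
  move=> ltx hx; exists x => //.
  have E u : side (f u) = if f u == x then side x else ~~ side x.
    by case: eqP => [->//|/eqP ne]; rewrite hx.
  case sx: (side x); [left|right]; apply/setP => u; rewrite !inE sC E sx;
    by case: (f u == x).
have nww : f w != f w' by apply: contraTneq wC => ->.
(* The numbers [0], [1], [2] sum to [3], so this is the side of the third vertex, which decides
   which of [f w] and [f w'] is alone. For [r = 2] the number is out of range and either choice
   works. *)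
have [e|ne] := eqVneq (side (3 - f w - f w')%N) true.
  apply: (key (f w')) => // y ly ny; rewrite (negbTE w'C) /=.
  case: (eqVneq y (f w)) => [->//|ny2].
  by rewrite (_ : y = 3 - f w - f w')%N //; lia.
apply: (key (f w)) => // y ly ny; rewrite wC /=.
case: (eqVneq y (f w')) => [->|ny2]; first exact: negbTE.
by rewrite (_ : y = 3 - f w - f w')%N; [case: (side _) ne|lia].
Qed.

(** Single vertices give diagonal entries [A], the pairs with vertex [0] give entries [- A / 2], and
    the zero row sum [A - (r - 1) * A / 2] forces [A = 0] once [r] exceeds [3]. A uniform triangle
    shows that three vertices do not suffice. *)
Lemma equal_cuts_zero M g f r A : (forall u v, g u v = g v u) -> labelling f r ->
  represents M g f r -> (4 <= r)%N ->
  (forall C side, sided C f side -> is_cut C -> cutv g C = A) -> A = 0.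
Proof.
move=> sg lf h r4 H; have [fr fs] := lf.
have Hx x : (x < r)%N -> M x x = A.
  move=> ltx; rewrite (rep_fiber h ltx); apply: (H _ (fun z => z == x)).
    by move=> u; rewrite inE.
  by apply: (fiber_cut lf) => //; lia.
have sM x y : (x < r)%N -> (y < r)%N -> x != y -> M x y = M y x.
  move=> lx ly ne; rewrite (rep_off h lx ly ne) (rep_off h ly lx) 1?eq_sym //.
  congr (- _); rewrite exchange_big /=; apply: eq_bigr => u _.
  by apply: eq_bigr => v _; exact: sg.
have H0 y : (0 < y < r)%N -> M 0%N y = - A / 2.
  case/andP=> y0 ly; have r0 : (0 < r)%N by lia.
  have : cutv g (fiber f 0 :|: fiber f y) = A.
    apply: (H _ (fun z => (z == 0%N) || (z == y))).
      by move=> u; rewrite !inE.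
    apply/andP; split.
      have [w ew] := fs 0%N r0; apply/set0Pn; exists w; by rewrite !inE ew.
    rewrite properE finset.subsetT /=; apply/subsetPn.
    have [|w ew] := fs (if y == 1 then 2 else 1)%N; first by case: ifP; lia.
    exists w; rewrite ?inE // ew; case: (y =P 1%N) => [->//|ne'] /=.
    by apply/negP => /eqP; lia.
  have d : [disjoint fiber f 0 & fiber f y] by apply: disjoint_fiber; lia.
  rewrite -block_laplacian blockUl // !blockUr // -!h // !Hx // (sM y 0%N) //; last by lia.
  by lra.
have := rep_row h fr (_ : 0 < r)%N; rewrite -(subnKC r4) /= big_cons Hx //; last by lia.
move=> /(_ isT).
rewrite big_seq_cond (eq_bigr (fun=> - A / 2)); last first.
  move=> y; rewrite andbT -[_ :: _]/(iota 1 (3 + (r - 4))) mem_iota => yr.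
  by apply: H0; lia.
rewrite -big_seq_cond -[_ :: _]/(iota 1 (3 + (r - 4))).
rewrite big_const_seq count_predT size_iota iter_addr addr0 -[_ *+ (3 + _)]mulr_natr natrD.
have : 0 <= (r - 4)%N%:R :> R by rewrite ler0n.
nra.
Qed.

Lemma cutv_ge0 g C : (forall u v, 0 <= g u v) -> 0 <= cutv g C.
Proof. by move=> g0; rewrite !sumr_ge0 // => u _; rewrite sumr_ge0. Qed.

Definition combine (X Y : R) g g' u v := X * g u v + Y * g' u v.

Lemma cutv_combine X Y g g' C :
  cutv (combine X Y g g') C = X * cutv g C + Y * cutv g' C.
Proof.
rewrite /cutv !mulr_sumr -big_split /=; apply: eq_bigr => u _.
by rewrite !mulr_sumr -big_split.
Qed.

Lemma represents_combine X Y g g' M M' f r : represents M g f r ->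
  represents M' g' f r ->
  represents (fun x y => X * M x y + Y * M' x y) (combine X Y g g') f r.
Proof.
move=> h h' x y lx ly; rewrite h // h' // /block mulr_sumr [Y * _]mulr_sumr -big_split /=.
apply: eq_bigr => u _; rewrite !sum_laplacian.
have E (Pr : pred 'I_n) : \sum_(v | Pr v) combine X Y g g' u v =
    X * (\sum_(v | Pr v) g u v) + Y * (\sum_(v | Pr v) g' u v).
  by rewrite !mulr_sumr -big_split.
by rewrite !E; case: ifP => _; ring.
Qed.
End Contraction.

(** * When a contraction is likely to spare the target *)

Section Phases.
Variables (R : realType) (n : nat) (a b : 'I_n -> 'I_n -> R) (lmax : R).
Hypothesis a_sym : forall u v, a u v = a v u.
Hypothesis b_sym : forall u v, b u v = b v u.
Hypothesis a_ge0 : forall u v, 0 <= a u v.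
Hypothesis ab_ge0 : forall u v, 0 <= a u v + lmax * b u v.
Hypothesis lmax_gt0 : 0 < lmax.
Notation va := (cutv a).
Notation vb := (cutv b).
Implicit Types (C : {set 'I_n}) (A B : R).

(** This compares the lines [A + l * B] and [A' + l * B'] for all sufficiently small [l > 0]. *)
Definition lexle A B A' B' : Prop := A < A' \/ (A = A' /\ B <= B').

Definition lexmin C0 : Prop :=
  is_cut C0 /\ forall C, is_cut C -> lexle (va C0) (vb C0) (va C) (vb C).

(* The conditions under which a random contraction of the graph of
   [X * Ma + Y * Mb] is unlikely to hit the cut [C]. *)
Definition ready (Ma Mb : nat -> nat -> R) r X Y tot C : Prop :=
  [/\ (4 <= r)%N, 0 < tot, tot = \sum_(x <- iota 0 r) (X * Ma x x + Y * Mb x x),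
      forall x y, (x < r)%N -> (y < r)%N -> x != y -> 0 <= - (X * Ma x y + Y * Mb x y)
    & r%:R * (X * va C + Y * vb C) <= tot].

Lemma lexle_anti A B A' B' : lexle A B A' B' -> lexle A' B' A B -> A = A' /\ B = B'.
Proof. by rewrite /lexle => -[h|[-> h]] [h'|[e h']]; split; lra. Qed.

Lemma sum_iota_ge r (F : nat -> R) c : (forall x, (x < r)%N -> c <= F x) ->
  r%:R * c <= \sum_(x <- iota 0 r) F x.
Proof.
move=> h; have -> : r%:R * c = \sum_(x <- iota 0 r) c.
  by rewrite big_const_seq count_predT size_iota iter_addr addr0 mulr_natl.
rewrite big_seq_cond [leRHS]big_seq_cond ler_sum // => x.
by rewrite andbT mem_iota => ltx; exact: h.
Qed.

Lemma sum_iota_eq0 r (F : nat -> R) (Pr : pred nat) :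
  (forall x, (x < r)%N -> Pr x -> 0 <= F x) -> \sum_(x <- iota 0 r | Pr x) F x = 0 ->
  forall x, (x < r)%N -> Pr x -> F x = 0.
Proof.
move=> h0; rewrite big_seq_cond => /eqP; rewrite psumr_eq0; last first.
  by move=> x /andP[]; rewrite mem_iota => ? ?; exact: h0.
move=> /allP H x ltx px; have := H x; rewrite mem_iota add0n ltx px /=.
by move=> /(_ isT)/eqP.
Qed.

Section OneGraph.
Variables (f : 'I_n -> nat) (r : nat) (Ma Mb : nat -> nat -> R).
Hypotheses (lf : labelling f r) (ra : represents Ma a f r) (rb : represents Mb b f r).
Hypothesis r2 : (2 <= r)%N.
Let ta := \sum_(x <- iota 0 r) Ma x x.
Let tb := \sum_(x <- iota 0 r) Mb x x.

Lemma fiber_val x : (x < r)%N -> [/\ is_cut (fiber f x), Ma x x = va (fiber f x)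
  & Mb x x = vb (fiber f x)].
Proof.
by move=> ltx; rewrite (rep_fiber ra) // (rep_fiber rb) //; split=> //; exact: fiber_cut lf _ _.
Qed.

Lemma off_ge0 (g : 'I_n -> 'I_n -> R) (M : nat -> nat -> R) x y : represents M g f r -> (forall u v, 0 <= g u v) ->
  (x < r)%N -> (y < r)%N -> x != y -> 0 <= - M x y.
Proof.
move=> h g0 lx ly ne; rewrite (rep_off h) // opprK !sumr_ge0 // => u _.
by rewrite sumr_ge0.
Qed.

Lemma ta_ge0 : 0 <= ta.
Proof.
have := @sum_iota_ge r (fun x => Ma x x) 0; rewrite mulr0; apply=> x ltx.
by have [_ -> _] := fiber_val ltx; exact: cutv_ge0.
Qed.

Lemma small_val C side : sided C f side -> is_cut C -> (r <= 3)%N ->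
  exists2 x, (x < r)%N & Ma x x = va C /\ Mb x x = vb C.
Proof.
move=> sC cC r3; have [x ltx h] := small_sided lf r3 cC sC; exists x => //.
have [_ -> ->] := fiber_val ltx.
by case: h => ->; rewrite ?cutv_setC.
Qed.

(** Nonnegative weights with total [0] vanish. This makes slopes usable as weights: where [a] is
    [0], nonnegativity of [a + lmax * b] gives [0 <= b]. *)
Lemma ta0_zero : ta = 0 -> forall x y u v, (x < r)%N -> (y < r)%N -> x != y ->
  u \in fiber f x -> v \in fiber f y -> a u v = 0.
Proof.
move=> t0 x y u v lx ly ne ux vy.
have M0 z : (z < r)%N -> Ma z z = 0.
  move=> lz; apply: (sum_iota_eq0 (Pr := xpredT) _ t0) => // z' lz' _.
  by have [_ -> _] := fiber_val lz'; exact: cutv_ge0.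
have [fr _] := lf.
have := rep_wdeg ra fr lx; rewrite M0 // /wdeg => w0.
have E : - Ma x y = 0.
  apply: (sum_iota_eq0 _ w0) => //; last by rewrite eq_sym.
  by move=> z lz nz; apply: (off_ge0 ra) => //; rewrite eq_sym.
move: E; rewrite (rep_off ra) // opprK => /eqP.
rewrite psumr_eq0 => [|u' _]; last by rewrite sumr_ge0.
move=> /allP /(_ u); rewrite mem_index_enum => /(_ isT); rewrite ux /=.
rewrite psumr_eq0 // => /allP /(_ v); rewrite mem_index_enum => /(_ isT).
by rewrite vy /= => /eqP.
Qed.

(** No contracted vertex costs less than [C0] in the leading criterion, and averaging over the
    vertices gives the last clause of [ready]. If the costs vanish the slopes take over; if these
    vanish too, [C0] and all inspected vertices have the line [(0, 0)] and the incumbent is optimal.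
    With at most three vertices [C0] itself has been inspected. *)
Lemma check1_ready C0 side A B : lexmin C0 -> sided C0 f side ->
  (exists2 C, is_cut C & A = va C /\ B = vb C) ->
  (forall x, (x < r)%N -> lexle A B (Ma x x) (Mb x x)) ->
  (A = va C0 /\ B = vb C0) \/
  ready Ma Mb r (ta != 0)%:R (ta == 0)%:R (if ta == 0 then tb else ta) C0.
Proof.
move=> [cC0 minC0] sC0 [C cC [eA eB]] hx; have [fr _] := lf.
have le0 : lexle (va C0) (vb C0) A B by rewrite eA eB; exact: minC0.
have hf x : (x < r)%N -> lexle (va C0) (vb C0) (Ma x x) (Mb x x).
  by move=> ltx; have [c -> ->] := fiber_val ltx; exact: minC0.
have [r3|r4] := leqP r 3.
  have [x ltx [ea eb]] := small_val sC0 cC0 r3.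
  have := hx x ltx; rewrite ea eb => h; left.
  by have [-> ->] := lexle_anti h le0.
have [t0|tn0] := eqVneq ta 0; last first.
  right; split=> //.
  - by rewrite lt_neqAle eq_sym tn0 ta_ge0.
  - by apply: eq_bigr => x _; rewrite mul1r mul0r addr0.
  - by move=> x y lx ly ne; rewrite mul1r mul0r addr0 (off_ge0 ra).
  - rewrite mul1r mul0r addr0; apply: sum_iota_ge => x ltx.
    by have [|[]] := hf x ltx => [/ltW|->].
have b0 x y u v : (x < r)%N -> (y < r)%N -> x != y ->
    u \in fiber f x -> v \in fiber f y -> 0 <= b u v.
  move=> lx ly ne ux vy; have := ab_ge0 u v.
  by rewrite (ta0_zero t0 lx ly ne ux vy) add0r pmulr_rge0.
have off x y : (x < r)%N -> (y < r)%N -> x != y -> 0 <= - Mb x y.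
  move=> lx ly ne; rewrite (rep_off rb) // opprK; apply: sumr_ge0 => u ux.
  by apply: sumr_ge0 => v vy; exact: (b0 x y).
have Mb0 x : (x < r)%N -> 0 <= Mb x x.
  move=> lx; rewrite -(rep_wdeg rb fr lx) /wdeg big_seq_cond sumr_ge0 // => y.
  by rewrite mem_iota add0n => /andP[/= ly ne]; apply: off => //; rewrite eq_sym.
have Ma0 x : (x < r)%N -> Ma x x = 0.
  move=> lz; apply: (sum_iota_eq0 (Pr := xpredT) _ t0) => // z' lz' _.
  by have [_ -> _] := fiber_val lz'; exact: cutv_ge0.
have va0 : va C0 = 0.
  have := hf 0%N (ltnW r2); rewrite Ma0 1?ltnW //; have := cutv_ge0 C0 a_ge0.
  by move=> h [h'|[-> //]]; lra.
have vb0 x : (x < r)%N -> vb C0 <= Mb x x.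
  by move=> lx; have := hf x lx; rewrite Ma0 // va0 => -[|[]] //; rewrite ltxx.
have [tb0|tbn0] := eqVneq tb 0.
  left; have Mb00 x : (x < r)%N -> Mb x x = 0.
    by move=> lz; apply: (sum_iota_eq0 (Pr := xpredT) _ tb0) => // z' lz' _; exact: Mb0.
  have e : vb C0 = 0.
    apply/eqP; rewrite eq_le -{1}(Mb00 0%N) 1?ltnW // vb0 1?ltnW //=.
    rewrite (rep_cutv rb fr sC0) big_seq_cond sumr_ge0 // => x.
    rewrite mem_iota add0n => /andP[/= lx sx].
    rewrite big_seq_cond sumr_ge0 // => y; rewrite mem_iota add0n => /andP[/= ly sy].
    by apply: off => //; apply: contraNneq sy => <-.
  have := hx 0%N (ltnW r2); rewrite Ma0 1?ltnW // Mb00 1?ltnW // -{1}va0 -e.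
  by move=> h; have [-> ->] := lexle_anti h le0.
right; split=> //.
- rewrite lt_neqAle eq_sym tbn0 /=.
  by have := @sum_iota_ge r (fun x => Mb x x) 0; rewrite mulr0; apply.
- by apply: eq_bigr => x _; rewrite mul1r mul0r add0r.
- by move=> x y lx ly ne; rewrite mul1r mul0r add0r off.
- by rewrite mul1r mul0r add0r; apply: sum_iota_ge.
Qed.

Variables (A B lam : R) (C0 : {set 'I_n}).
Hypotheses (C0min : lexmin C0) (EA : A = va C0) (EB : B = vb C0).
Hypotheses (lam_gt0 : 0 < lam) (lam_le : lam <= lmax).

(** A line of smaller slope meets the line [(A, B)] after [l], or exactly at [l] provided the flag
    says that a crossing there is known. *)
Definition cleared l (fl : nat) (x y : R) : Prop :=
  y < B -> l * (B - y) < x - A \/ (fl = 1%N /\ l * (B - y) = x - A).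

Definition crossing l C : Prop := [/\ is_cut C, vb C < B & l * (B - vb C) = va C - A].

(** The flag tells the initial value [lmax], where nothing need cross, from a value attained by a
    cut: a crossing exactly at [lmax] is a breakpoint as well. *)
Definition sound2 l (fl : nat) : Prop :=
  [/\ 0 < l, l <= lmax, (fl = 0%N /\ l = lmax) \/ (fl = 1%N /\ exists C, crossing l C)
    & (fl < 2)%N].

Definition found2 l (fl : nat) : Prop :=
  forall C, is_cut C -> cleared l fl (va C) (vb C).

(** Crossing parameters are quotients with positive denominators, compared here after
    cross-multiplication. *)
Definition first_crossing C1 : Prop :=
  [/\ is_cut C1, vb C1 < B, va C1 - A <= lmax * (B - vb C1) &
   forall C, is_cut C -> vb C < B ->
     (va C1 - A) * (B - vb C) <= (va C - A) * (B - vb C1)].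

Let g := combine 1 lam a b.
Let M x y := 1 * Ma x y + lam * Mb x y.
Let tot := ta + lam * tb.
(** If the weights at [lam] sum to [0], all compatible cuts and the incumbent line have value [0]
    there. With at least four vertices and a nonzero cost at the start, some cut differs from the
    incumbent line and therefore crosses it at [lam], so the flag may be raised without any
    contraction. *)
Let fl' fl := if (tot == 0) && (3 < r)%N && (0 < ta) then 1%N else fl.

(** Weights are affine in the parameter and nonnegative at [0] and at [lmax]. *)
Lemma g_ge0 u v : 0 <= g u v.
Proof.
rewrite /g /combine mul1r; have h1 := a_ge0 u v; have h2 := ab_ge0 u v.
have [b0|b0] := leP 0 (b u v); first by rewrite addr_ge0 // mulr_ge0 // ltW.
by apply: le_trans h2 _; rewrite lerD2l ler_wnM2r // ltW.
Qed.

Lemma rM : represents M g f r.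
Proof. exact: represents_combine. Qed.

Lemma totE : \sum_(x <- iota 0 r) M x x = tot.
Proof. by rewrite /M big_split /= -!mulr_sumr mul1r. Qed.

(** A line of slope at least [B] starts on or above the incumbent line, by minimality of [C0], and
    stays there; the other lines are cleared. *)
Lemma line_le C fl : is_cut C -> cleared lam fl (va C) (vb C) ->
  A + lam * B <= va C + lam * vb C.
Proof.
move=> cC; rewrite /cleared; have [lt|ge] := ltP (vb C) B.
  by move=> /(_ isT) [h|[_ h]]; lra.
move=> _; have : lexle A B (va C) (vb C) by rewrite EA EB; case: C0min => _; apply.
have : lam * B <= lam * vb C by rewrite ler_pM2l.
by move=> h [h'|[h' _]]; lra.
Qed.

Lemma zero_line fl : (forall x, (x < r)%N -> cleared lam fl (Ma x x) (Mb x x)) ->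
  tot = 0 -> A + lam * B = 0.
Proof.
move=> hx t0; have [fr _] := lf; apply/eqP; rewrite eq_le; apply/andP; split.
  have M0 : M 0%N 0%N = 0.
    have t0' : \sum_(x <- iota 0 r) M x x = 0 by rewrite totE.
    apply: (sum_iota_eq0 (Pr := xpredT) _ t0') => //; last by lia.
    by move=> z lz _; rewrite (rep_fiber rM) //; apply: cutv_ge0; exact: g_ge0.
  have r0 : (0 < r)%N by lia.
  have := hx 0%N r0; have [c e1 e2] := fiber_val r0; rewrite e1 e2 => h.
  by have := line_le c h; rewrite -e1 -e2; move: M0; rewrite /M mul1r => ->.
have := cutv_ge0 C0 g_ge0; rewrite /g cutv_combine EA EB; lra.
Qed.

Lemma sided_zero C side : sided C f side -> tot = 0 -> va C + lam * vb C = 0.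
Proof.
move=> sC t0; have [fr _] := lf; apply/eqP; rewrite eq_le; apply/andP; split.
  have := rep_cut_le rM fr sC (fun x y lx ly ne => off_ge0 rM g_ge0 lx ly ne).
  by rewrite totE t0 /g cutv_combine mul1r.
by have := cutv_ge0 C g_ge0; rewrite /g cutv_combine mul1r.
Qed.

(** If every compatible cut had cost [A] at the start, [equal_cuts_zero] would make all costs
    vanish. So some cut starts strictly higher, and as it meets the incumbent line at [lam] its
    slope is smaller. *)
Lemma check2_sound fl : sound2 lam fl ->
  (forall x, (x < r)%N -> cleared lam fl (Ma x x) (Mb x x)) ->
  sound2 lam (fl' fl).
Proof.
move=> sd hx; rewrite /fl'; case: ifP => // /andP[/andP[/eqP t0 r4] tap].
split=> //; right; split=> //.
have L0 := zero_line hx t0; have [fr _] := lf.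
suff [C [side [sC cC ne]]] : exists C side, [/\ sided C f side, is_cut C & va C != A].
  have := sided_zero sC t0.
  have : lexle A B (va C) (vb C) by rewrite EA EB; case: C0min => _; apply.
  case=> [lt|[e _]]; last by rewrite e eqxx in ne.
  move=> e0; exists C; split=> //; last by lra.
  have : 0 < lam * (B - vb C) by lra.
  by rewrite pmulr_rgt0 // subr_gt0.
apply: contrapT => no.
have all C side : sided C f side -> is_cut C -> va C = A.
  move=> sC cC; apply/eqP/negPn/negP => ne; apply: no; exists C, side; split=> //.
have A0 := equal_cuts_zero a_sym lf ra r4 all.
suff : ta = 0 by move=> e; rewrite e ltxx in tap.
rewrite /ta big_seq_cond big1 // => x; rewrite andbT mem_iota => ltx.
have [c -> _] := fiber_val ltx; rewrite (all _ (fun z => z == x)) //.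
by move=> u; rewrite inE.
Qed.

(** As [lam] is [lmax] or a true crossing, [C1] lies on or below the incumbent line at [lam],
    whereas every inspected vertex lies on or above it; averaging gives [ready]. If the total is
    [0], the raised flag settles the search instead. *)
Lemma check2_ready C1 side fl : first_crossing C1 -> sided C1 f side ->
  sound2 lam fl -> (forall x, (x < r)%N -> cleared lam fl (Ma x x) (Mb x x)) ->
  found2 lam (fl' fl) \/ ready Ma Mb r 1 lam tot C1.
Proof.
move=> [cC1 ltB leM minC1] sC1 sd hx; have [fr _] := lf.
have leL : va C1 - A <= lam * (B - vb C1).
  case: (sd) => _ _ [[_ ->]//|[_ [C [cC ltC eC]]]] _.
  have := minC1 C cC ltC; rewrite -eC mulrAC ler_pM2r ?subr_gt0 //.
have fd : fl' fl = 1%N -> lam * (B - vb C1) = va C1 - A -> found2 lam (fl' fl).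
  move=> f1 e C cC ltC; have := minC1 C cC ltC; rewrite -e mulrAC.
  rewrite ler_pM2r ?subr_gt0 // le_eqVlt => /orP[/eqP h|h]; [by right|by left].
have fdc : cleared lam fl (va C1) (vb C1) -> found2 lam (fl' fl).
  move=> /(_ ltB) [h|[h1 h2]]; first by lra.
  by apply: fd => //; rewrite /fl' h1 if_same.
have [r3|r4] := leqP r 3.
  have [x ltx [ea eb]] := small_val sC1 cC1 r3.
  by left; apply: fdc; rewrite -ea -eb; exact: hx.
have [t0|tn0] := eqVneq tot 0.
  left; have e0 := sided_zero sC1 t0; have L0 := zero_line hx t0.
  (* Otherwise [C1] has the line [(0, 0)], and minimality of [C0] together with [0 <= A] gives
     [B <= 0], against the smaller slope of [C1]. *)
  have tap : 0 < ta.
    rewrite lt_neqAle ta_ge0 andbT; apply/eqP => e.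
    have := rep_cut_le ra fr sC1 (fun x y lx ly ne => off_ge0 ra a_ge0 lx ly ne).
    rewrite -/ta -e => h; have v0 : va C1 = 0.
      by apply/eqP; rewrite eq_le h cutv_ge0.
    have w0 : vb C1 = 0.
      move: e0; rewrite v0 add0r => /eqP; rewrite mulf_eq0 gt_eqF //= => /eqP //.
    have : lexle A B (va C1) (vb C1) by rewrite EA EB; case: C0min => _; apply.
    have A0 : 0 <= A by rewrite EA cutv_ge0.
    rewrite v0 w0 => -[|[e1 e2]]; [lra|].
    move: ltB; rewrite w0 => Bp; have : 0 < lam * B by rewrite mulr_gt0.
    lra.
  by apply: fd; [rewrite /fl' t0 eqxx r4 tap|lra].
right; split=> //.
- rewrite lt_neqAle eq_sym tn0 /= -totE.
  have := @sum_iota_ge r (fun x => M x x) 0; rewrite mulr0; apply=> x ltx.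
  by rewrite (rep_fiber rM) //; apply: cutv_ge0; exact: g_ge0.
- by rewrite -totE.
- by move=> x y lx ly ne; exact: (off_ge0 rM g_ge0).
- rewrite -totE mul1r; apply: sum_iota_ge => x ltx.
  apply: (@le_trans _ _ (A + lam * B)); first by lra.
  have [c e1 e2] := fiber_val ltx; rewrite /M mul1r e1 e2.
  by apply: (line_le (fl := fl)) => //; rewrite -e1 -e2; exact: hx.
Qed.
End OneGraph.
End Phases.

(** * Success probability of the unrolled recursion *)

Section Tree.
Variable R : realType.
Implicit Types (l : seq nat) (al : nat -> bool).

(* A lower bound for the probability that the contractions [l] reveal the target
   cut, when the levels on which it is still alive are given by [al]. *)
Fixpoint reveal l al : R :=
  if l is j :: l' then
    let y := reveal l' (upd al j false) in
    if al j.+1 then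
      (if j == 0%N then 1 else reveal l' (upd al j true)) / 4 + 3 / 4 * y
    else y
  else 0.

(** The recursive calls in depth-first order; an entry [i] stands for contracting the graph of level
    [i.+1] to level [i]. *)
Fixpoint tree j : seq nat :=
  if j is j'.+1 then
    let t := j' :: tree j' in t ++ t ++ t ++ t
  else [::].

(** Four independent branches, each entered alive with probability [1 / 4], and certain success on
    level [0]. *)
Fixpoint tree_prob j : R :=
  if j is j'.+1 then 1 - (1 - tree_prob j' / 4) ^+ 4 else 1.

(** The part of the living levels that [tree j] cannot destroy, as it overwrites only levels below
    [j]. *)
Definition above j al i : bool := (j <= i)%N && al i.

Lemma reveal_bounds l al : 0 <= reveal l al <= 1.
Proof.
elim: l al => [|j l IH] al /=; first by rewrite lexx ler01.
have /andP[h1 h2] := IH (upd al j false); have /andP[h3 h4] := IH (upd al j true).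
by case: (al j.+1); case: (j == 0%N); apply/andP; split; lra.
Qed.

Lemma reveal_mono l al al' : (forall i, al i ==> al' i) -> reveal l al <= reveal l al'.
Proof.
elim: l al al' => [|j l IH] al al' h //=.
have h1 : reveal l (upd al j false) <= reveal l (upd al' j false).
  by apply: IH => i; rewrite /upd; case: eqP.
have h2 : reveal l (upd al j true) <= reveal l (upd al' j true).
  by apply: IH => i; rewrite /upd; case: eqP.
have h3 : reveal l (upd al j false) <= reveal l (upd al j true).
  by apply: IH => i; rewrite /upd; case: eqP => // _; exact: implybb.
have /andP[b1 b2] := reveal_bounds l (upd al j false).
have /andP[b3 b4] := reveal_bounds l (upd al' j false).
have := h j.+1; case: (al j.+1) => [/= ->|_]; first by case: (j == 0%N); lra.
by case: (al' j.+1) => //; case: (j == 0%N); lra.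
Qed.

Lemma reveal_cons j l al : al j.+1 -> reveal (j :: l) al =
  (if j == 0%N then 1 else reveal l (upd al j true)) / 4
    + 3 / 4 * reveal l (upd al j false).
Proof. by move=> /= ->. Qed.

Lemma reveal_skip j l al : reveal l (upd al j false) <= reveal (j :: l) al.
Proof.
rewrite /=; case: (al j.+1) => //.
have h3 : reveal l (upd al j false) <= reveal l (upd al j true).
  by apply: reveal_mono => i; rewrite /upd; case: eqP => // _; exact: implybb.
have /andP[b1 b2] := reveal_bounds l (upd al j false).
by case: (j == 0%N); lra.
Qed.

Lemma tree_cat j l : let t := j :: tree j in
  tree j.+1 ++ l = t ++ (t ++ (t ++ (t ++ l))).
Proof.
set t := j :: tree j; rewrite -[tree j.+1]/(t ++ t ++ t ++ t).
by move: t => t; rewrite /= -!catA.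
Qed.

Lemma reveal_tree_skip j l al : reveal l (above j al) <= reveal (tree j ++ l) al.
Proof.
elim: j l al => [|j IH] l al; first by apply: reveal_mono => i; apply/implyP.
have blk l' al' : (forall i, above j.+1 al i ==> al' i) ->
    exists2 al'', (forall i, above j.+1 al i ==> al'' i) &
    reveal l' al'' <= reveal ((j :: tree j) ++ l') al'.
  move=> h; exists (above j (upd al' j false)).
    move=> i; have := h i; rewrite /above /upd.
    by case: ltngtP => //= ltji; rewrite ?(gtn_eqF ltji).
  by apply: le_trans (IH _ _) _; exact: reveal_skip.
have h0 i : above j.+1 al i ==> al i by apply/implyP => /andP[].
rewrite tree_cat.
have [al1 h1 le1] := blk ((j :: tree j) ++ (j :: tree j) ++ (j :: tree j) ++ l) _ h0.
have [al2 h2 le2] := blk ((j :: tree j) ++ (j :: tree j) ++ l) _ h1.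
have [al3 h3 le3] := blk ((j :: tree j) ++ l) _ h2.
have [al4 h4 le4] := blk l _ h3.
apply: le_trans le1; apply: le_trans le2; apply: le_trans le3; apply: le_trans le4.
exact: reveal_mono.
Qed.

Lemma tree_prob_bounds j : 0 < tree_prob j <= 1.
Proof.
elim: j => [|j /andP[IH1 IH2]] /=; first by rewrite ltr01 lexx.
set q := tree_prob j / 4.
have q0 : 0 < q by rewrite /q; lra.
have q1 : q <= 1 / 4 by rewrite /q; lra.
have h : 0 <= (1 - q) ^+ 4 < 1.
  by rewrite exprn_ge0 ?exprn_ilt1 //; lra.
by apply/andP; split; lra.
Qed.

(** Every block leaves level [j.+1] intact, so the next one starts from the same graph and the
    failure probabilities multiply. *)
Lemma reveal_four j l al : al j.+1 ->
  (forall l al, al j.+1 ->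
    tree_prob j / 4 + (1 - tree_prob j / 4) * reveal l (above j.+1 al)
      <= reveal ((j :: tree j) ++ l) al) ->
  1 - (1 - tree_prob j.+1) * (1 - reveal l (above j.+1 al)) <= reveal (tree j.+1 ++ l) al.
Proof.
move=> alj IH; have /andP[p0 p1] := tree_prob_bounds j.
rewrite [tree_prob j.+1]/= subKr; set q := tree_prob j / 4.
have q0 : 0 <= 1 - q by rewrite /q; lra.
have blk l' al' c : al' j.+1 -> (forall i, above j.+1 al i ==> al' i) ->
    (forall al'', al'' j.+1 -> (forall i, above j.+1 al i ==> al'' i) ->
       1 - c <= reveal l' al'') ->
    1 - (1 - q) * c <= reveal ((j :: tree j) ++ l') al'.
  move=> hj h hl; have := IH l' al' hj; apply: le_trans; rewrite -/q.
  have Hc : 1 - c <= reveal l' (above j.+1 al').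
    apply: hl => [|i]; first by rewrite /above leqnn.
    by have := h i; rewrite /above; case: (leqP j.+1 i).
  have : (1 - q) * (1 - c) <= (1 - q) * reveal l' (above j.+1 al').
    by rewrite ler_wpM2l.
  lra.
rewrite tree_cat !exprS expr0 mulr1 -!mulrA.
apply: (blk) => // [i|al1 a1 h1]; first by apply/implyP => /andP[].
apply: (blk) => // al2 a2 h2; apply: (blk) => // al3 a3 h3.
apply: (blk) => // al4 a4 h4.
by rewrite subKr; exact: reveal_mono.
Qed.

(** The bound is affine in the value of the remaining list, so that blocks can be chained: either
    the block reveals the target, or the list goes on with the levels above [j] untouched. *)
Lemma reveal_block j l al : al j.+1 ->
  tree_prob j / 4 + (1 - tree_prob j / 4) * reveal l (above j.+1 al)
    <= reveal ((j :: tree j) ++ l) al.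
Proof.
elim: j l al => [|j IH] l al alj.
  rewrite [reveal (_ ++ _) _]/= alj /=.
  have : reveal l (above 1 al) <= reveal l (upd al 0%N false).
    by apply: reveal_mono => -[|i] //; rewrite /above /=; exact: implybb.
  lra.
have /andP[pS0 pS1] := tree_prob_bounds j.+1.
rewrite cat_cons reveal_cons // (_ : (j.+1 == 0%N) = false) //.
set X := reveal l (above j.+2 al).
have H1 : X <= reveal (tree j.+1 ++ l) (upd al j.+1 false).
  apply: le_trans (reveal_tree_skip _ _ _); apply: reveal_mono => i.
  rewrite /above /upd; case: (ltngtP j.+1 i) => //= lt.
  exact: implybb.
have H2 := @reveal_four j l (upd al j.+1 true) _ IH.
rewrite /upd eqxx -/(upd _ _ _) in H2; have {}H2 := H2 isT.
have H3 : X <= reveal l (above j.+1 (upd al j.+1 true)).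
  apply: reveal_mono => i; rewrite /above /upd; case: (ltngtP j.+1 i) => //= lt.
  exact: implybb.
have H4 : (1 - tree_prob j.+1) * X <=
   (1 - tree_prob j.+1) * reveal l (above j.+1 (upd al j.+1 true)).
  by rewrite ler_wpM2l // subr_ge0.
move: (tree_prob j.+1) pS0 pS1 H1 H2 H4 => p *; lra.
Qed.

Lemma reveal_runs K N al : al K.+1 ->
  1 - (1 - tree_prob K.+1) ^+ N <= reveal (flatten (nseq N (tree K.+1))) al.
Proof.
have /andP[p0 p1] := tree_prob_bounds K.+1.
elim: N al => [|N IH] al alK; first by rewrite expr0 subrr.
have := @reveal_four K (flatten (nseq N (tree K.+1))) al alK (@reveal_block K).
apply: le_trans; rewrite exprS lerB // ler_wpM2l ?subr_ge0 //.
have := IH (above K.+1 al); rewrite /above leqnn alK => /(_ isT); lra.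
Qed.

(** Expanding the fourth power, one level loses at most [3 / 8 * p ^+ 2]; for [p <= 1] the inverse
    of the probability then grows by less than [1]. *)
Lemma tree_prob_ge j : 1 / j.+1%:R <= tree_prob j.
Proof.
elim: j => [|j IH]; first by rewrite divr1.
have /andP[p0 p1] := tree_prob_bounds j.
have m0 : 0 < (j.+1%:R : R) by rewrite ltr0n.
have m1 : 1 <= (j.+1%:R : R) by rewrite ler1n.
rewrite /= -[j.+2%:R]natr1; move: (tree_prob j) p0 p1 (j.+1%:R) m0 m1 IH => p p0 p1 m m0 m1 IH.
have IH' : 1 <= p * m by rewrite -ler_pdivrMr.
rewrite ler_pdivrMr; last by lra.
have h1 : p - 3 / 8 * p ^+ 2 <= 1 - (1 - p / 4) ^+ 4.
  have -> : 1 - (1 - p / 4) ^+ 4 = p - 3 / 8 * p ^+ 2 + p ^+ 3 / 16 - p ^+ 4 / 256 by field.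
  have : p ^+ 4 <= p ^+ 3 by rewrite !exprS ler_piMl // ?mulr_ge0 ?exprn_ge0 //; lra.
  have : 0 <= p ^+ 3 by rewrite exprn_ge0 // ltW.
  lra.
apply: (@le_trans _ _ ((p - 3 / 8 * p ^+ 2) * (m + 1))); last by rewrite ler_wpM2r //; lra.
have : 1 * (p * m) <= p * m * (p * m) by rewrite ler_wpM2r //; lra.
nra.
Qed.

(** By Bernoulli's inequality [K.+1] runs fail with probability at most [1 / 2]. Repeating them
    [A * K.+1] times gives failure at most [2 ^- (A * K.+1)], whence the number of runs. *)
Lemma failure_prob K A n : (n <= 2 ^ K.+1)%N -> (0 < n)%N ->
  (1 - tree_prob K) ^+ (A * K.+1 * K.+1) <= n%:R ^- A.
Proof.
move=> len n0; have /andP[p0 p1] := tree_prob_bounds K.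
have q0 : 0 <= 1 - tree_prob K by rewrite subr_ge0.
have half : (1 - tree_prob K) ^+ K.+1 <= 2^-1.
  have h := tree_prob_ge K.
  apply: (@le_trans _ _ ((1 - 1 / K.+1%:R) ^+ K.+1)).
    have k1 : 1 / K.+1%:R <= 1 :> R by rewrite ler_pdivrMr ?ltr0n // mul1r ler1n.
    by rewrite lerXn2r ?nnegrE ?subr_ge0 ?lerB.
  case: K {len p0 p1 q0 h} => [|K]; first by rewrite divr1 subrr expr0n invr_ge0.
  have k0 : 0 < K.+1%:R :> R by rewrite ltr0n.
  have E : 1 - 1 / K.+2%:R = (1 + K.+1%:R^-1)^-1 :> R.
    rewrite -[K.+2%:R]natr1; move: (K.+1%:R : R) k0 => k k0.
    by field; apply/andP; split; apply: lt0r_neq0; lra.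
  have i0 : 0 < K.+1%:R^-1 :> R by rewrite invr_gt0.
  rewrite E exprVn lef_pV2 ?posrE ?exprn_gt0 ?addr_gt0 //.
  have bern m (x : R) : 0 <= x -> 1 + m%:R * x <= (1 + x) ^+ m.
    move=> x0; elim: m => [|m IHm]; first by rewrite mul0r addr0 expr0.
    rewrite exprS -natr1; have : (1 + x) * (1 + m%:R * x) <= (1 + x) * (1 + x) ^+ m.
      by rewrite ler_wpM2l //; lra.
    have : 0 <= m%:R * x * x by rewrite !mulr_ge0 ?ler0n.
    lra.
  apply: le_trans (bern _ _ (ltW i0)).
  rewrite -[K.+2%:R]natr1 mulrDl divff ?lt0r_neq0 // mul1r.
  by move: (_^-1) i0 => x; lra.
have -> : (A * K.+1 * K.+1 = K.+1 * (K.+1 * A))%N by lia.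
rewrite exprM; apply: (@le_trans _ _ (2^-1 ^+ (K.+1 * A))).
  by rewrite lerXn2r // ?nnegrE ?exprn_ge0 ?invr_ge0.
rewrite exprM -exprVn lerXn2r // ?nnegrE ?exprn_ge0 ?invr_ge0 //.
by rewrite exprVn lef_pV2 ?posrE ?exprn_gt0 ?ltr0n // -natrX ler_nat.
Qed.

(** The recursion becomes counting in base four: a branch on level [j] starts whenever the lowest
    [j] digits of the counter are zero. *)
Definition level_actions (K x : nat) : seq nat :=
  [seq j <- rev (iota 0 K) | (4 ^ j %| x)%N].

Lemma level_actionsS (K x : nat) : level_actions K.+1 x =
  (if (4 ^ K %| x)%N then [:: K] else [::]) ++ level_actions K x.
Proof.
have E : iota 0 K.+1 = rcons (iota 0 K) K by rewrite -addn1 iotaD -cats1.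
by rewrite /level_actions E rev_rcons /=; case: ifP.
Qed.

(** For [i < j], divisibility by [4 ^ i] depends only on the position inside an aligned block of
    [4 ^ j] steps, so every such block replays the same tree. *)
Lemma tree_actions j m :
  flatten [seq level_actions j x | x <- iota (m * 4 ^ j)%N (4 ^ j)%N] = tree j.
Proof.
elim: j m => [|j IH] m; first by rewrite expn0.
have blk m' : flatten [seq level_actions j.+1 x | x <- iota (m' * 4 ^ j)%N (4 ^ j)%N]
   = j :: tree j.
  rewrite -(IH m'); have : (0 < 4 ^ j)%N by rewrite expn_gt0.
  case E : (4 ^ j)%N => [//|k] _ /=; rewrite level_actionsS E dvdn_mull //=.
  congr (_ :: (_ ++ flatten _)); apply/eq_in_map => l; rewrite mem_iota => /andP[h1 h2].
  rewrite level_actionsS E ifF //; apply/negP => /dvdnP[q e].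
  rewrite e in h1 h2.
  by have [hq|hq] := leqP q m'; have := leq_mul hq (leqnn k.+1); lia.
rewrite -[RHS]cats0 tree_cat cats0 expnS.
have -> : (4 * 4 ^ j = 4 ^ j + (4 ^ j + (4 ^ j + 4 ^ j)))%N by lia.
rewrite !iotaD !map_cat !flatten_cat.
have -> : (m * (4 ^ j + (4 ^ j + (4 ^ j + 4 ^ j))) = (4 * m) * 4 ^ j)%N by lia.
rewrite -!addnA.
have -> : (4 * m * 4 ^ j + 4 ^ j = (4 * m).+1 * 4 ^ j)%N by lia.
have -> : (4 * m * 4 ^ j + (4 ^ j + 4 ^ j) = (4 * m).+2 * 4 ^ j)%N by lia.
have -> : (4 * m * 4 ^ j + (4 ^ j + (4 ^ j + 4 ^ j)) = (4 * m).+3 * 4 ^ j)%N by lia.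
by rewrite !blk.
Qed.

Lemma all_actions K N :
  flatten [seq level_actions K x | x <- iota 0 (N * 4 ^ K)%N] = flatten (nseq N (tree K)).
Proof.
elim: N => [|N IH]; first by rewrite mul0n.
rewrite mulSn addnC iotaD map_cat flatten_cat IH tree_actions.
by rewrite -[in RHS]addn1 nseqD flatten_cat /= cats0.
Qed.
End Tree.

(** * Matrix levels in memory: copying and merging *)

Notation "a [+] b" := (WBin WAdd a b) (at level 50, left associativity).
Notation "a [-] b" := (WBin WSub a b) (at level 50, left associativity).
Notation "a [*] b" := (WBin WMul a b) (at level 40, left associativity).
Notation "a [/] b" := (WBin WDiv a b) (at level 40, left associativity).
Notation "a [%] b" := (WBin WMod a b) (at level 40, left associativity).
Notation "a [+r] b" := (RBin RAdd a b) (at level 50, left associativity).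
Notation "a [-r] b" := (RBin RSub a b) (at level 50, left associativity).
Notation "a [*r] b" := (RBin RMul a b) (at level 40, left associativity).
Notation "a [/r] b" := (RBin RDiv a b) (at level 40, left associativity).
Notation "a ;; b" := (HSeq a b) (at level 60, right associativity).

Lemma reval_mem (R : realType) (s : state R) e :
  reval s (RMem e) = rmem s (weval s e).
Proof. by []. Qed.

Lemma packed_inj (n p y p' y' : nat) : (y < n)%N -> (y' < n)%N ->
  (p * n + y = p' * n + y')%N -> p = p' /\ y = y'.
Proof.
move=> ly ly' e; have n0 : (0 < n)%N by lia.
have := congr1 (divn^~ n) e; rewrite !divnMDl // !divn_small // !addn0 => ->.
by have := congr1 (modn^~ n) e; rewrite !modnMDl !modn_small.
Qed.

(* Word registers: 1 = n, 2 = B0, 3 = m, 4 = K, 11 = the current level, 12 = its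
   number r of vertices; entry (x, y) of the Laplacian of level j is stored at
   [adr t j x y], with t = 0 for the costs at the start and t = 1 for the
   direction. *)
Definition adrE (t : nat) (j x y : wexpr) : wexpr :=
  WVar 2 [+] (((j [*] WVar 1 [+] x) [*] WVar 1 [+] y) [*] WNum 2 [+] WNum t).

Definition entry (t : nat) (x y : wexpr) : rexpr := RMem (adrE t (WVar 11) x y).

(** One loop with quotient and remainder replaces a double loop, so that a single rule for storing
    loops covers the copy and the merging passes. *)
Definition copy_level : hcmd :=
  HFor 15 16 (WVar 22 [*] WVar 22)
    (HStore (adrE 0 (WVar 11) (WVar 15 [/] WVar 22) (WVar 15 [%] WVar 22))
       (RMem (adrE 0 (WVar 11 [+] WNum 1) (WVar 15 [/] WVar 22) (WVar 15 [%] WVar 22))) ;;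
     HStore (adrE 1 (WVar 11) (WVar 15 [/] WVar 22) (WVar 15 [%] WVar 22))
       (RMem (adrE 1 (WVar 11 [+] WNum 1) (WVar 15 [/] WVar 22) (WVar 15 [%] WVar 22)))).

Definition merge_loop (ea : nat -> wexpr) (er : nat -> rexpr) : hcmd :=
  HFor 15 16 (WVar 12) (HStore (ea 0%N) (er 0%N) ;; HStore (ea 1%N) (er 1%N)).

Definition lastE : wexpr := WVar 12 [-] WNum 1.

Definition merge_rows : hcmd :=
  merge_loop (fun t => adrE t (WVar 11) (WVar 17) (WVar 15))
    (fun t => entry t (WVar 17) (WVar 15) [+r] entry t (WVar 18) (WVar 15)).
Definition merge_cols : hcmd :=
  merge_loop (fun t => adrE t (WVar 11) (WVar 15) (WVar 17))
    (fun t => entry t (WVar 15) (WVar 17) [+r] entry t (WVar 15) (WVar 18)).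
Definition move_row : hcmd :=
  merge_loop (fun t => adrE t (WVar 11) (WVar 18) (WVar 15))
    (fun t => entry t lastE (WVar 15)).
Definition move_col : hcmd :=
  merge_loop (fun t => adrE t (WVar 11) (WVar 15) (WVar 18))
    (fun t => entry t (WVar 15) lastE).
Definition merge_vertices : hcmd := merge_rows ;; merge_cols ;; move_row ;; move_col.

Section Memory.
Variables (R : realType) (W d n B0 K m : nat).
Notation TB := (40 + d)%N.
Notation st := (state R).
Implicit Types (s : st).
Notation surely := (@surely R W TB).
Notation hoare := (@hoare R W TB).
Notation bounded := (@bounded R W TB).

(** The passes work in place. A read at index [x] may therefore rely only on cells not written so
    far, and the hypothesis on [ea] and [er] grants exactly this, including the order of the two
    stores of an iteration. *)
Lemma for_store i ib e (ea : nat -> wexpr) (er : nat -> rexpr) s N A (val : nat -> nat -> R) :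
  let c := HStore (ea 0%N) (er 0%N) ;; HStore (ea 1%N) (er 1%N) in
  (i < TB)%N -> (ib < TB)%N -> i != ib -> wsafe W TB s e -> weval s e = N ->
  (forall t t' y y', (t < 2)%N -> (t' < 2)%N -> (y < N)%N -> (y' < N)%N ->
     A t y = A t' y' -> t = t' /\ y = y') ->
  (forall t x s', (t < 2)%N -> (x < N)%N -> frame (HFor i ib e c) s s' ->
     wreg s' i = x ->
     (forall q, (forall t' y, (t' < 2)%N -> (y < x)%N || ((y == x) && (t' < t)%N) ->
        q <> A t' y) -> rmem s' q = rmem s q) ->
     [/\ wsafe W TB s' (ea t), rsafe W TB s' (er t), weval s' (ea t) = A t x
       & reval s' (er t) = val t x]) ->
  surely (N.+1 * hcost TB (HFor i ib e c)) (HFor i ib e c) s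
    (fun s' => (forall t y, (t < 2)%N -> (y < N)%N -> rmem s' (A t y) = val t y) /\
      (forall q, (forall t y, (t < 2)%N -> (y < N)%N -> q <> A t y) ->
         rmem s' q = rmem s q)).
Proof.
move=> c lti ltib ne se eN inj H.
apply: (@surely_forN R W TB i ib e c s N (fun x s' =>
  (forall t y, (t < 2)%N -> (y < x)%N -> rmem s' (A t y) = val t y) /\
      (forall q, (forall t y, (t < 2)%N -> (y < x)%N -> q <> A t y) ->
         rmem s' q = rmem s q))) => //.
move=> x s' ltx F B ei eb [I1 I2].
have [|sa sr ea0 er0] := H 0%N x s' isT ltx F ei.
  move=> q hq; apply: I2 => t y lt2 lty; apply: hq => //; by rewrite lty.
apply: surely_store_seq => //.
set s1 := set_rmem s' _ _.
have F1 : frame (HFor i ib e c) s s1 by case: F => f1 f2 f3 f4; split.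
have M1 q : rmem s1 q = if q == A 0%N x then val 0%N x else rmem s' q.
  by rewrite /s1 /= ea0 er0.
have [|sa1 sr1 ea1 er1] := H 1%N x s1 isT ltx F1 ei.
  move=> q hq; rewrite M1; case: eqP => [e0|_].
    by case: (hq 0%N x isT); rewrite ?ltnn ?eqxx.
  by apply: I2 => t y lt2 lty; apply: hq => //; rewrite lty.
apply: surely_store => //; set s2 := set_rmem s1 _ _.
have M2 q : rmem s2 q = if q == A 1%N x then val 1%N x else rmem s1 q.
  by rewrite /s2 /= ea1 er1.
have R2 q : rmem (setw s2 i x.+1) q = rmem s2 q by [].
split=> [t y lt2|q hq].
  rewrite ltnS leq_eqVlt => /orP[/eqP->|lty].
    case: t lt2 => [|[|//]] _; rewrite R2 M2 ?eqxx // M1 eqxx.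
    by case: eqP => // e0; have [] := inj 0%N 1%N x x isT isT ltx ltx e0.
  have lyN := ltn_trans lty ltx.
  rewrite R2 M2 M1.
  case: eqP => [e0|_]; first by have [_ e1] := inj t 1%N y x lt2 isT lyN ltx e0; lia.
  case: eqP => [e0|_]; first by have [_ e1] := inj t 0%N y x lt2 isT lyN ltx e0; lia.
  exact: I1.
rewrite R2 M2 M1 (introF eqP (hq 1%N x _ _)) //.
rewrite (introF eqP (hq 0%N x _ _)) //.
by apply: I2 => t y lt2 lty; apply: hq => //; lia.
Qed.

Definition adr (t j x y : nat) : nat := (B0 + (((j * n + x) * n + y) * 2 + t))%N.
Definition mat s t j x y : R := rmem s (adr t j x y).

Definition env s : Prop := [/\ wreg s 1 = n, wreg s 2 = B0, wreg s 3 = m & wreg s 4 = K].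

Hypothesis n_gt1 : (1 < n)%N.
Hypothesis HW : (B0 + K.+1 * (n * n) * 2 < W)%N.

Lemma env_frame c s s' : frame c s s' ->
  all (fun i => i \notin written_w c) [:: 1; 2; 3; 4]%N -> env s -> env s'.
Proof.
by move=> [h _ _ _] /= /and5P[h1 h2 h3 h4 _] [e1 e2 e3 e4]; split; rewrite h.
Qed.

Lemma adr_inj t j x y t' j' x' y' : (t < 2)%N -> (t' < 2)%N -> (x < n)%N ->
  (x' < n)%N -> (y < n)%N -> (y' < n)%N -> adr t j x y = adr t' j' x' y' ->
  [/\ t = t', j = j', x = x' & y = y'].
Proof.
move=> t2 t2' lx lx' ly ly' /addnI e.
have [e1 ->] := packed_inj t2 t2' e; have [e2 ->] := packed_inj ly ly' e1.
by have [-> ->] := packed_inj lx lx' e2.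
Qed.

Lemma adr_lt t j x y : (t < 2)%N -> (x < n)%N -> (y < n)%N -> (j <= K)%N ->
  (adr t j x y < W)%N.
Proof.
move=> t2 lx ly lj; apply: leq_ltn_trans HW; rewrite /adr leq_add2l.
have h1 : (j * n + x < K.+1 * n)%N.
  by apply: (@leq_trans (j.+1 * n)); [rewrite mulSn; lia|rewrite leq_mul2r; lia].
have h2 : ((j * n + x) * n + y < K.+1 * (n * n))%N.
  apply: (@leq_trans ((j * n + x).+1 * n)); first by rewrite mulSn; lia.
  by rewrite mulnA leq_mul2r h1 orbT.
lia.
Qed.

Lemma W_gt2 : (2 < W)%N.
Proof.
have h1 : (2 * 2 <= n * n)%N by exact: leq_mul.
have h2 : (n * n <= K.+1 * (n * n))%N by rewrite mulSn leq_addr.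
by apply: leq_trans HW; lia.
Qed.

Lemma adrE_ok s t j x y : env s -> (t < 2)%N -> wsafe W TB s j -> wsafe W TB s x ->
  wsafe W TB s y -> (weval s j <= K)%N -> (weval s x < n)%N -> (weval s y < n)%N ->
  wsafe W TB s (adrE t j x y) /\
  weval s (adrE t j x y) = adr t (weval s j) (weval s x) (weval s y).
Proof.
move=> [e1 e2 _ _] t2 sj sx sy lj lx ly; split; last by rewrite /= e1 e2.
rewrite /= e1 e2 sj sx sy /=.
have := adr_lt t2 lx ly lj; rewrite /adr; have := W_gt2.
set a := weval s j; set b := weval s x; set c := weval s y => w2 h.
have m1 : (a * n <= (a * n + b) * n)%N.
  by apply: (@leq_trans (a * n + b)); [lia|rewrite -{1}[(a * n + b)%N]muln1 leq_mul2l; lia].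
have m2 : (a * n + b <= (a * n + b) * n)%N.
  by rewrite -{1}[(a * n + b)%N]muln1 leq_mul2l; lia.
have d40 : (2 < TB)%N by lia.
by do !(apply/andP; split => //); lia.
Qed.

Definition other_levels_same j s s' : Prop :=
  forall q, (forall t x y, (t < 2)%N -> (x < n)%N -> (y < n)%N -> q <> adr t j x y) ->
    rmem s' q = rmem s q.

Lemma copy_ok s j S : env s -> wreg s 11 = j -> wreg s 22 = S -> (j < K)%N ->
  (0 < S)%N -> (S <= n)%N ->
  surely ((S * S).+1 * hcost TB copy_level) copy_level s (fun s' =>
    (forall t x y, (t < 2)%N -> (x < S)%N -> (y < S)%N ->
       mat s' t j x y = mat s t j.+1 x y) /\ other_levels_same j s s').
Proof.
move=> Es Ej ES ltj S0 Sn.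
have lt_div x : (x < S * S)%N -> (x %/ S < n)%N.
  by move=> lx; apply: leq_trans Sn; rewrite ltn_divLR.
have lt_mod x : (x %% S < n)%N by apply: leq_trans Sn; rewrite ltn_pmod.
have SSW : (S * S < W)%N.
  apply: leq_ltn_trans HW; have := leq_mul Sn Sn; nia.
have KW : (K < W)%N by apply: leq_ltn_trans HW; nia.
have nW : (n < W)%N by apply: leq_ltn_trans HW; nia.
have := @for_store 15 16 (WVar 22 [*] WVar 22)
  (fun t => adrE t (WVar 11) (WVar 15 [/] WVar 22) (WVar 15 [%] WVar 22))
  (fun t => RMem (adrE t (WVar 11 [+] WNum 1) (WVar 15 [/] WVar 22) (WVar 15 [%] WVar 22)))
  s (S * S)%N (fun t q => adr t j (q %/ S) (q %% S))
  (fun t q => mat s t j.+1 (q %/ S) (q %% S)).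
have sS : wsafe W TB s (WVar 22 [*] WVar 22) by rewrite /= ES SSW.
have eS : weval s (WVar 22 [*] WVar 22) = (S * S)%N by rewrite /= ES.
move=> /(_ isT isT isT sS eS) H.
apply: surely_le (H _ _) _ _ => {H} //.
- move=> t t' y y' t2 t2' ly ly' e.
  have [-> _ ed em] := adr_inj t2 t2' (lt_div _ ly) (lt_div _ ly') (lt_mod _) (lt_mod _) e.
  by split=> //; rewrite (divn_eq y S) ed em -divn_eq.
- move=> t x s' t2 lx F ex same; have [fw _ _ _] := F.
  have Es' : env s' by exact: env_frame F _ Es.
  have Ej' : wreg s' 11 = j by rewrite fw.
  have ES' : wreg s' 22 = S by rewrite fw.
  have [||||||sa ea] := @adrE_ok s' t (WVar 11) (WVar 15 [/] WVar 22) (WVar 15 [%] WVar 22) Es' t2.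
  + by [].
  + by rewrite /= ex ES'; apply: ltn_trans nW; exact: lt_div.
  + by rewrite /= ex ES'; apply: ltn_trans nW; exact: lt_mod.
  + by rewrite /= Ej' ltnW.
  + by rewrite /= ex ES'; exact: lt_div.
  + by rewrite /= ex ES'; exact: lt_mod.
  have [||||||sb eb] := @adrE_ok s' t (WVar 11 [+] WNum 1) (WVar 15 [/] WVar 22) (WVar 15 [%] WVar 22) Es' t2.
  + by rewrite /= Ej' addn1 (leq_ltn_trans ltj KW) (ltn_trans _ W_gt2).
  + by rewrite /= ex ES'; apply: ltn_trans nW; exact: lt_div.
  + by rewrite /= ex ES'; apply: ltn_trans nW; exact: lt_mod.
  + by rewrite /= Ej' addn1.
  + by rewrite /= ex ES'; exact: lt_div.
  + by rewrite /= ex ES'; exact: lt_mod.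
  split=> //; first by rewrite ea /= ex Ej' ES'.
  rewrite reval_mem eb [weval _ (_ [+] _)]/= Ej' addn1.
  rewrite /= ex ES' same // => t' y t2' hy e.
  have ly : (y < S * S)%N.
    by case/orP: hy => [|/andP[/eqP->]] // => hy; exact: ltn_trans lx.
  have [_ ej _ _] := adr_inj t2 t2' (lt_div _ lx) (lt_div _ ly) (lt_mod _) (lt_mod _) e.
  lia.
- move=> s' F B [H1 H2]; split.
    move=> t x y t2 lx ly.
    have lq : (x * S + y < S * S)%N.
      by apply: (@leq_trans (x.+1 * S)); [rewrite mulSn; lia|rewrite leq_mul2r lx orbT].
    have := H1 t (x * S + y)%N t2 lq.
    by rewrite divnMDl // modnMDl divn_small // modn_small // addn0.
  move=> q hq; apply: H2 => t y t2 ly; apply: hq => //; exact: lt_div.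
Qed.

Section Merge.
Variables (s0 : st) (j r u v : nat).
Hypotheses (ltj : (j <= K)%N) (rn : (r <= n)%N) (ur : (u < r)%N) (vr : (v < r)%N).
Hypothesis uv : u != v.

Definition at_level s : Prop :=
  [/\ env s, wreg s 11 = j, wreg s 12 = r, wreg s 17 = u & wreg s 18 = v].

Lemma at_level_frame c s s' : frame c s s' ->
  all (fun i => i \notin written_w c) [:: 1; 2; 3; 4; 11; 12; 17; 18]%N ->
  at_level s -> at_level s'.
Proof.
move=> [h _ _ _] /= /and5P[h1 h2 h3 h4 /and5P[h5 h6 h7 h8 _]].
by case=> -[e1 e2 e3 e4] e5 e6 e7 e8; split; [split|..]; rewrite h.
Qed.

(* One of the four passes: position [p x] receives the value [val t x]. *)
Lemma merge_loop_ok s (xe ye : wexpr) (px py : nat -> nat) (er : nat -> rexpr) val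
  (M : nat -> nat -> nat -> R) :
  let ea := fun t => adrE t (WVar 11) xe ye in
  at_level s ->
  (forall t x y, (t < 2)%N -> (x < r)%N -> (y < r)%N -> mat s t j x y = M t x y) ->
  (forall y y', (y < r)%N -> (y' < r)%N -> px y = px y' -> py y = py y' -> y = y') ->
  (forall x, (x < r)%N -> (px x < r)%N /\ (py x < r)%N) ->
  (forall s' x, at_level s' -> wreg s' 15 = x -> (x < r)%N ->
     [/\ wsafe W TB s' xe, wsafe W TB s' ye, weval s' xe = px x & weval s' ye = py x]) ->
  (forall s' t x, at_level s' -> wreg s' 15 = x -> (x < r)%N -> (t < 2)%N ->
     (forall x' y', (x' < r)%N -> (y' < r)%N ->
        (forall y, (y < x)%N -> x' <> px y \/ y' <> py y) ->
        mat s' t j x' y' = M t x' y') ->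
     rsafe W TB s' (er t) /\ reval s' (er t) = val t x) ->
  surely (r.+1 * hcost TB (merge_loop ea er)) (merge_loop ea er) s (fun s' =>
    [/\ at_level s', forall t x, (t < 2)%N -> (x < r)%N ->
        mat s' t j (px x) (py x) = val t x,
      forall t x y, (t < 2)%N -> (x < r)%N -> (y < r)%N ->
        (forall z, (z < r)%N -> x <> px z \/ y <> py z) -> mat s' t j x y = M t x y
     & other_levels_same j s s']).
Proof.
move=> ea As HM inj lp Hp Hv.
have lp1 x : (x < r)%N -> (px x < n)%N /\ (py x < n)%N.
  by move=> lx; have [h1 h2] := lp x lx; split; exact: leq_trans rn.
have := @for_store 15 16 (WVar 12) ea er s r (fun t q => adr t j (px q) (py q)) val.
move=> /(_ isT isT isT isT); case: (As) => _ _ er12 _ _; rewrite [weval _ _]/= er12.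
move=> /(_ erefl) H; apply: surely_le (H _ _) _ _ => {H} //.
- move=> t t' y y' t2 t2' ly ly' e; have [a1 a2] := lp1 _ ly; have [b1 b2] := lp1 _ ly'.
  have [-> _ e1 e2] := adr_inj t2 t2' a1 b1 a2 b2 e.
  by split=> //; exact: inj.
- move=> t x s' t2 lx F ex same.
  have As' : at_level s' by exact: at_level_frame F _ As.
  have [s1 s2 e1 e2] := Hp s' x As' ex lx; have [l1 l2] := lp1 _ lx.
  have [Es' Ej' _ _ _] := As'.
  have [||||||sa ea'] := @adrE_ok s' t (WVar 11) xe ye Es' t2; rewrite ?e1 ?e2 //.
    by rewrite /= Ej'.
  have [|sr rr] := Hv s' t x As' ex lx t2.
    move=> x' y' lx' ly' far; rewrite -HM // /mat same // => t' y t2' hy e.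
    have ly : (y < r)%N by case/orP: hy => [|/andP[/eqP->]] // => hy; exact: ltn_trans lx.
    have [b1 b2] := lp1 _ ly.
    have [et _ f1 f2] := adr_inj t2 t2' (leq_trans lx' rn) b1 (leq_trans ly' rn) b2 e.
    case/orP: hy => [hy|/andP[_]]; last by rewrite et ltnn.
    by case: (far y hy).
  by split=> //; rewrite /ea ea' e1 e2 [weval _ _]/= Ej'.
- move=> s' F B [H1 H2]; split.
  + exact: at_level_frame F _ As.
  + by move=> t x t2 lx; exact: H1.
  + move=> t x y t2 lx ly far; rewrite -HM // /mat H2 // => t' z t2' lz e.
    have [b1 b2] := lp1 _ lz.
    have [_ _ f1 f2] := adr_inj t2 t2' (leq_trans lx rn) b1 (leq_trans ly rn) b2 e.
    by case: (far z lz).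
  + move=> q hq; apply: H2 => t y t2 ly; have [b1 b2] := lp1 _ ly; exact: hq.
Qed.

Lemma entry_ok s t xe ye : at_level s -> (t < 2)%N -> wsafe W TB s xe -> wsafe W TB s ye ->
  (weval s xe < r)%N -> (weval s ye < r)%N ->
  rsafe W TB s (entry t xe ye) /\
  reval s (entry t xe ye) = mat s t j (weval s xe) (weval s ye).
Proof.
move=> [Es Ej _ _ _] t2 sx sy lx ly.
have [||||||sa ea] := @adrE_ok s t (WVar 11) xe ye Es t2; rewrite //.
- by rewrite /= Ej.
- exact: leq_trans rn.
- exact: leq_trans rn.
by split=> //; rewrite /entry reval_mem ea /mat /= Ej.
Qed.

(** In each pass, step [x] reads cells with running index [x] and has so far written only cells with
    smaller running index, so working in place does no harm. *)
Lemma merge_ok s (M : nat -> nat -> nat -> R) : at_level s ->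
  (forall t x y, (t < 2)%N -> (x < r)%N -> (y < r)%N -> mat s t j x y = M t x y) ->
  surely (r.+1 * hcost TB merge_vertices) merge_vertices s (fun s' =>
    [/\ at_level s', forall t x y, (t < 2)%N -> (x < r)%N -> (y < r)%N ->
        mat s' t j x y = merge_matrix r u v (M t) x y
     & other_levels_same j s s']).
Proof.
move=> As HM.
have lr : (r.-1 < r)%N by lia.
have rW : (r < W)%N by apply: leq_ltn_trans HW; nia.
have sub1 s' : at_level s' -> wsafe W TB s' lastE /\ weval s' lastE = r.-1.
  case=> _ _ e _ _; rewrite /= e subn1; split=> //.
  by rewrite (ltn_trans _ W_gt2) //=; exact: ltn_trans rW.
pose M1 t x y := if x == u then M t u y + M t v y else M t x y.
pose M2 t x y := if y == u then M1 t x u + M1 t x v else M1 t x y.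
pose M3 t x y := if x == v then M2 t r.-1 y else M2 t x y.
have trans3 j' s1 s2 s3 : other_levels_same j' s1 s2 -> other_levels_same j' s2 s3 ->
  other_levels_same j' s1 s3 by move=> h1 h2 q hq; rewrite h2 // h1.
apply: surely_seqN.
  apply: (@merge_loop_ok s (WVar 17) (WVar 15) (fun=> u) id _
     (fun t x => M t u x + M t v x) M As HM) => //.
  - by move=> s' x [_ _ _ eu ev] ex lx; split.
  - move=> s' t x As' ex lx t2 HM'; have [_ _ _ eu ev] := As'.
    have lu : (weval s' (WVar 17) < r)%N by rewrite /= eu.
    have lv : (weval s' (WVar 18) < r)%N by rewrite /= ev.
    have lx' : (weval s' (WVar 15) < r)%N by rewrite /= ex.
    have [sa ea] := @entry_ok s' t (WVar 17) (WVar 15) As' t2 isT isT lu lx'.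
    have [sb eb] := @entry_ok s' t (WVar 18) (WVar 15) As' t2 isT isT lv lx'.
    split; first exact: (introT andP (conj sa sb)).
    transitivity (reval s' (entry t (WVar 17) (WVar 15)) + reval s' (entry t (WVar 18) (WVar 15))) => //.
    rewrite ea eb -[weval s' (WVar 15)]/(wreg s' 15) -[weval s' (WVar 17)]/(wreg s' 17) -[weval s' (WVar 18)]/(wreg s' 18) eu ev ex.
    by rewrite !HM' //; [move=> y ly; right; lia|move=> y ly; right; lia].
move=> s1 F1 _ [As1 W1 N1 O1].
have HM1 t x y : (t < 2)%N -> (x < r)%N -> (y < r)%N -> mat s1 t j x y = M1 t x y.
  move=> t2 lx ly; rewrite /M1; case: eqP => [->|ne]; first exact: W1.
  by apply: N1 => // z lz; left.
apply: surely_seqN.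
  apply: (@merge_loop_ok s1 (WVar 15) (WVar 17) id (fun=> u) _
     (fun t x => M1 t x u + M1 t x v) M1 As1 HM1) => //.
  - by move=> s' x [_ _ _ eu ev] ex lx; split.
  - move=> s' t x As' ex lx t2 HM'; have [_ _ _ eu ev] := As'.
    have lu : (weval s' (WVar 17) < r)%N by rewrite /= eu.
    have lv : (weval s' (WVar 18) < r)%N by rewrite /= ev.
    have lx' : (weval s' (WVar 15) < r)%N by rewrite /= ex.
    have [sa ea] := @entry_ok s' t (WVar 15) (WVar 17) As' t2 isT isT lx' lu.
    have [sb eb] := @entry_ok s' t (WVar 15) (WVar 18) As' t2 isT isT lx' lv.
    split; first exact: (introT andP (conj sa sb)).
    transitivity (reval s' (entry t (WVar 15) (WVar 17)) + reval s' (entry t (WVar 15) (WVar 18))) => //.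
    rewrite ea eb -[weval s' (WVar 15)]/(wreg s' 15) -[weval s' (WVar 17)]/(wreg s' 17) -[weval s' (WVar 18)]/(wreg s' 18) eu ev ex.
    by rewrite !HM' //; [move=> y ly; left; lia|move=> y ly; left; lia].
move=> s2 F2 _ [As2 W2 N2 O2].
have HM2 t x y : (t < 2)%N -> (x < r)%N -> (y < r)%N -> mat s2 t j x y = M2 t x y.
  move=> t2 lx ly; rewrite /M2; case: eqP => [->|ne]; first exact: W2.
  by apply: N2 => // z lz; right.
apply: surely_seqN.
  apply: (@merge_loop_ok s2 (WVar 18) (WVar 15) (fun=> v) id _
     (fun t x => M2 t r.-1 x) M2 As2 HM2) => //.
  - by move=> s' x [_ _ _ eu ev] ex lx; split.
  - move=> s' t x As' ex lx t2 HM'; have [sl el] := sub1 s' As'.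
    have ll : (weval s' lastE < r)%N by rewrite el.
    have lx' : (weval s' (WVar 15) < r)%N by rewrite /= ex.
    have [sa ea] := @entry_ok s' t lastE (WVar 15) As' t2 sl isT ll lx'.
    split=> //; rewrite ea el [weval _ _]/= ex.
    by rewrite HM' // => y ly; right; lia.
move=> s3 F3 _ [As3 W3 N3 O3].
have HM3 t x y : (t < 2)%N -> (x < r)%N -> (y < r)%N -> mat s3 t j x y = M3 t x y.
  move=> t2 lx ly; rewrite /M3; case: eqP => [->|ne]; first exact: W3.
  by apply: N3 => // z lz; left.
apply: surely_le (@merge_loop_ok s3 (WVar 15) (WVar 18) id (fun=> v) _
     (fun t x => M3 t x r.-1) M3 As3 HM3 _ _ _ _) _ _ => //.
- by move=> s' x [_ _ _ eu ev] ex lx; split.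
- move=> s' t x As' ex lx t2 HM'; have [sl el] := sub1 s' As'.
  have ll : (weval s' lastE < r)%N by rewrite el.
  have lx' : (weval s' (WVar 15) < r)%N by rewrite /= ex.
  have [sa ea] := @entry_ok s' t (WVar 15) lastE As' t2 isT sl lx' ll.
  split=> //; rewrite ea el [weval _ _]/= ex.
  by rewrite HM' // => y ly; left; lia.
move=> s4 F4 _ [As4 W4 N4 O4]; split=> //.
- move=> t x y t2 lx ly; rewrite /merge_matrix.
  case: eqP => [->|ne]; first exact: W4.
  by apply: N4 => // z lz; right.
- exact: (trans3 _ _ _ _ (trans3 _ _ _ _ (trans3 _ _ _ _ O1 O2) O3) O4).
Qed.
End Merge.
End Memory.

(** * Programs that inspect vertices and draw an edge *)

Lemma eq_scan (R : realType) (w w' : nat -> R) th acc cur l :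
  (forall x, x \in l -> w x = w' x) -> scan w th acc cur l = scan w' th acc cur l.
Proof.
elim: l acc cur => //= x l IH acc cur h; rewrite h ?mem_head // IH // => y yl.
by rewrite h // inE yl orbT.
Qed.

Lemma sum_iotaS (R : realType) (F : nat -> R) x :
  \sum_(y <- iota 0 x.+1) F y = \sum_(y <- iota 0 x) F y + F x.
Proof. by rewrite -addn1 iotaD big_cat /= big_seq1. Qed.

Notation zeroR := (RWord (WNum 0)).
Notation oneR := (RWord (WNum 1)).

(* Real registers: 0 and 1 = the incumbent line (A, B), 2 = the incumbent
   parameter, 3 and 4 = the coefficients (X, Y) of the contraction weights,
   5 = their total; word register 20 is the flag of phase 2. *)
Definition check_body (upd : hcmd) : hcmd :=
  HSetR 10 (entry 0 (WVar 15) (WVar 15)) ;;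
  HSetR 11 (entry 1 (WVar 15) (WVar 15)) ;;
  HSetR 6 (RVar 6 [+r] RVar 10) ;; HSetR 7 (RVar 7 [+r] RVar 11) ;; upd.

Definition check (upd post : hcmd) : hcmd :=
  (HSetR 6 zeroR ;; HSetR 7 zeroR) ;;
  HFor 15 16 (WVar 12) (check_body upd) ;; post.

Definition upd1 : hcmd :=
  HIf (LtR (RVar 10) (RVar 0)) (HSetR 0 (RVar 10) ;; HSetR 1 (RVar 11))
    (HIf (EqR (RVar 10) (RVar 0))
       (HIf (LtR (RVar 11) (RVar 1)) (HSetR 1 (RVar 11)) HSkip) HSkip).
Definition post1 : hcmd :=
  HIf (EqR (RVar 6) zeroR)
    (HSetR 3 zeroR ;; HSetR 4 oneR ;; HSetR 5 (RVar 7))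
    (HSetR 3 oneR ;; HSetR 4 zeroR ;; HSetR 5 (RVar 6)).

(** A tie also performs the update: the parameter keeps its value, but the flag has to record that a
    cut attains it. *)
Definition upd2 : hcmd :=
  HIf (LtR (RVar 11) (RVar 1))
    (HIf (LtR (RVar 2 [*r] (RVar 1 [-r] RVar 11)) (RVar 10 [-r] RVar 0)) HSkip
       (HSetR 2 ((RVar 10 [-r] RVar 0) [/r] (RVar 1 [-r] RVar 11)) ;; HSetW 20 (WNum 1)))
    HSkip.
Definition post2 : hcmd :=
  HSetR 3 oneR ;; HSetR 4 (RVar 2) ;; HSetR 5 (RVar 6 [+r] RVar 2 [*r] RVar 7) ;;
  HIf (EqR (RVar 5) zeroR)
    (HIf (LtW (WNum 3) (WVar 12)) (HIf (LtR zeroR (RVar 6)) (HSetW 20 (WNum 1)) HSkip)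
       HSkip) HSkip.

Definition sel1 : hcmd :=
  (HSetR 9 (RVar 5 [*r] RWord (WVar 19) [/r] RWord (WVar 3)) ;; HSetR 8 zeroR ;;
   HSetW 17 (WNum 0)) ;;
  HFor 15 16 (WVar 12)
    (HIf (LtR (RVar 9) (RVar 8)) HSkip (HSetW 17 (WVar 15)) ;;
     HSetR 8 (RVar 8 [+r] (RVar 3 [*r] entry 0 (WVar 15) (WVar 15) [+r]
                         RVar 4 [*r] entry 1 (WVar 15) (WVar 15)))).

(** The default neighbour is [1] for vertex [0] and [0] for any other, so the two ends differ
    whatever the weights are. *)
Definition sel2 : hcmd :=
  (HSetR 9 ((RVar 3 [*r] entry 0 (WVar 17) (WVar 17) [+r]
             RVar 4 [*r] entry 1 (WVar 17) (WVar 17))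
             [*r] RWord (WVar 19) [/r] RWord (WVar 3)) ;; HSetR 8 zeroR ;;
   HIf (EqW (WVar 17) (WNum 0)) (HSetW 18 (WNum 1)) (HSetW 18 (WNum 0))) ;;
  HFor 15 16 (WVar 12)
    (HIf (EqW (WVar 15) (WVar 17)) HSkip
      (HIf (LtR (RVar 9) (RVar 8)) HSkip (HSetW 18 (WVar 15)) ;;
       HSetR 8 (RVar 8 [-r] (RVar 3 [*r] entry 0 (WVar 17) (WVar 15) [+r]
                           RVar 4 [*r] entry 1 (WVar 17) (WVar 15))))).

Definition pick_edge : hcmd := HRand 19 (WVar 3) ;; sel1 ;; HRand 19 (WVar 3) ;; sel2.
Definition contract_edge : hcmd := pick_edge ;; merge_vertices ;; HSetW 12 (WVar 12 [-] WNum 1).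

Section Steps.
Variables (R : realType) (W d n B0 K m : nat).
Notation TB := (40 + d)%N.
Notation st := (state R).
Implicit Types (s : st).
Notation surely := (@surely R W TB).
Notation hoare := (@hoare R W TB).
Notation bounded := (@bounded R W TB).
Notation env := (env n B0 K m).
Notation mat := (@mat R n B0).
Hypothesis n_gt1 : (1 < n)%N.
Hypothesis HW : (B0 + K.+1 * (n * n) * 2 < W)%N.
Hypothesis m_gt0 : (0 < m)%N.

Definition lvl j r s : Prop := [/\ env s, wreg s 11 = j & wreg s 12 = r].

Lemma lvl_frame c j r s s' : frame c s s' ->
  all (fun i => i \notin written_w c) [:: 1; 2; 3; 4; 11; 12]%N -> lvl j r s -> lvl j r s'.
Proof.
move=> [h _ _ _] /= /and5P[h1 h2 h3 h4 /and3P[h5 h6 _]].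
by case=> -[e1 e2 e3 e4] e5 e6; split; [split|..]; rewrite h.
Qed.

Section Level.
Variables (j r : nat).
Hypotheses (ltj : (j <= K)%N) (rn : (r <= n)%N) (r2 : (1 < r)%N).

Lemma entryP s t xe ye x y : lvl j r s -> (t < 2)%N -> wsafe W TB s xe ->
  wsafe W TB s ye -> weval s xe = x -> weval s ye = y -> (x < r)%N -> (y < r)%N ->
  rsafe W TB s (entry t xe ye) /\ reval s (entry t xe ye) = mat s t j x y.
Proof.
move=> [Es ej er] t2 sx sy <- <- lx ly.
have As : at_level n B0 K m j r (wreg s 17) (wreg s 18) s by split.
exact: (entry_ok n_gt1 HW ltj rn As).
Qed.

Lemma W_gt1 : (1 < W)%N.
Proof. exact: ltnW (W_gt2 n_gt1 HW). Qed.

(** [Iv] describes the incumbent after [x] inspected vertices; the running sums of the two diagonals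
    are treated here once for both searches. *)
Lemma check_ok s upd post (Iv : nat -> R -> R -> R -> nat -> Prop) Post :
  let vals x s' := Iv x (rreg s' 0) (rreg s' 1) (rreg s' 2) (wreg s' 20) in
  lvl j r s -> {subset written_w upd <= [:: 20%N]} ->
  {subset written_r upd <= [:: 0; 1; 2]%N} -> ~~ stores upd ->
  vals 0%N s ->
  (forall x s', (x < r)%N -> lvl j r s' -> rreg s' 10 = mat s 0 j x x ->
     rreg s' 11 = mat s 1 j x x -> vals x s' ->
     surely (hcost TB upd) upd s' (vals x.+1)) ->
  (forall s', lvl j r s' -> rmem s' = rmem s -> vals r s' ->
     rreg s' 6 = \sum_(x <- iota 0 r) mat s 0 j x x ->
     rreg s' 7 = \sum_(x <- iota 0 r) mat s 1 j x x ->
     surely (hcost TB post) post s' Post) ->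
  surely (r.+1 * hcost TB (check upd post)) (check upd post) s Post.
Proof.
move=> vals Ls sw sr ns I0 Hu Hp.
have w1 := W_gt1.
have nw i : i != 20%N -> i \notin written_w upd.
  by move=> ni; apply/negP => /sw; rewrite inE (negbTE ni).
have nr i : (2 < i)%N -> i \notin written_r upd.
  by move=> ni; apply/negP => /sr; rewrite !inE; lia.
apply: (surely_seqN (P1 := fun s1 => [/\ lvl j r s1, rmem s1 = rmem s, vals 0%N s1,
    rreg s1 6 = 0 & rreg s1 7 = 0])).
  apply: surelyN; apply: surely_setr_seq => //=; first by rewrite (ltnW w1).
  by apply: surely_setr => //=; rewrite (ltnW w1).
move=> s1 F1 _ [L1 m1 v1 z6 z7].
have [_ _ er] := L1.
apply: (surely_seqN (P1 := fun s' =>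
    [/\ lvl j r s', rmem s' = rmem s, vals r s',
       rreg s' 6 = \sum_(x <- iota 0 r) mat s 0 j x x &
       rreg s' 7 = \sum_(x <- iota 0 r) mat s 1 j x x])).
  apply: (@surely_forN R W TB 15 16 (WVar 12) (check_body upd) s1 r (fun x s' =>
    [/\ lvl j r s', rmem s' = rmem s, vals x s',
       rreg s' 6 = \sum_(x <- iota 0 x) mat s 0 j x x &
       rreg s' 7 = \sum_(x <- iota 0 x) mat s 1 j x x])) => //=.
  - exact: nw.
  - exact: nw.
  - by split=> //; rewrite ?big_nil.
  move=> x s' lx F _ ex eb [L' m' v' e6 e7].
  have [sa ea] := @entryP s' 0 (WVar 15) (WVar 15) x x L' isT isT isT ex ex lx lx.
  apply: (surely_setr_seq (i := 10)) => //.
  have mm t : mat s' t j x x = mat s t j x x by rewrite /mat m'.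
  rewrite ea mm; set s2 := set_rreg _ _ _.
  have L2 : lvl j r s2 by [].
  have [sb eb2] := @entryP s2 1 (WVar 15) (WVar 15) x x L2 isT isT isT ex ex lx lx.
  have mm2 t : mat s2 t j x x = mat s t j x x by rewrite /mat /= m'.
  apply: (surely_setr_seq (i := 11)) => //; rewrite eb2 mm2.
  apply: (surely_setr_seq (i := 6)) => //; apply: (surely_setr_seq (i := 7)) => //=.
  set s3 := set_rreg _ 7 _.
  apply: surely_le (Hu x s3 lx L' _ _ _) _ _ => //=.
  move=> s4 F4 _ v4; have [fw fr _ fm] := F4.
  split=> //.
  - by apply: (@lvl_frame upd j r s3 s4 F4 _ L'); rewrite /= !nw.
  - by rewrite /= fm.
  - by rewrite sum_iotaS -e6 -[LHS]/(rreg s4 6) fr ?nr.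
  - by rewrite sum_iotaS -e7 -[LHS]/(rreg s4 7) fr ?nr.
move=> s2 F2 _ [L2 m2 v2 e6 e7].
by apply: surelyN; exact: Hp.
Qed.

Lemma upd1_ok A0 B1 l0 fl0 (M0 M1 : nat -> R) x s :
  let Iv x A B (l : R) (fl : nat) := [/\ l = l0, fl = fl0,
     (A = A0 /\ B = B1) \/ (exists2 y, (y < x)%N & A = M0 y /\ B = M1 y),
     lexle A B A0 B1 & forall y, (y < x)%N -> lexle A B (M0 y) (M1 y)] in
  let vals x s' := Iv x (rreg s' 0) (rreg s' 1) (rreg s' 2) (wreg s' 20) in
  rreg s 10 = M0 x -> rreg s 11 = M1 x -> vals x s ->
  surely (hcost TB upd1) upd1 s (vals x.+1).
Proof.
move=> Iv vals e10 e11 [el efl src le0 ley].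
have ltr A B A' B' A2 B2 : lexle A B A' B' -> lexle A' B' A2 B2 -> @lexle R A B A2 B2.
  by rewrite /lexle => -[h|[-> h]] [h'|[<- h']]; lra.
have all A B : lexle A B (rreg s 0) (rreg s 1) -> lexle A B (M0 x) (M1 x) ->
    forall y, (y < x.+1)%N -> lexle A B (M0 y) (M1 y).
  move=> h1 h2 y; rewrite ltnS leq_eqVlt => /orP[/eqP->//|/ley]; exact: ltr.
have src' : (rreg s 0 = A0 /\ rreg s 1 = B1) \/
    (exists2 y, (y < x.+1)%N & rreg s 0 = M0 y /\ rreg s 1 = M1 y).
  by case: src => [|[y ly h]]; [left|right; exists y => //; lia].
apply: surely_if => //= [lt|nlt].
  apply: surely_setr_seq => //; apply: surely_setr => //=.
  have lex : lexle (rreg s 10) (rreg s 11) (rreg s 0) (rreg s 1) by left.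
  split=> //=.
  - by right; exists x; rewrite ?e10 ?e11.
  - exact: ltr le0.
  - by apply: all => //; rewrite e10 e11; right.
apply: surely_if => //= [/eqP eq|neq].
  apply: surely_if => //= [lt|nlt2].
    apply: surely_setr => //=.
    have lex : lexle (rreg s 0) (rreg s 11) (rreg s 0) (rreg s 1) by right; split=> //; exact: ltW.
    split=> //=.
    + by right; exists x; rewrite -?eq ?e10 ?e11.
    + exact: ltr le0.
    + by apply: all => //; rewrite -eq e10 e11; right.
  apply: surely_skip; split=> //; apply: all; first by right.
  by right; rewrite -e10 -e11 eq; split=> //; rewrite leNgt.
apply: surely_skip; split=> //; apply: all; first by right.
by left; rewrite -e10 lt_neqAle leNgt nlt andbT eq_sym.
Qed.

(** A new crossing is never later than the old parameter, so vertices inspected earlier stay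
    cleared; a tie among them is allowed because the flag becomes [1]. *)
Lemma upd2_ok A0 B1 l0 fl0 (M0 M1 : nat -> R) x s : (fl0 < 2)%N ->
  let Iv x A B (l : R) (fl : nat) := [/\ A = A0, B = B1, (l <= l0) /\ (fl < 2)%N,
     (l = l0 /\ fl = fl0) \/
     (fl = 1%N /\ exists2 y, (y < x)%N & M1 y < B1 /\ l * (B1 - M1 y) = M0 y - A0)
   & forall y, (y < x)%N -> cleared A0 B1 l fl (M0 y) (M1 y)] in
  let vals x s' := Iv x (rreg s' 0) (rreg s' 1) (rreg s' 2) (wreg s' 20) in
  rreg s 10 = M0 x -> rreg s 11 = M1 x -> vals x s ->
  surely (hcost TB upd2) upd2 s (vals x.+1).
Proof.
move=> f02 Iv vals e10 e11 [eA eB [lel fl2] src cl].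
have src' : (rreg s 2 = l0 /\ wreg s 20 = fl0) \/
    (wreg s 20 = 1%N /\ exists2 y, (y < x.+1)%N & M1 y < B1 /\ rreg s 2 * (B1 - M1 y) = M0 y - A0).
  by case: src => [|[h [y ly h']]]; [left|right; split=> //; exists y => //; lia].
have stay : cleared A0 B1 (rreg s 2) (wreg s 20) (M0 x) (M1 x) -> vals x.+1 s.
  move=> hx; split=> // y; rewrite ltnS leq_eqVlt => /orP[/eqP->//|]; exact: cl.
apply: surely_if => //= [lt|nlt]; last first.
  by apply: surely_skip; apply: stay => h; rewrite eB e11 h in nlt.
apply: surely_if => //= [lt2|nlt2].
  by apply: surely_skip; apply: stay => _; left; rewrite -e10 -e11 -eA -eB.
apply: surely_setr_seq => //; apply: surely_setw => //=; first exact: W_gt1.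
rewrite -leNgt in nlt2; rewrite e10 e11 eA eB in lt nlt2 *.
have p : 0 < B1 - M1 x by rewrite subr_gt0.
set l' := (M0 x - A0) / (B1 - M1 x).
have el' : l' * (B1 - M1 x) = M0 x - A0 by rewrite /l' divfK // gt_eqF.
have l'l : l' <= rreg s 2 by rewrite /l' ler_pdivrMr.
split=> //=; first by split=> //; exact: le_trans lel.
- by right; split=> //; exists x.
- move=> y; rewrite ltnS leq_eqVlt => /orP[/eqP->|ly] h; first by right.
  have q : 0 < B1 - M1 y by rewrite subr_gt0.
  have le2 : l' * (B1 - M1 y) <= rreg s 2 * (B1 - M1 y) by rewrite ler_pM2r.
  have [h1|[_ h1]] := cl y ly h; first by left; exact: le_lt_trans h1.
  by move: le2; rewrite h1 le_eqVlt => /orP[/eqP|]; [right|left].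
Qed.

Lemma sel1_ok s U : lvl j r s -> wreg s 19 = U ->
  surely (r.+1 * hcost TB sel1) sel1 s (fun s' => rmem s' = rmem s /\
    wreg s' 17 = scan (fun x => rreg s 3 * mat s 0 j x x + rreg s 4 * mat s 1 j x x)
      (rreg s 5 * U%:R / m%:R) 0 0 (iota 0 r)).
Proof.
move=> Ls eU; have w1 := W_gt1; have [[_ _ e3 _] _ er] := Ls.
pose w x := rreg s 3 * mat s 0 j x x + rreg s 4 * mat s 1 j x x.
pose th := rreg s 5 * U%:R / m%:R.
apply: (surely_seqN (P1 := fun s1 => [/\ lvl j r s1, rmem s1 = rmem s, rreg s1 9 = th,
    rreg s1 3 = rreg s 3 /\ rreg s1 4 = rreg s 4 & rreg s1 8 = 0 /\ wreg s1 17 = 0%N])).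
  apply: surelyN; apply: surely_setr_seq => //; apply: surely_setr_seq => //=.
    by rewrite (ltnW w1).
  apply: surely_setw => //=; first by rewrite (ltnW w1).
  by split=> //=; rewrite e3 eU.
move=> s1 F1 _ [L1 m1 z9 z34 [z8 z17]].
have [_ _ er1] := L1.
(* Invariant: scanning the rest of the list from the current registers gives the result of the whole
   scan. *)
apply: surely_le (@surely_forN R W TB 15 16 (WVar 12) _ s1 r (fun x s' =>
    [/\ lvl j r s', rmem s' = rmem s, rreg s' 9 = th, rreg s' 3 = rreg s 3 /\ rreg s' 4 = rreg s 4
      & scan w th (rreg s' 8) (wreg s' 17) (iota x (r - x)) = scan w th 0 0 (iota 0 r)])
    _ _ _ _ _ _ _ _ _) _ _ => //=.
- by split=> //=; rewrite subn0 z8 z17.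
- move=> x s' lx F _ ex eb [L' m' e9 [e3' e4'] es].
  have key (s2 : st) : lvl j r s2 -> rmem s2 = rmem s -> rreg s2 9 = th ->
     rreg s2 3 = rreg s 3 /\ rreg s2 4 = rreg s 4 -> rreg s2 8 = rreg s' 8 -> wreg s2 15 = x ->
     wreg s2 17 = (if rreg s' 8 <= th then x else wreg s' 17) ->
     surely (hcost TB (HSetR 8 (RVar 8 [+r] (RVar 3 [*r] entry 0 (WVar 15) (WVar 15) [+r]
                         RVar 4 [*r] entry 1 (WVar 15) (WVar 15)))))
      (HSetR 8 (RVar 8 [+r] (RVar 3 [*r] entry 0 (WVar 15) (WVar 15) [+r]
                         RVar 4 [*r] entry 1 (WVar 15) (WVar 15)))) s2 (fun s'' =>
     [/\ lvl j r (setw s'' 15 x.+1), rmem s'' = rmem s, rreg s'' 9 = th,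
       rreg s'' 3 = rreg s 3 /\ rreg s'' 4 = rreg s 4
      & scan w th (rreg s'' 8) (wreg s'' 17) (iota x.+1 (r - x.+1)) = scan w th 0 0 (iota 0 r)]).
    move=> L2 m2 e9' [f3 f4] e8' ex2 e17.
    have [sa ea] := @entryP s2 0 (WVar 15) (WVar 15) x x L2 isT isT isT ex2 ex2 lx lx.
    have [sb eb2] := @entryP s2 1 (WVar 15) (WVar 15) x x L2 isT isT isT ex2 ex2 lx lx.
    apply: surely_setr => //; first exact: (introT andP (conj isT (introT andP (conj sa sb)))).
    set rv := reval _ _.
    have -> : rv = rreg s' 8 + w x.
      transitivity (rreg s2 8 + (rreg s2 3 * reval s2 (entry 0 (WVar 15) (WVar 15)) +
         rreg s2 4 * reval s2 (entry 1 (WVar 15) (WVar 15)))) => //.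
      by rewrite ea eb2 f3 f4 e8' /w /mat m2.
    by split=> //=; rewrite -es e17 -(subnSK lx).
  apply: (surely_seq (P1 := fun s2 => [/\ lvl j r s2, rmem s2 = rmem s /\ rreg s2 9 = th,
       rreg s2 3 = rreg s 3 /\ rreg s2 4 = rreg s 4, rreg s2 8 = rreg s' 8 /\ wreg s2 15 = x
       & wreg s2 17 = (if rreg s' 8 <= th then x else wreg s' 17)])).
    apply: surely_if => //= h.
      apply: surely_skip; split=> //; rewrite ifF //; apply/negbTE.
      by rewrite -ltNge -e9.
    apply: surely_setw => //=; split=> //=; rewrite ex ifT //.
    by rewrite leNgt -e9.
  move=> s2 F2 _ [h1 [h2 h3] h4 [h5 h6] h7].
  by apply: surely_le (key s2 h1 h2 h3 h4 h5 h6 h7) _ _.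
- move=> s' _ _ [_ -> _ _]; rewrite subnn /= => ->; by split.
Qed.

Lemma sel2_ok s U u : lvl j r s -> wreg s 19 = U -> wreg s 17 = u -> (u < r)%N ->
  surely (r.+1 * hcost TB sel2) sel2 s (fun s' => rmem s' = rmem s /\
    wreg s' 18 = scan (fun y => - (rreg s 3 * mat s 0 j u y + rreg s 4 * mat s 1 j u y))
      ((rreg s 3 * mat s 0 j u u + rreg s 4 * mat s 1 j u u) * U%:R / m%:R) 0
      (u == 0%N) [seq y <- iota 0 r | y != u]).
Proof.
move=> Ls eU eu lu; have w1 := W_gt1; have [[_ _ e3 _] _ er] := Ls.
pose w y := - (rreg s 3 * mat s 0 j u y + rreg s 4 * mat s 1 j u y).
pose th := (rreg s 3 * mat s 0 j u u + rreg s 4 * mat s 1 j u u) * U%:R / m%:R.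
have [sa ea] := @entryP s 0 (WVar 17) (WVar 17) u u Ls isT isT isT eu eu lu lu.
have [sb eb] := @entryP s 1 (WVar 17) (WVar 17) u u Ls isT isT isT eu eu lu lu.
have s9 : rsafe W TB s ((RVar 3 [*r] entry 0 (WVar 17) (WVar 17) [+r]
             RVar 4 [*r] entry 1 (WVar 17) (WVar 17)) [*r] RWord (WVar 19) [/r] RWord (WVar 3)).
  by rewrite -[rsafe _ _ _ _]/(rsafe W TB s (entry 0 (WVar 17) (WVar 17)) &&
    rsafe W TB s (entry 1 (WVar 17) (WVar 17)) && true && true) sa sb.
have v9 : reval s ((RVar 3 [*r] entry 0 (WVar 17) (WVar 17) [+r]
             RVar 4 [*r] entry 1 (WVar 17) (WVar 17)) [*r] RWord (WVar 19) [/r] RWord (WVar 3)) = th.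
  transitivity ((rreg s 3 * reval s (entry 0 (WVar 17) (WVar 17)) +
     rreg s 4 * reval s (entry 1 (WVar 17) (WVar 17))) * (wreg s 19)%:R / (wreg s 3)%:R) => //.
  by rewrite ea eb eU e3.
apply: (surely_seqN (P1 := fun s1 => [/\ lvl j r s1, rmem s1 = rmem s, rreg s1 9 = th,
      [/\ rreg s1 3 = rreg s 3, rreg s1 4 = rreg s 4 & wreg s1 17 = u]
      & rreg s1 8 = 0 /\ wreg s1 18 = (u == 0%N)])).
  apply: surelyN; apply: (surely_setr_seq (i := 9)) => //; rewrite v9.
  apply: surely_setr_seq => //=; first by rewrite (ltnW w1).
  apply: surely_if => //=; first by rewrite (ltnW w1).
    by move=> /eqP e; apply: surely_setw => //=; split=> //=; split=> //; rewrite -eu e.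
  move=> ne; apply: surely_setw => //=; first by rewrite (ltnW w1).
  by split=> //=; split=> //; rewrite -eu (negbTE ne).
move=> s1 F1 _ [L1 m1 e9 [e3' e4 e17] [e8 e18]].
have [_ _ er1] := L1.
pose fl x := [seq y <- iota x (r - x) | y != u].
apply: surely_le (@surely_forN R W TB 15 16 (WVar 12) _ s1 r (fun x s' =>
    [/\ lvl j r s', rmem s' = rmem s, rreg s' 9 = th,
      [/\ rreg s' 3 = rreg s 3, rreg s' 4 = rreg s 4 & wreg s' 17 = u]
      & scan w th (rreg s' 8) (wreg s' 18) (fl x) = scan w th 0 (u == 0%N) (fl 0%N)])
    _ _ _ _ _ _ _ _ _) _ _ => //=.
- by split=> //=; rewrite e8 e18.
- move=> x s' lx F _ ex _ [L' m' f9 [f3 f4 f17] es].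
  have flx : fl x = if x == u then fl x.+1 else x :: fl x.+1.
    by rewrite /fl -(subnSK lx) /=; case: eqP.
  apply: surely_if => //=.
    rewrite ex f17 => h; apply: surely_skip; split=> //=.
    by rewrite -es flx h.
  rewrite ex f17 => h; rewrite flx (negbTE h) /= in es.
  apply: (surely_seq (P1 := fun s2 => [/\ lvl j r s2, rmem s2 = rmem s /\ rreg s2 9 = th,
       [/\ rreg s2 3 = rreg s 3, rreg s2 4 = rreg s 4 & wreg s2 17 = u], rreg s2 8 = rreg s' 8 /\ wreg s2 15 = x
       & wreg s2 18 = (if rreg s' 8 <= th then x else wreg s' 18)])).
    apply: surely_if => //= h2.
      apply: surely_skip; split=> //; rewrite ifF //; apply/negbTE.
      by rewrite -ltNge -f9.
    apply: surely_setw => //=; split=> //=; rewrite ex ifT //.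
    by rewrite leNgt -f9.
  move=> s2 F2 _ [L2 [m2 g9] [g3 g4 g17] [g8 ex2] g18].
  have [sa2 ea2] := @entryP s2 0 (WVar 17) (WVar 15) u x L2 isT isT isT g17 ex2 lu lx.
  have [sb2 eb2] := @entryP s2 1 (WVar 17) (WVar 15) u x L2 isT isT isT g17 ex2 lu lx.
  apply: surely_setr => //; first exact: (introT andP (conj isT (introT andP (conj sa2 sb2)))).
  set rv := reval _ _.
  have -> : rv = rreg s' 8 + w x.
    transitivity (rreg s2 8 - (rreg s2 3 * reval s2 (entry 0 (WVar 17) (WVar 15)) +
       rreg s2 4 * reval s2 (entry 1 (WVar 17) (WVar 15)))) => //.
    by rewrite ea2 eb2 g3 g4 g8 /w /mat m2.
  by split=> //=; rewrite -es g18.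
- move=> s' _ _ [_ -> _ _]; rewrite /fl subnn /= => ->; by rewrite subn0; split.
Qed.
End Level.
End Steps.

(** * One random contraction *)

Section Contract.
Variables (R : realType) (W d n B0 K m : nat).
Notation TB := (40 + d)%N.
Notation st := (state R).
Implicit Types (s : st).
Notation surely := (@surely R W TB).
Notation hoare := (@hoare R W TB).
Notation env := (env n B0 K m).
Notation mat := (@mat R n B0).
Notation lvl := (@lvl R n B0 K m).
Notation other_levels_same := (@other_levels_same R n B0).
Hypothesis n_gt1 : (1 < n)%N.
Hypothesis HW : (B0 + K.+1 * (n * n) * 2 < W)%N.
Hypothesis m_gt0 : (0 < m)%N.

Lemma hoare_seqN N c1 c2 s v V1 V2 : hoare (N * hcost TB c1) c1 s v V1 ->
  (forall s', frame c1 s s' -> bounded W TB s' -> 0 < V1 s' ->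
     hoare (N * hcost TB c2) c2 s' (V1 s') V2) ->
  hoare (N * hcost TB (HSeq c1 c2)) (HSeq c1 c2) s v V2.
Proof. by move=> H1 H2; rewrite /= mulnDr; exact: hoare_seq H1 H2. Qed.

Lemma frame_seq c1 c2 s1 s2 s3 : frame c1 s1 s2 -> frame c2 s2 s3 ->
  frame (c1 ;; c2) s1 s3.
Proof.
by move=> F1 F2; apply: frame_trans F1 F2 => //= i; rewrite mem_cat => ->; rewrite ?orbT.
Qed.

Lemma hoare_rand_setw N s (g : nat -> R) : wreg s 3 = m ->
  hoare (N.+1 * hcost TB (HRand 19 (WVar 3))) (HRand 19 (WVar 3)) s
    ((\sum_(0 <= U < m) g U) / m%:R)
    (fun s1 => if `[< s1 = setw s 19 (wreg s1 19) >] then g (wreg s1 19) else 0).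
Proof.
move=> e3; set V := fun s1 => _.
have := @hoare_rand R W TB 19 (WVar 3) s V isT isT; rewrite [weval _ _]/= e3 => /(_ m_gt0) H.
apply: hoare_le H _ _ _ => //.
rewrite big_mkord ler_wpM2r ?invr_ge0 ?ler0n // ler_sum // => U _.
by rewrite /V asboolT.
Qed.

(** For all draws and all weights both ends are in range and distinct, so the outcome is well formed
    even when nothing is known about the weights. The only probabilistic content is the average of
    [val] over the [m ^ 2] pairs of draws. *)
Lemma contract_ok j r s (val : nat -> nat -> R) (v : R) (V : st -> R) :
  let u U := scan (fun x => rreg s 3 * mat s 0 j x x + rreg s 4 * mat s 1 j x x)
      (rreg s 5 * U%:R / m%:R) 0 0 (iota 0 r) in
  let w u U := scan (fun y => - (rreg s 3 * mat s 0 j u y + rreg s 4 * mat s 1 j u y))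
      ((rreg s 3 * mat s 0 j u u + rreg s 4 * mat s 1 j u u) * U%:R / m%:R) 0
      (u == 0%N) [seq y <- iota 0 r | y != u] in
  lvl j r s -> (j <= K)%N -> (r <= n)%N -> (1 < r)%N ->
  (forall u v, 0 <= val u v) ->
  v * m%:R ^+ 2 <= \sum_(0 <= U1 < m) \sum_(0 <= U2 < m) val (u U1) (w (u U1) U2) ->
  (forall u v s', (u < r)%N -> (v < r)%N -> u != v -> lvl j r.-1 s' ->
     frame contract_edge s s' ->
     (forall t x y, (t < 2)%N -> (x < r)%N -> (y < r)%N ->
        mat s' t j x y = merge_matrix r u v (mat s t j) x y) ->
     other_levels_same j s s' -> val u v <= V s') ->
  hoare (r.+1 * hcost TB contract_edge) contract_edge s v V.
Proof.
move=> u w Ls ltj rn r2 val0 Hv HV; have w2 := W_gt2 n_gt1 HW.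
have m0 : 0 < m%:R :> R by rewrite ltr0n.
have [[_ _ e3 _] _ er] := Ls.
have ltu U : (u U < r)%N.
  have := @scan_mem R (fun x => rreg s 3 * mat s 0 j x x + rreg s 4 * mat s 1 j x x)
    (rreg s 5 * U%:R / m%:R) 0 0 (iota 0 r).
  by rewrite -/(u U) inE mem_iota => /orP[/eqP->|/andP[_]] //; lia.
have ltw x U : (w x U < r)%N && (w x U != x).
  have := @scan_mem R (fun y => - (rreg s 3 * mat s 0 j x y + rreg s 4 * mat s 1 j x y))
      ((rreg s 3 * mat s 0 j x x + rreg s 4 * mat s 1 j x x) * U%:R / m%:R) 0
      (x == 0%N) [seq y <- iota 0 r | y != x].
  rewrite -/(w x U) inE mem_filter mem_iota add0n => /orP[/eqP->|/andP[-> /= ->]] //.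
  by case: x => [|x] //=; lia.
pose good s' := [/\ lvl j r s', rmem s' = rmem s, (wreg s' 17 < r)%N,
   (wreg s' 18 < r)%N & wreg s' 17 != wreg s' 18].
apply: (@hoare_seqN _ _ _ _ _ (fun s' => if `[< good s' >] then
    val (wreg s' 17) (wreg s' 18) else 0)).
  pose rv (s : st) (g : nat -> R) (s1 : st) : R :=
    if `[< s1 = setw s 19 (wreg s1 19) >] then g (wreg s1 19) else 0.
  apply: (@hoare_seqN _ _ _ _ _ (rv s (fun U1 =>
      (\sum_(0 <= U2 < m) val (u U1) (w (u U1) U2)) / m%:R))).
    apply: hoare_le (@hoare_rand_setw r s (fun U1 => (\sum_(0 <= U2 < m) val (u U1) (w (u U1) U2)) / m%:R) e3) (leqnn _) _ _.
      rewrite -mulr_suml ler_pdivlMr // ler_pdivlMr //.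
      by rewrite -mulrA -expr2.
    move=> s1 _ _ _; exact: lexx.
  move=> s1 F1 _; rewrite /rv; case: asboolP => [E1 _|_]; last by rewrite ltxx.
  set U1 := wreg s1 19 in E1 *.
  have L1 : lvl j r s1 by rewrite E1.
  have Q0 : 0 <= (\sum_(0 <= U2 < m) val (u U1) (w (u U1) U2)) / m%:R.
    by rewrite divr_ge0 ?ler0n // sumr_ge0.
  apply: (@hoare_seqN _ _ _ _ _ (fun s' => if `[< [/\ rmem s' = rmem s,
       wreg s' 17 = u U1, lvl j r s' & rreg s' 3 = rreg s 3 /\ rreg s' 4 = rreg s 4] >]
       then (\sum_(0 <= U2 < m) val (u U1) (w (u U1) U2)) / m%:R else 0)).
    apply: surely_hoare (sel1_ok n_gt1 HW ltj rn L1 (erefl U1)) Q0 _.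
    move=> s2 F2 _ [m2 e17]; have [_ fr _ _] := F2.
    rewrite asboolT //; split.
    - by rewrite m2 E1.
    - by rewrite e17 /u E1.
    - exact: lvl_frame F2 _ L1.
    - by rewrite !fr // E1.
  move=> s2 F2 _; case: asboolP => [[m2 e17 L2 [f3 f4]] _|_]; last by rewrite ltxx.
  have [[_ _ e3' _] _ _] := L2.
  apply: (@hoare_seqN _ _ _ _ _ (rv s2 (fun U2 => val (u U1) (w (u U1) U2)))).
    exact: (@hoare_rand_setw r s2 (fun U2 => val (u U1) (w (u U1) U2)) e3').
  move=> s3 F3 _; rewrite /rv; case: asboolP => [E3 _|_]; last by rewrite ltxx.
  set U2 := wreg s3 19 in E3 *.
  have L3 : lvl j r s3 by rewrite E3.
  have e17' : wreg s3 17 = u U1 by rewrite E3.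
  apply: surely_hoare (sel2_ok n_gt1 HW ltj rn L3 (erefl U2) e17' (ltu U1)) (val0 _ _) _.
  move=> s4 F4 _ [m4 e18]; have [fw _ _ _] := F4.
  have e17'' : wreg s4 17 = u U1 by rewrite fw.
  have e18' : wreg s4 18 = w (u U1) U2.
    by rewrite e18 E3 /= f3 f4 /w /mat /= m2.
  have /andP[l1 l2] := ltw (u U1) U2.
  rewrite asboolT ?e17'' ?e18' //; split; rewrite ?e17'' ?e18' //.
  - exact: lvl_frame F4 _ L3.
  - by rewrite m4 E3 /= m2.
  - by rewrite eq_sym.
move=> s1 F1 _; case: asboolP => [[L1 m1 l17 l18 ne] _|_]; last by rewrite ltxx.
have [Es1 ej1 er1] := L1.
have As : at_level n B0 K m j r (wreg s1 17) (wreg s1 18) s1 by split.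
set val1 := val _ _.
apply: (@hoare_seqN _ _ _ _ _ (fun s' => if `[< [/\ lvl j r s',
    (forall t x y, (t < 2)%N -> (x < r)%N -> (y < r)%N ->
        mat s' t j x y = merge_matrix r (wreg s1 17) (wreg s1 18) (mat s t j) x y),
    other_levels_same j s s' & true] >] then val1 else 0)).
  have HM t x y : (t < 2)%N -> (x < r)%N -> (y < r)%N -> mat s1 t j x y = mat s t j x y.
    by move=> _ _ _; rewrite /mat m1.
  apply: surely_hoare (merge_ok n_gt1 HW ltj rn l17 l18 ne As HM) (val0 _ _) _.
  move=> s2 F2 _ [[E2 ej2 er2 _ _] H2 O2]; rewrite asboolT //; split=> //.
  by move=> q hq; rewrite O2 // m1.
move=> s2 F2 _; case: asboolP => [[L2 H2 O2 _] _|_]; last by rewrite ltxx.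
have [Es2 ej2 er2] := L2.
have H : surely (hcost TB (HSetW 12 (WVar 12 [-] WNum 1))) (HSetW 12 (WVar 12 [-] WNum 1)) s2
    (fun s3 => s3 = setw s2 12 r.-1).
  apply: surely_setw => //=; rewrite er2 ?subn1 // (ltnW w2) /=.
  apply: leq_ltn_trans HW; have : (n <= K.+1 * (n * n))%N by nia.
  lia.
apply: surely_hoare (surelyN r H) (val0 _ _) _ => s3 F3 _ E3.
have Fs := frame_seq F1 (frame_seq F2 F3).
by rewrite E3 in Fs *; exact: HV Fs H2 O2.
Qed.
End Contract.

(** * The loop over levels: survival and running time *)

Definition set_size (i : nat) (e : wexpr) : hcmd :=
  HIf (LtW (e [+] WNum 1) (WVar 1)) (HSetW i (e [+] WNum 1)) (HSetW i (WVar 1)).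

(** Register 10 holds [2 ^ j], and registers 22 and 23 receive the sizes of levels [j.+1] and [j].
    The closing check inspects the graph at its final size, since the loop checks only before
    contracting. *)
Definition action (chk : hcmd) : hcmd :=
  (set_size 22 (WVar 10 [+] WVar 10) ;; set_size 23 (WVar 10) ;; HSetW 12 (WVar 22)) ;;
  copy_level ;;
  HFor 13 14 (WVar 22 [-] WVar 23) (chk ;; contract_edge) ;; chk.

(** The square of register 10 is [4 ^ j], so the divisibility test needs no table of powers. *)
Definition level_step (chk : hcmd) : hcmd :=
  HSetW 10 (WVar 10 [/] WNum 2) ;; HSetW 11 (WVar 4 [-] WVar 8 [-] WNum 1) ;;
  HIf (EqW (WVar 6 [%] (WVar 10 [*] WVar 10)) (WNum 0)) (action chk) HSkip.

Definition phase (chk : hcmd) (N : wexpr) : hcmd :=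
  HFor 6 7 N (HSetW 10 (WVar 5) ;; HFor 8 9 (WVar 4) (level_step chk)).

Section Phase.
Variables (R : realType) (W d n B0 K m : nat).
Notation TB := (40 + d)%N.
Notation st := (state R).
Implicit Types (s : st).
Notation surely := (@surely R W TB).
Notation hoare := (@hoare R W TB).
Notation env := (env n B0 K m).
Notation mat := (@mat R n B0).
Notation lvl := (@lvl R n B0 K m).
Notation other_levels_same := (@other_levels_same R n B0).
Hypothesis n_gt1 : (1 < n)%N.
Hypothesis HW : (B0 + K.+1 * (n * n) * 2 < W)%N.
Hypothesis m_gt0 : (0 < m)%N.
Hypothesis mE : m%:R = n%:R ^+ 4 :> R.
Hypothesis KW : (2 ^ K < W.-1)%N.

Variables (a b : 'I_n -> 'I_n -> R) (C : {set 'I_n}) (chk : hcmd).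
Variables (Snd Fnd : R -> R -> R -> nat -> Prop).
Hypotheses (a_sym : forall u v, a u v = a v u) (b_sym : forall u v, b u v = b v u).

Definition vals (Pr : R -> R -> R -> nat -> Prop) s : Prop :=
  Pr (rreg s 0) (rreg s 1) (rreg s 2) (wreg s 20).

Hypothesis chk_w : {subset written_w chk <= [:: 15; 16; 20]%N}.
Hypothesis chk_s : ~~ stores chk.
(** The interface that lets one analysis serve both searches. Soundness and persistence of success
    are unconditional; only the last clause speaks of the target. *)
Hypothesis chk_ok : forall s j r f, lvl j r s -> (j <= K)%N -> (r <= n)%N -> (1 < r)%N ->
  labelling f r -> represents (mat s 0 j) a f r -> represents (mat s 1 j) b f r ->
  vals Snd s -> surely (r.+1 * hcost TB chk) chk s (fun s' =>
    [/\ vals Snd s', (vals Fnd s -> vals Fnd s') & forall side, sided C f side ->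
       vals Fnd s' \/
       ready a b (mat s 0 j) (mat s 1 j) r (rreg s' 3) (rreg s' 4) (rreg s' 5) C]).

(** This holds on every run and keeps lost branches well formed, whereas [alive] also demands that
    the target be a union of fibres. *)
Definition valid s j r : Prop := exists f, [/\ labelling f r,
  represents (mat s 0 j) a f r & represents (mat s 1 j) b f r].

Definition alive s j r : Prop := exists f side, [/\ labelling f r,
  represents (mat s 0 j) a f r, represents (mat s 1 j) b f r & sided C f side].

Lemma surely_time t t' c s Post : surely t c s Post -> (t <= t')%N -> surely t' c s Post.
Proof. by move=> H le; exact: surely_le H le _. Qed.

Lemma represents_same M M' (g : 'I_n -> 'I_n -> R) f r :
  (forall x y, (x < r)%N -> (y < r)%N -> M' x y = M x y) ->
  represents M g f r -> represents M' g f r.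
Proof. by move=> h H x y lx ly; rewrite h // H. Qed.

Lemma valid_same s s' j j' r : (forall t x y, (t < 2)%N -> (x < r)%N -> (y < r)%N ->
    mat s' t j' x y = mat s t j x y) -> valid s j r -> valid s' j' r.
Proof.
move=> h [f [lf ra rb]]; exists f; split=> //.
  by apply: represents_same ra => x y; exact: h.
by apply: represents_same rb => x y; exact: h.
Qed.

Lemma alive_same s s' j j' r : (forall t x y, (t < 2)%N -> (x < r)%N -> (y < r)%N ->
    mat s' t j' x y = mat s t j x y) -> alive s j r -> alive s' j' r.
Proof.
move=> h [f [side [lf ra rb sC]]]; exists f, side; split=> //.
  by apply: represents_same ra => x y; exact: h.
by apply: represents_same rb => x y; exact: h.
Qed.

Lemma mat_other s s' j i : other_levels_same j s s' -> i != j ->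
  forall t x y, (t < 2)%N -> (x < n)%N -> (y < n)%N -> mat s' t i x y = mat s t i x y.
Proof.
move=> O ne t x y t2 lx ly; rewrite /mat O // => t' x' y' t2' lx' ly' e.
by have [_ e2 _ _] := adr_inj t2 t2' lx lx' ly ly' e; rewrite e2 eqxx in ne.
Qed.

Lemma other_trans j s1 s2 s3 : other_levels_same j s1 s2 -> other_levels_same j s2 s3 ->
  other_levels_same j s1 s3.
Proof. by move=> h1 h2 q hq; rewrite h2 // h1. Qed.

(** [x] and [y] are the values of ending the pending contractions with and without the target, and
    [p] bounds the probability that a living target passes through them. *)
Definition worth (x y p : R) s j r : R :=
  if `[< vals Fnd s >] then x else
  if `[< alive s j r >] then p * x + (1 - p) * y else y.

(** The ideal factor [1 - 2 / r] is weakened to a square that leaves room for the rounding term, at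
    most [2 / r ^ 3] because [m = n ^ 4], and whose product over consecutive [r] still
    telescopes. *)
Lemma survival r : (4 <= r)%N -> (r <= n)%N ->
  ((r%:R - 2) / (r%:R - 1)) ^+ 2 <= 1 - (2 / r%:R + 2 * r%:R / m%:R) :> R.
Proof.
move=> r4 rn; rewrite mE.
have r4' : 4 <= r%:R :> R by rewrite ler_nat.
have rn' : r%:R <= n%:R :> R by rewrite ler_nat.
set z := r%:R in r4' rn' *; set N := n%:R in rn' *.
have z0 : 0 < z by lra.
have N0 : 0 < N by lra.
have h1 : 2 * z / N ^+ 4 <= 2 * z / z ^+ 4.
  rewrite ler_wpM2l //; first by lra.
  by rewrite lef_pV2 ?posrE ?exprn_gt0 // lerXn2r // nnegrE ltW.
suff h2 : ((z - 2) / (z - 1)) ^+ 2 <= 1 - (2 / z + 2 * z / z ^+ 4).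
  apply: le_trans h2 _; lra.
have -> : ((z - 2) / (z - 1)) ^+ 2 = (z - 2) ^+ 2 / (z - 1) ^+ 2.
  by rewrite expr_div_n.
have -> : 1 - (2 / z + 2 * z / z ^+ 4) = (z ^+ 3 - 2 * z ^+ 2 - 2) / z ^+ 3.
  by field; rewrite lt0r_neq0.
rewrite ler_pdivrMr ?exprn_gt0 //; last by lra.
rewrite mulrAC ler_pdivlMr ?exprn_gt0 //.
have -> : (z ^+ 3 - 2 * z ^+ 2 - 2) * (z - 1) ^+ 2 =
  (z - 2) ^+ 2 * z ^+ 3 + (z ^+ 2 * (z - 2) - 2 * (z - 1) ^+ 2) by ring.
rewrite lerDl.
have -> : z ^+ 2 * (z - 2) - 2 * (z - 1) ^+ 2 = z * (z * (z - 4) + 4) - 2 by ring.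
have : 0 <= z * (z - 4) by rewrite mulr_ge0; lra.
by move=> h; have : 4 * 4 <= z * (z * (z - 4) + 4); [rewrite ler_pM //; lra|lra].
Qed.

Lemma vals_frame Pr c s s' : frame c s s' -> 20%N \notin written_w c ->
  all (fun i => i \notin written_r c) [:: 0; 1; 2]%N -> vals Pr s' = vals Pr s.
Proof.
by move=> [fw fr _ _] h /= /and4P[h1 h2 h3 _]; rewrite /vals fw // !fr.
Qed.

Lemma step_ok (x y p : R) j r s : 0 <= y <= x -> 0 <= p <= 1 ->
  lvl j r s -> (j <= K)%N -> (2 < r)%N -> (r <= n)%N -> valid s j r -> vals Snd s ->
  hoare (r.+1 * hcost TB (chk ;; contract_edge)) (chk ;; contract_edge) s
    (worth x y (p * ((r%:R - 2) / (r%:R - 1)) ^+ 2) s j r)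
    (fun s' => if `[< [/\ lvl j r.-1 s', valid s' j r.-1, vals Snd s',
        (vals Fnd s -> vals Fnd s') & other_levels_same j s s'] >]
      then worth x y p s' j r.-1 else 0).
Proof.
move=> /andP[y0 yx] /andP[p0 p1] Ls ltj r3 rn vs snd; have r2 : (1 < r)%N by lia.
have nw i : i \notin [:: 15; 16; 20]%N -> i \notin written_w chk.
  by apply: contra; exact: chk_w.
set q := p * _.
have q0 : 0 <= q by rewrite mulr_ge0 // sqr_ge0.
have q1 : q <= 1.
  have r1 : 2 < r%:R :> R by rewrite ltr_nat.
  have h : ((r%:R - 2) / (r%:R - 1)) ^+ 2 <= 1 :> R.
    by apply: exprn_ile1; [rewrite divr_ge0; lra|rewrite ler_pdivrMr; lra].
  by rewrite -[1]mulr1 ler_pM // sqr_ge0.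
have worth_ge0 : 0 <= worth x y q s j r.
  rewrite /worth; case: ifP => _; first exact: le_trans yx.
  case: ifP => _ //; rewrite addr_ge0 // mulr_ge0 //; first exact: le_trans yx.
  by rewrite subr_ge0.
(* The labelling is chosen so that the target is sided whenever it is alive. *)
have [f [side [lf ra rb sC]]] : exists f side, [/\ labelling f r,
  represents (mat s 0 j) a f r, represents (mat s 1 j) b f r
  & alive s j r -> sided C f side].
  have [[f [side [? ? ? ?]]]|na] := pselect (alive s j r); first by exists f, side.
  by case: vs => f [? ? ?]; exists f, (fun=> true).
apply: (hoare_seqN (V1 := fun s1 => if `[< [/\ lvl j r s1, rmem s1 = rmem s, vals Snd s1,
    (vals Fnd s -> vals Fnd s1) & alive s j r -> vals Fnd s1 \/
       ready a b (mat s 0 j) (mat s 1 j) r (rreg s1 3) (rreg s1 4) (rreg s1 5) C] >]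
    then worth x y q s j r else 0)).
  apply: surely_hoare (chk_ok Ls ltj rn r2 lf ra rb snd) worth_ge0 _.
  move=> s1 F1 _ [snd1 fnd1 H1]; rewrite asboolT //; split=> //.
  - by apply: (lvl_frame F1 _ Ls); rewrite /= !nw.
  - by case: F1 => _ _ _ ->.
  - by move=> al; exact: H1 (sC al).
move=> s1 F1 _; case: asboolP => [[L1 m1 snd1 fnd1 H1] _|_]; last by rewrite ltxx.
have mm t i z z' : mat s1 t i z z' = mat s t i z z' by rewrite /mat m1.
pose z := p * x + (1 - p) * y.
have yz : y <= z.
  have : 0 <= p * (x - y) by rewrite mulr_ge0 // subr_ge0.
  by rewrite /z; lra.
have zx : z <= x.
  have : 0 <= (1 - p) * (x - y) by rewrite mulr_ge0 // subr_ge0.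
  by rewrite /z; lra.
pose val (u v : nat) : R :=
  if `[< vals Fnd s1 >] then x else
  if `[< alive s j r >] then (if side u == side v then z else y) else y.
apply: (contract_ok n_gt1 HW m_gt0 (val := val) L1) => //.
- move=> u v; rewrite /val; case: ifP => _; first exact: le_trans yx.
  by case: ifP => // _; case: ifP => // _; exact: le_trans yz.
- rewrite /val /worth.
  have const c : \sum_(0 <= U1 < m) \sum_(0 <= U2 < m) c = c * m%:R ^+ 2 :> R.
    rewrite !big_const_nat !iter_addr !addr0 !subn0.
    by rewrite -(mulr_natr (c *+ m) m) -(mulr_natr c m) expr2 mulrA.
  have [F|nF] := pselect (vals Fnd s1).
    rewrite (asboolT F) const ler_wpM2r ?exprn_ge0 //.
    case: ifP => _ //; case: ifP => _ //.
    have : 0 <= (1 - q) * (x - y) by rewrite mulr_ge0 // subr_ge0.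
    by lra.
  rewrite (asboolF nF) asboolF; last by move=> /fnd1.
  have [al|nal] := pselect (alive s j r); last by rewrite (asboolF nal) const.
  rewrite (asboolT al); have [//|rdy] := H1 al; case: rdy => r4 tot0 totE wt0 cutle.
  set X := rreg s1 3 in totE wt0 cutle *; set Y := rreg s1 4 in totE wt0 cutle *.
  set tot := rreg s1 5 in tot0 totE cutle *.
  pose wt (x y : nat) := - (X * mat s 0 j x y + Y * mat s 1 j x y).
  have [fr _] := lf.
  have rM := represents_combine X Y ra rb.
  have wd u : (u < r)%N -> wdeg r wt u = X * mat s 0 j u u + Y * mat s 1 j u u.
    exact: (rep_wdeg rM fr).
  have wT : wtot r wt = tot by rewrite (rep_wtot rM fr) totE.
  have g_sym u v : combine X Y a b u v = combine X Y a b v u.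
    by rewrite /combine a_sym b_sym.
  have cut_le : r%:R * \sum_(x <- iota 0 r) \sum_(y <- iota 0 r | side y != side x) wt x y
      <= 2 * wtot r wt.
    rewrite (rep_bad g_sym rM fr (sC al)) cutv_combine wT mulrCA ler_pM2l //.
  have tp : 0 < wtot r wt by rewrite wT.
  have := bad_pick wt0 m_gt0 tp cut_le 0 (fun u => (u == 0%N) : nat) r2.
  set bad := (X in X%:R <= _) => badle.
  (* Every pair of draws is worth [z], minus the gap [z - y] if it merges the two sides of the
     target. *)
  rewrite (_ : \sum_(0 <= U1 < m) _ = z * m%:R ^+ 2 - (z - y) * bad%:R); last first.
    rewrite -const /bad natr_sum mulr_sumr -sumrB; apply: eq_bigr => U1 _.
    rewrite natr_sum mulr_sumr -sumrB; apply: eq_bigr => U2 _.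
    have e1 : scan (fun x => X * mat s1 0 j x x + Y * mat s1 1 j x x)
       (tot * U1%:R / m%:R) 0 0 (iota 0 r) = pick1 r m wt 0 U1.
      rewrite /pick1 wT; apply: eq_scan => u; rewrite mem_iota => lu.
      by rewrite !mm wd.
    rewrite e1; set u := pick1 _ _ _ _ _.
    have lu : (u < r)%N by apply: pick1_lt; [exact: ltnW|rewrite wT ltW].
    have e2 : scan (fun y => - (X * mat s1 0 j u y + Y * mat s1 1 j u y))
      ((X * mat s1 0 j u u + Y * mat s1 1 j u u) * U2%:R / m%:R) 0
      (u == 0%N) [seq y <- iota 0 r | y != u] = pick2 r m wt (u == 0%N) u U2.
      by rewrite /pick2 wd // !mm; apply: eq_scan => y' _; rewrite !mm.
    by rewrite e2 eq_sym; case: eqP => _ /=; ring.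
  have sv := survival r4 rn.
  have m0 : 0 < (m%:R : R) ^+ 2 by rewrite exprn_gt0 // ltr0n.
  have h1 : (z - y) * bad%:R <=
     (z - y) * (m%:R ^+ 2 * (2 / r%:R + 2 * r%:R / m%:R)).
    by rewrite ler_wpM2l // subr_ge0.
  apply: le_trans (_ : z * m%:R ^+ 2 - (z - y) * (m%:R ^+ 2 * (2 / r%:R + 2 * r%:R / m%:R)) <= _); last by lra.
  have h2 : p * (x - y) * ((r%:R - 2) / (r%:R - 1)) ^+ 2 <=
     p * (x - y) * (1 - (2 / r%:R + 2 * r%:R / m%:R)).
    by rewrite ler_wpM2l // mulr_ge0 // subr_ge0.
  have -> : z * m%:R ^+ 2 - (z - y) * (m%:R ^+ 2 * (2 / r%:R + 2 * r%:R / m%:R)) =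
     (y + p * (x - y) * (1 - (2 / r%:R + 2 * r%:R / m%:R))) * m%:R ^+ 2.
    by rewrite /z; ring.
  apply: ler_wpM2r; first exact: ltW.
  have -> : q * x + (1 - q) * y = y + p * (x - y) * ((r%:R - 2) / (r%:R - 1)) ^+ 2.
    by rewrite /q; ring.
  by apply: lerD.
- move=> u v s' ur vr uv L' F' Hm O.
  have vE Pr : vals Pr s' = vals Pr s1 by exact: vals_frame F' _ _.
  have lf' := merge_labelling lf ur vr uv.
  have lt1 z1 : (z1 < r.-1)%N -> (z1 < r)%N by move=> h; exact: leq_trans h (leq_pred r).
  have ra' : represents (mat s' 0 j) a (merge_label r u v \o f) r.-1.
    apply: represents_same (merge_represents lf ur vr uv ra) => z1 z2 l1 l2.
    by rewrite Hm ?lt1 // /merge_matrix !mm.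
  have rb' : represents (mat s' 1 j) b (merge_label r u v \o f) r.-1.
    apply: represents_same (merge_represents lf ur vr uv rb) => z1 z2 l1 l2.
    by rewrite Hm ?lt1 // /merge_matrix !mm.
  rewrite asboolT; last first.
    split=> //; rewrite ?vE //; first by exists (merge_label r u v \o f).
    by move=> q' hq; rewrite O // m1.
  rewrite /val /worth vE -/z; case: ifP => // _.
  case: (asboolP (alive s j r)) => [al|_]; last by case: ifP.
  case: eqP => [e|_]; last by case: ifP.
  rewrite asboolT //; exists (merge_label r u v \o f), (fun x => if x == v then side r.-1 else side x).
  by split=> //; exact: (merge_sided lf ur vr uv (sC al) e).
Qed.

(** With the successor, [lev j - 1] is at least half of [lev j.+1 - 1], so the telescoped survival
    bound is at least [1 / 4]. Level [0] has two vertices. *)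
Definition lev j : nat := minn n (2 ^ j).+1.

Lemma lev_ge2 j : (1 < lev j)%N.
Proof. by rewrite /lev leq_min n_gt1 ltnS expn_gt0. Qed.

Lemma lev_le j : (lev j <= lev j.+1)%N /\ (lev j.+1 <= n)%N.
Proof.
have := expn_gt0 2 j; rewrite /lev expnS; lia.
Qed.

Lemma lev_half j : (lev j.+1).-1%:R <= 2 * (lev j).-1%:R :> R.
Proof. by rewrite -natrM ler_nat /lev expnS; have := expn_gt0 2 j; lia. Qed.

(** The survival factors telescope to [((lev j - 1) / (lev j.+1 - 1)) ^+ 2]. The test [0 < j] is
    there because on level [0] the closing check has already found a living target. *)
Lemma action_ok (x y : R) j s : 0 <= y <= x ->
  env s -> wreg s 11 = j -> wreg s 10 = (2 ^ j)%N -> (j < K)%N ->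
  valid s j.+1 (lev j.+1) -> vals Snd s ->
  hoare ((lev j.+1).+2 * (lev j.+1).+2 * hcost TB (action chk)) (action chk) s
    (worth x y (1 / 4) s j.+1 (lev j.+1))
    (fun s' => if `[< [/\ env s', valid s' j (lev j), vals Snd s',
        (vals Fnd s -> vals Fnd s') & other_levels_same j s s'] >]
      then (if `[< vals Fnd s' >] then x else
            if (0 < j)%N && `[< alive s' j (lev j) >] then x else y) else 0).
Proof.
move=> /andP[y0 yx] Es e11 e10 ltj vs snd.
have x0 := le_trans y0 yx.
have [lejS leSn] := lev_le j; have sj2 := lev_ge2 j.
have w2 := W_gt2 n_gt1 HW.
have nw i : i \notin [:: 15; 16; 20]%N -> i \notin written_w chk.
  by apply: contra; exact: chk_w.
have nW : (n < W)%N.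
  apply: leq_ltn_trans HW; have : (n <= K.+1 * (n * n))%N by nia.
  lia.
have hK : (2 ^ j + 2 ^ j <= 2 ^ K)%N.
  by rewrite addnn -mul2n -expnS leq_exp2l.
set S := lev j.+1 in lejS leSn *; set sj := lev j in lejS sj2 *.
set N2 := (S.+2 * S.+2)%N.
have worth0 p' s' i r : 0 <= p' <= 1 -> 0 <= worth x y p' s' i r.
  move=> /andP[h0 h1]; rewrite /worth; case: ifP => // _; case: ifP => // _.
  by rewrite addr_ge0 // mulr_ge0 // subr_ge0.
have p14 : 0 <= (1 / 4 : R) <= 1 by apply/andP; split; lra.
have size_ok i e s' h : (i < TB)%N -> wreg s' 1 = n -> wsafe W TB s' e -> weval s' e = h ->
   (h < W.-1)%N ->
   surely (hcost TB (set_size i e)) (set_size i e) s' (fun s1 => s1 = setw s' i (minn n h.+1)).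
  move=> li e1 se ee hw.
  have se1 : wsafe W TB s' (e [+] WNum 1) by rewrite /= se ee addn1 (ltnW w2) /=; lia.
  apply: surely_if; first by rewrite -[tsafe _ _ _ _]/(wsafe W TB s' (e [+] WNum 1) && true) se1.
    rewrite /= ee e1 addn1 => h1; apply: surely_setw => //=; rewrite ee addn1.
    by rewrite (minn_idPr _) // ltnW.
  rewrite /= ee e1 addn1 -leqNgt => h1; apply: surely_setw => //=.
  by rewrite e1 (minn_idPl h1).
have [E1 _ _ E4] := Es.
pose st1 := setw (setw (setw s 22 S) 23 sj) 12 S.
apply: (hoare_seqN (V1 := fun s1 => if `[< s1 = st1 >] then worth x y (1/4) s j.+1 S else 0)).
  have H : surely (hcost TB (set_size 22 (WVar 10 [+] WVar 10) ;; set_size 23 (WVar 10) ;; HSetW 12 (WVar 22)))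
     (set_size 22 (WVar 10 [+] WVar 10) ;; set_size 23 (WVar 10) ;; HSetW 12 (WVar 22)) s (fun s1 => s1 = st1).
    apply: (surely_seq (P1 := fun s1 => s1 = setw s 22 S)).
      apply: surely_le (size_ok 22%N (WVar 10 [+] WVar 10) s (2 ^ j + 2 ^ j)%N isT E1 _ _ _) _ _ => //.
      - by rewrite /= e10; lia.
      - by rewrite /= e10.
      - lia.
      - by move=> s1 _ _ ->; rewrite /S /lev expnS mul2n addnn.
    move=> s1 _ _ ->; apply: (surely_seq (P1 := fun s1 => s1 = setw (setw s 22 S) 23 sj)).
      by apply: surely_le (size_ok 23%N (WVar 10) (setw s 22 S) (2 ^ j)%N isT E1 isT _ _) _ _ => //; lia.
    by move=> s2 _ _ ->; apply: surely_setw.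
  apply: surely_hoare (surely_time H _) (worth0 _ _ _ _ p14) _.
    by rewrite leq_pmull // /N2.
  by move=> s1 _ _ ->; rewrite asboolT.
move=> s1 F1 _; case: asboolP => [E _|_]; last by rewrite ltxx.
subst s1.
have L1 : lvl j S st1 by split.
apply: (hoare_seqN (V1 := fun s2 => if `[< [/\ lvl j S s2, wreg s2 22 = S /\ wreg s2 23 = sj,
    (forall t x y, (t < 2)%N -> (x < S)%N -> (y < S)%N -> mat s2 t j x y = mat s t j.+1 x y),
    other_levels_same j s s2 & forall Pr, vals Pr s2 = vals Pr s] >]
    then worth x y (1/4) s j.+1 S else 0)).
  have H := @copy_ok R W d n B0 K m n_gt1 HW st1 j S Es e11 erefl ltj (ltnW (lev_ge2 _)) leSn.
  apply: surely_hoare (surely_time H _) (worth0 _ _ _ _ p14) _.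
    by rewrite leq_mul2r /N2; apply/orP; right; nia.
  move=> s2 F2 _ [m2 O2]; rewrite asboolT //.
  have [fw _ _ _] := F2; split=> //.
  - exact: lvl_frame F2 _ L1.
  - by rewrite !fw.
  - by move=> Pr; rewrite (vals_frame Pr F2).
move=> s2 F2 _; case: asboolP => [[L2 [r22 r23] m2 O2 v2] _|_]; last by rewrite ltxx.
(* A lower bound for surviving the contractions that remain after [i] of them. *)
pose q i : R := ((sj.-1)%:R / (S - i).-1%:R) ^+ 2.
have q01 i : (i <= S - sj)%N -> 0 <= q i <= 1.
  move=> li; rewrite sqr_ge0 /=; apply: exprn_ile1; first by rewrite divr_ge0 ?ler0n.
  rewrite ler_pdivrMr ?mul1r ?ler_nat ?ltr0n; lia.
pose V i s' := if `[< [/\ lvl j (S - i) s', valid s' j (S - i), vals Snd s',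
     (vals Fnd s -> vals Fnd s') & other_levels_same j s s'] >] then worth x y (q i) s' j (S - i) else 0.
apply: (hoare_seqN (V1 := V (S - sj)%N)).
  have sE : wsafe W TB s2 (WVar 22 [-] WVar 23) by rewrite /= r22 r23; lia.
  have eE : weval s2 (WVar 22 [-] WVar 23) = (S - sj)%N by rewrite /= r22 r23.
  have nw13 : 13%N \notin written_w (chk ;; contract_edge).
    by rewrite /= mem_cat negb_or nw.
  have nw14 : 14%N \notin written_w (chk ;; contract_edge).
    by rewrite /= mem_cat negb_or nw.
  apply: hoare_le (@hoare_for R W TB 13 14 (WVar 22 [-] WVar 23) (chk ;; contract_edge) s2
     (S - sj) (fun i => (S - i).+1 * hcost TB (chk ;; contract_edge))%N V isT isT isT nw13 nw14 sE eE _) _ _ _.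
  - move=> i s3 li F3 _ e13 _; rewrite {1}/V; case: asboolP => [[L3 v3 snd3 f3 O3] _|_]; last by rewrite ltxx.
    rewrite {1}/V asboolT //.
    have r3 : (2 < S - i)%N by lia.
    have qq : q i = q i.+1 * (((S - i)%:R - 2) / ((S - i)%:R - 1)) ^+ 2.
      rewrite /q -exprMn; congr (_ ^+ 2).
      have S1 : (1 <= S - i)%N by apply: leq_trans r3.
      have -> : (S - i)%:R - 1 = (S - i).-1%:R :> R by rewrite -subn1 (natrB _ S1).
      have -> : (S - i)%:R - 2 = (S - i.+1).-1%:R :> R by rewrite -natrB; [congr (_%:R); lia|lia].
      field; apply/andP; split; rewrite pnatr_eq0; lia.
    rewrite qq.
    have le2 : (S - i <= n)%N by lia.
    apply: hoare_le (step_ok (p := q i.+1) _ _ L3 (ltnW ltj) r3 le2 v3 snd3) (leqnn _) (lexx _) _.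
    + by rewrite y0.
    + by apply: q01; lia.
    + move=> s4 F4 _; case: asboolP => [[L4 v4 snd4 f4 O4] _|_]; last by rewrite ltxx.
      have eS : (S - i).-1 = (S - i.+1)%N by lia.
      rewrite eS in L4 v4 *; rewrite /V asboolT //; split=> //.
      * by move=> /f3 /f4.
      * exact: other_trans O3 O4.
  - rewrite (_ : hcost TB (HFor _ _ _ _) = hcost TB (chk ;; contract_edge) +
       (size (compile_w (WVar 22 [-] WVar 23) TB) + 6))%N //.
    set hb := hcost TB (chk ;; contract_edge).
    apply: (@leq_trans ((S - sj) * (S.+1 * hb + 3) + (size (compile_w (WVar 22 [-] WVar 23) TB) + 3))).
      rewrite leq_add2r -[X in (_ <= X * _)%N]card_ord -sum_nat_const leq_sum // => i _.
      by rewrite leq_add2r leq_mul2r; apply/orP; right; lia.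
    rewrite (mulnDr N2) /N2; set sz := size _.
    have -> : (S.+2 * S.+2 * hb + S.+2 * S.+2 * (sz + 6) =
       S * S.+1 * hb + (3 * S + 4) * hb + (S.+2 * S.+2 * sz + 6 * (S.+2 * S.+2)))%N by lia.
    have h1 : ((S - sj) * (S.+1 * hb + 3) <= S * S.+1 * hb + 3 * S)%N.
      apply: (@leq_trans (S * (S.+1 * hb + 3))); last by rewrite mulnDr mulnA; lia.
      by rewrite leq_mul2r; lia.
    have h2 : (sz <= S.+2 * S.+2 * sz)%N by rewrite leq_pmull.
    lia.
  - rewrite {1}/V asboolT; last first.
      rewrite subn0; split=> //.
      + by apply: (valid_same (s := s)) vs; exact: m2.
      + by rewrite -[vals Snd _]/(vals Snd s2) v2.
      + by move=> F; rewrite -[vals Fnd (setw _ _ _)]/(vals Fnd s2) v2.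
    rewrite subn0 /worth -[vals Fnd (setw _ _ _)]/(vals Fnd s2) v2; case: ifP => // _.
    have hq : 1 / 4 <= q 0%N.
      have := lev_half j; rewrite -/S -/sj => h.
      rewrite /q subn0; have -> : 1 / 4 = (1 / 2) ^+ 2 :> R by field.
      rewrite lerXn2r ?nnegrE ?divr_ge0 ?ler0n //.
      by rewrite ler_pdivlMr ?ltr0n; [lra|lia].
    have zle : 1 / 4 * x + (1 - 1 / 4) * y <= q 0%N * x + (1 - q 0%N) * y.
      have : 0 <= (q 0%N - 1 / 4) * (x - y) by rewrite mulr_ge0 // subr_ge0.
      lra.
    have yle : y <= q 0%N * x + (1 - q 0%N) * y.
      have /andP[h _] := q01 0%N isT.
      have : 0 <= q 0%N * (x - y) by rewrite mulr_ge0 // subr_ge0.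
      lra.
    case: (asboolP (alive s j.+1 S)) => [al|_]; last by case: ifP.
    by rewrite asboolT //; apply: (alive_same (s := s)) al; exact: m2.
  - by move=> s' _ _ _; exact: lexx.
move=> s3 F3 _; rewrite /V; case: asboolP => [[L3 v3 snd3 f3 O3] _|_]; last by rewrite ltxx.
have eS : (S - (S - sj) = sj)%N by lia.
rewrite eS in L3 v3 *.
have q1 : q (S - sj)%N = 1.
  by rewrite /q eS divff ?expr1n // pnatr_eq0; lia.
have [f [side [lf ra rb sC]]] : exists f side, [/\ labelling f sj,
  represents (mat s3 0 j) a f sj, represents (mat s3 1 j) b f sj
  & alive s3 j sj -> sided C f side].
  have [[f [side [? ? ? ?]]]|na] := pselect (alive s3 j sj); first by exists f, side.
  by case: v3 => f [? ? ?]; exists f, (fun=> true).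
have sjn : (sj <= n)%N by lia.
have H := chk_ok L3 (ltnW ltj) sjn sj2 lf ra rb snd3.
apply: surely_hoare (surely_time H _) (worth0 _ _ _ _ _) _.
- by rewrite leq_mul2r /N2; apply/orP; right; nia.
- by rewrite q1 ler01 lexx.
move=> s4 F4 _ [snd4 f4 H4].
have m4 : rmem s4 = rmem s3 by case: F4 => _ _ _ ->.
have al4 : alive s3 j sj -> alive s4 j sj.
  by apply: alive_same => t z z' _ _ _; rewrite /mat m4.
rewrite asboolT; last first.
  split=> //.
  - by case: (L3) => E3 _ _; apply: (env_frame F4 _ E3); rewrite /= !nw.
  - by apply: valid_same v3 => t z z' _ _ _; rewrite /mat m4.
  - by move=> /f3 /f4.
  - by apply: (other_trans O3) => h _; rewrite m4.
rewrite /worth q1; have [F|nF] := pselect (vals Fnd s4).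
  rewrite (asboolT F); case: ifP => // _; case: ifP => // _; lra.
rewrite (asboolF nF) asboolF; last by move=> /f4.
case: (asboolP (alive s3 j sj)) => [al|_]; last by case: ifP.
have [//|[r4 _ _ _ _]] := H4 side (sC al).
rewrite asboolT ?andbT; last exact: al4.
(* [ready] requires four vertices and level [0] has two, so [j] is positive here. *)
rewrite ifT; first by lra.
rewrite lt0n; apply/eqP => j0; move: r4.
by rewrite /sj j0 /lev expn0 leq_min andbF.
Qed.

Hypothesis KW2 : (4 ^ K < W)%N.

Definition alive_levels s (i : nat) : bool := (i <= K)%N && `[< alive s i (lev i) >].

Lemma action_nw i : i \notin [:: 12; 13; 14; 15; 16; 17; 18; 19; 20; 22; 23]%N ->
  i \notin written_w (action chk).
Proof.
move=> h; have hc : i \notin written_w chk.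
  by apply: contra h => /chk_w; rewrite !inE; lia.
apply: contra h => /=; rewrite !(mem_cat, inE) (negbTE hc) /=; lia.
Qed.

Definition act_time j : nat := (lev j.+1).+2 * (lev j.+1).+2 * hcost TB (action chk).

(** In step [l = 0] the levels are filled from the top, so only those above the current one are
    known to be valid; later all are. Unless the target was found before, the values handed to
    [action_ok] are the two continuations in the definition of [reveal]. *)
Lemma level_step_ok l j rest s : (l < W)%N -> env s -> wreg s 5 = (2 ^ K)%N -> wreg s 6 = l ->
  (j < K)%N -> wreg s 10 = (2 ^ j.+1)%N -> wreg s 8 = (K - j.+1)%N -> vals Snd s ->
  (forall i, (i <= K)%N -> (0 < l)%N || (j < i)%N -> valid s i (lev i)) ->
  hoare (hcost TB (level_step chk) + (if 4 ^ j %| l then act_time j else 0))%N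
   (level_step chk) s
   (if `[< vals Fnd s >] then 1 else reveal R (level_actions j.+1 l ++ rest) (alive_levels s))
   (fun s' => if `[< [/\ env s', wreg s' 10 = (2 ^ j)%N, vals Snd s' /\ other_levels_same j s s' &
      forall i, (i <= K)%N -> (0 < l)%N || (j <= i)%N -> valid s' i (lev i)] >] then
      (if `[< vals Fnd s' >] then 1 else reveal R (level_actions j l ++ rest) (alive_levels s'))
      else 0).
Proof.
move=> lW Es e5 e6 ltj e10 e8 snd vs; have [_ _ _ e4] := Es.
have w2 := W_gt2 n_gt1 HW.
have jW : (2 ^ j < W)%N by apply: leq_ltn_trans (_ : 2 ^ K < W)%N; [rewrite leq_exp2l|]; lia.
have jjW : (2 ^ j * 2 ^ j < W)%N.
  apply: leq_ltn_trans KW2; rewrite -expnMn leq_exp2l //; lia.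
have KltW : (K < W)%N by apply: leq_ltn_trans HW; nia.
pose s2 := setw (setw s 10 (2 ^ j)%N) 11 j.
set v := (if _ then 1 else _).
have v0 : 0 <= v.
  by rewrite /v; case: ifP => // _; have /andP[] := @reveal_bounds R (level_actions j.+1 l ++ rest) (alive_levels s).
have H1 : surely (hcost TB (HSetW 10 (WVar 10 [/] WNum 2))) (HSetW 10 (WVar 10 [/] WNum 2)) s
    (fun s1 => s1 = setw s 10 (2 ^ j)%N).
  have e : (wreg s 10 %/ 2 = 2 ^ j)%N by rewrite e10 expnS mulKn.
  by apply: surely_setw => //=; rewrite e // w2.
have H2 : surely (hcost TB (HSetW 11 (WVar 4 [-] WVar 8 [-] WNum 1)))
    (HSetW 11 (WVar 4 [-] WVar 8 [-] WNum 1)) (setw s 10 (2 ^ j)%N) (fun s1 => s1 = s2).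
  have e : (wreg s 4 - wreg s 8 - 1 = j)%N by rewrite e4 e8; lia.
  apply: surely_setw => //=; rewrite e // (ltnW w2) e4 e8 /=; lia.
have al2 : alive_levels s2 = alive_levels s by [].
rewrite [hcost _ _]/= -!addnA.
apply: (hoare_seq (V1 := fun s1 => if `[< s1 = setw s 10 (2 ^ j)%N >] then v else 0)).
  by apply: surely_hoare H1 v0 _ => s1 _ _ ->; rewrite asboolT.
move=> s1 F1 _; case: asboolP => [-> _|_]; last by rewrite ltxx.
apply: (hoare_seq (V1 := fun s1 => if `[< s1 = s2 >] then v else 0)).
  by apply: surely_hoare H2 v0 _ => s3 _ _ ->; rewrite asboolT.
move=> s3 F3 _; case: asboolP => [-> _|_]; last by rewrite ltxx.
have te : teval s2 (EqW (WVar 6 [%] (WVar 10 [*] WVar 10)) (WNum 0)) = (4 ^ j %| l)%N.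
  by rewrite /= e6 -expnMn.
set V' := fun s' => _.
have Hif := @hoare_if R W TB (EqW (WVar 6 [%] (WVar 10 [*] WVar 10)) (WNum 0)) (action chk) HSkip s2 v V'
  (if 4 ^ j %| l then act_time j else 0)%N 0.
apply: hoare_le (Hif _ _ _) _ (lexx _) _ => {Hif}.
- by rewrite /= jjW (ltnW (ltnW w2)) /= andbT; apply: leq_ltn_trans (leq_mod _ _) _; rewrite e6.
- rewrite te => dv; rewrite dv.
  rewrite /v level_actionsS dv /=; set l' := level_actions j l ++ rest.
  set al := alive_levels s.
  have /andP[y0 y1] := @reveal_bounds R l' (upd al j false).
  have yx : reveal R l' (upd al j false) <= reveal R l' (upd al j true).
    by apply: reveal_mono => i; rewrite /upd; case: eqP => // _; exact: implybb.
  have /andP[x0 x1] := @reveal_bounds R l' (upd al j true).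
  pose y := if `[< vals Fnd s >] then 0 else reveal R l' (upd al j false).
  pose x := if `[< vals Fnd s >] then 1 else if j == 0%N then 1 else reveal R l' (upd al j true).
  have vs2 : valid s2 j.+1 (lev j.+1) by apply: vs; rewrite // ltnSn orbT.
  have yx' : 0 <= y <= x.
    by rewrite /x /y; case: ifP => _; [rewrite lexx ler01|case: ifP => _; rewrite y0].
  apply: hoare_le (@action_ok x y j s2 yx' Es erefl erefl ltj vs2 snd) (leqnn _) _ _.
    rewrite /worth -[vals Fnd s2]/(vals Fnd s) /x /y; case: ifP => // _.
    have -> : al j.+1 = `[< alive s2 j.+1 (lev j.+1) >] by rewrite /al /alive_levels ltj.
    by case: ifP => // _; case: ifP => _; lra.
  move=> s4 F4 _; case: asboolP => [[E4 v4 snd4 f4 O4] _|_]; last by rewrite ltxx.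
  have [fw _ _ _] := F4.
  have vi i : i != j -> (i <= K)%N -> valid s i (lev i) -> valid s4 i (lev i).
    move=> ne li; apply: valid_same => t z z' t2 lz lz'.
    by rewrite -[mat s t i z z']/(mat s2 t i z z') (mat_other O4 ne) //;
      [apply: leq_trans lz _|apply: leq_trans lz' _]; exact: geq_minl.
  have ali i : i != j -> al i -> alive_levels s4 i.
    move=> ne /andP[li /asboolP h]; rewrite /alive_levels li asboolT //.
    apply: alive_same h => t z z' t2 lz lz'.
    by rewrite -[mat s t i z z']/(mat s2 t i z z') (mat_other O4 ne) //;
      [apply: leq_trans lz _|apply: leq_trans lz' _]; exact: geq_minl.
  have g4 : [/\ env s4, wreg s4 10 = (2 ^ j)%N, vals Snd s4 /\ other_levels_same j s s4 &
      forall i, (i <= K)%N -> (0 < l)%N || (j <= i)%N -> valid s4 i (lev i)].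
    split; [by []|by rewrite fw // action_nw|by split; [exact: snd4|exact: O4]|].
    move=> i li hi; have [->//|ne] := eqVneq i j; apply: vi => //.
    by apply: vs => //; case/orP: hi => [->//|h]; rewrite (ltn_neqAle j i) h andbT (eq_sym j i) ne orbT.
  rewrite /V' (asboolT g4).
  have [F|nF] := pselect (vals Fnd s4).
    by rewrite (asboolT F) /x; case: ifP => // _; case: ifP.
  rewrite (asboolF nF) /x /y (asboolF (_ : ~ vals Fnd s)); last by move=> /f4.
  have yle : reveal R l' (upd al j false) <= reveal R l' (alive_levels s4).
    by apply: reveal_mono => i; rewrite /upd; case: eqP => // /eqP ne; apply/implyP; exact: ali.
  case: ifP => // /andP[j0 /asboolP h]; rewrite ifF; last by case: (j) j0.
  apply: reveal_mono => i; rewrite /upd; case: eqP => [->|/eqP ne].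
    by rewrite /alive_levels (ltnW ltj) asboolT.
  by apply/implyP; exact: ali.
- rewrite te => ndv; apply: hoare_le (@hoare_skip R W TB s2 v) _ _ _ => // s4 _ _.
  case: asboolP => [-> _|_]; last by rewrite ltxx.
  have l0 : (0 < l)%N by case: (l) ndv => //; rewrite dvdn0.
  have g4 : [/\ env s2, wreg s2 10 = (2 ^ j)%N, vals Snd s2 /\ other_levels_same j s s2 &
      forall i, (i <= K)%N -> (0 < l)%N || (j <= i)%N -> valid s2 i (lev i)].
    have O2 : other_levels_same j s s2 by [].
    by split=> // i li _; apply: vs; rewrite ?l0.
  rewrite /V' (asboolT g4).
  by rewrite /v level_actionsS (negbTE ndv).
- by rewrite /=; lia.
- by [].
Qed.

Lemma level_step_nw i : i \notin [:: 10; 11; 12; 13; 14; 15; 16; 17; 18; 19; 20; 22; 23]%N ->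
  i \notin written_w (level_step chk).
Proof.
move=> h.
have -> : written_w (level_step chk) = [:: 10; 11]%N ++ (written_w (action chk) ++ [::]) by [].
rewrite cats0 mem_cat negb_or; apply/andP; split.
  by apply: contra h; rewrite !inE => /orP[] /eqP->.
apply: action_nw; apply: contra h.
rewrite -[[:: 10, 11, _ & _]]/([:: 10; 11]%N ++ _) mem_cat => ->; exact: orbT.
Qed.

Definition row_time l : nat :=
  hcost TB (HSetW 10 (WVar 5)) +
  (\sum_(jj < K) (hcost TB (level_step chk) +
     (if 4 ^ (K - jj.+1) %| l then act_time (K - jj.+1) else 0) + 3) +
   (size (compile_w (WVar 4) TB) + 3)).

(** Level [K] keeps the uncontracted graph, so that all runs of both searches can start from it. *)
Definition low_levels_only s s' : Prop :=
  forall q, (forall t j x y, (j < K)%N -> (t < 2)%N -> (x < n)%N -> (y < n)%N ->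
    q <> adr n B0 t j x y) -> rmem s' q = rmem s q.

(** The loop invariant is the value of [reveal] on the actions still to come. At the end this list
    is empty and [reveal] is [0], so only outcomes that found the target retain a positive value. *)
Lemma phase_ok NE N s : (0 < K)%N -> (n <= (2 ^ K).+1)%N ->
  env s -> wreg s 5 = (2 ^ K)%N -> wsafe W TB s NE -> weval s NE = (N * 4 ^ K)%N ->
  (N * 4 ^ K < W)%N -> vals Snd s -> valid s K n -> vals Fnd s \/ alive s K n ->
  hoare (\sum_(l < N * 4 ^ K) (row_time l + 3) + (size (compile_w NE TB) + 3))
   (phase chk NE) s (1 - (1 - tree_prob R K) ^+ N)
   (fun s' => if `[< [/\ env s', wreg s' 5 = (2 ^ K)%N, vals Snd s' /\ low_levels_only s s'
     & vals Fnd s'] >] then 1 else 0).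
Proof.
move=> K0 nK Es e5 sN eN LW snd vK fa; have w2 := W_gt2 n_gt1 HW.
set L := (N * 4 ^ K)%N in eN LW *.
have levK : lev K = n by rewrite /lev; apply/minn_idPl.
pose rest l := flatten [seq level_actions K z | z <- iota l (L - l)].
pose Gt l jj s' := [/\ env s', wreg s' 5 = (2 ^ K)%N, vals Snd s' /\ low_levels_only s s' &
   forall i, (i <= K)%N -> (0 < l)%N || (K - jj <= i)%N -> valid s' i (lev i)].
pose val l' s' : R := if `[< vals Fnd s' >] then 1 else reveal R l' (alive_levels s').
have val0 l' s' : 0 <= val l' s'.
  by rewrite /val; case: ifP => // _; have /andP[] := @reveal_bounds R l' (alive_levels s').
pose V l s' : R := if `[< Gt l 0%N s' >] then val (rest l) s' else 0.
have nw6 : 6%N \notin written_w (HSetW 10 (WVar 5) ;; HFor 8 9 (WVar 4) (level_step chk)).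
  rewrite (_ : written_w _ = [:: 10; 8; 9]%N ++ written_w (level_step chk)) //.
  by rewrite mem_cat negb_or level_step_nw.
have nw7 : 7%N \notin written_w (HSetW 10 (WVar 5) ;; HFor 8 9 (WVar 4) (level_step chk)).
  rewrite (_ : written_w _ = [:: 10; 8; 9]%N ++ written_w (level_step chk)) //.
  by rewrite mem_cat negb_or level_step_nw.
apply: hoare_le (@hoare_for R W TB 6 7 NE (HSetW 10 (WVar 5) ;; HFor 8 9 (WVar 4) (level_step chk)) s
   L row_time V isT isT isT nw6 nw7 sN eN _) (leqnn _) _ _.
- move=> l s1 ll F1 _ e6 _; rewrite {1}/V; case: asboolP => [[E1 f5 [snd1 k1] v1] _|_]; last by rewrite ltxx.
  rewrite {1}/V asboolT //.
  have KW' : (2 ^ K < W)%N by lia.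
  pose s2 := setw s1 10 (2 ^ K)%N.
  have H1 : surely (hcost TB (HSetW 10 (WVar 5))) (HSetW 10 (WVar 5)) s1 (fun s' => s' = s2).
    by apply: surely_setw => //=; rewrite f5.
  apply: (hoare_seq (V1 := fun s' => if `[< s' = s2 >] then val (rest l) s1 else 0)).
    by apply: surely_hoare H1 (val0 _ _) _ => s' _ _ ->; rewrite asboolT.
  move=> s2' F2 _; case: asboolP => [-> _|_]; last by rewrite ltxx.
  have restE : rest l = level_actions K l ++ rest l.+1.
    by rewrite /rest -(subnSK ll).
  pose V2 jj s' : R := if `[< Gt l jj s' /\ (wreg s' 6 = l /\ wreg s' 10 = (2 ^ (K - jj))%N) >] then
     val (level_actions (K - jj) l ++ rest l.+1) s' else 0.
  have [_ _ _ e4] := E1.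
  have nw8 : 8%N \notin written_w (level_step chk) by exact: level_step_nw.
  have nw9 : 9%N \notin written_w (level_step chk) by exact: level_step_nw.
  apply: hoare_le (@hoare_for R W TB 8 9 (WVar 4) (level_step chk) s2 K
     (fun jj => hcost TB (level_step chk) + (if 4 ^ (K - jj.+1) %| l then act_time (K - jj.+1) else 0))%N
     V2 isT isT isT nw8 nw9 isT e4 _) (leqnn _) _ _.
  + move=> jj s3 ljj F3 _ e8 _; rewrite {1}/V2.
    case: asboolP => [[[E3 g5 [snd3 k3] v3] [g6 g10]] _|_]; last by rewrite ltxx.
    rewrite {1}/V2 asboolT //.
    have ej : (K - jj = (K - jj.+1).+1)%N by lia.
    have ltj : (K - jj.+1 < K)%N by lia.
    have e8' : wreg s3 8 = (K - (K - jj.+1).+1)%N by rewrite e8; lia.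
    rewrite ej in g10 v3 *.
    have lW : (l < W)%N by lia.
    apply: hoare_le (@level_step_ok l (K - jj.+1) (rest l.+1) s3 lW E3 g5 g6 ltj g10 e8' snd3 v3) (leqnn _) (lexx _) _.
    move=> s4 F4 _; case: asboolP => [[E4 h10 [snd4 O4] v4] _|_]; last by rewrite ltxx.
    have [fw _ _ _] := F4.
    have g : Gt l jj.+1 (setw s4 8 jj.+1) /\
       (wreg (setw s4 8 jj.+1) 6 = l /\ wreg (setw s4 8 jj.+1) 10 = (2 ^ (K - jj.+1))%N).
      split; last by split; rewrite // [LHS]/= fw // level_step_nw.
      split; [by []|by rewrite [LHS]/= fw // level_step_nw| |by []].
      split=> // q hq; rewrite -[LHS]/(rmem s4 q) (O4 q); first exact: k3.
      by move=> t x y t2 lx ly; apply: hq.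
    by rewrite /V2 (asboolT g).
  + rewrite {1}/V2 asboolT; last by rewrite subn0.
    by rewrite subn0 -restE.
  + move=> s3 _ _ _; rewrite /V2 /V; case: asboolP => [[[E3 g5 snd3 v3] _]|_]; last first.
      by case: ifP.
    rewrite asboolT; last by split=> // i li _; apply: v3; rewrite // subnn leq0n orbT.
    by rewrite subnn.
- rewrite {1}/V asboolT; last first.
    have k0 : low_levels_only s (setw (setw s 7 L) 6 0) by [].
    split=> // i li; rewrite subn0 /= => leK; have -> : i = K by lia.
    by rewrite levK.
  rewrite /val -[vals Fnd (setw _ _ _)]/(vals Fnd s).
  have /andP[t0 t1] := tree_prob_bounds R K.
  have p1 : 1 - (1 - tree_prob R K) ^+ N <= 1.
    by rewrite lerBlDr lerDl exprn_ge0 // subr_ge0.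
  case: asboolP => [//|nF]; case: fa => [//|al].
  rewrite /rest subn0 all_actions.
  have := @reveal_runs R K.-1 N (alive_levels (setw (setw s 7 L) 6 0)).
  rewrite prednK //; apply.
  by rewrite /alive_levels leqnn levK asboolT.
- move=> s' _ _; rewrite /V; case: asboolP => [[E' g5 snd' _]|_] //; last by rewrite ltxx.
  rewrite /val /rest subnn /=; case: asboolP => [F _|_]; last by rewrite ltxx.
  by rewrite asboolT.
Qed.

Lemma count_multiples N q : (0 < q)%N -> (\sum_(l < N * q) (q %| l) = N)%N.
Proof.
move=> q0; elim: N => [|N IH]; first by rewrite mul0n big_ord0.
rewrite -(big_mkord xpredT (fun l => nat_of_bool (q %| l)%N)) mulSn addnC.
rewrite (@big_cat_nat _ _ _ (N * q)) //=; last by rewrite leq_addr.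
rewrite big_mkord IH.
rewrite big_ltn; last by lia.
rewrite dvdn_mull // big_nat big1 ?addn0 ?addn1 // => l /andP[h1 h2].
case: (boolP (q %| l)%N) => // /dvdnP[p e]; rewrite e in h1 h2.
by have [hq|hq] := leqP p N; have := leq_mul hq (leqnn q); lia.
Qed.

(** Rebuilding level [j] costs of the order of [4 ^ j] and happens once in [4 ^ j] steps, so each of
    the [K] levels costs as much as the bare loop. *)
Lemma phase_time NE N : (0 < N)%N ->
  (\sum_(l < N * 4 ^ K) (row_time l + 3) + (size (compile_w NE TB) + 3) <=
   60 * hcost TB (phase chk NE) * (N * 4 ^ K * K.+1))%N.
Proof.
move=> N0; set L := (N * 4 ^ K)%N.
have L0 : (0 < L)%N by rewrite muln_gt0 N0 expn_gt0.
set D := hcost TB (phase chk NE).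
have Dge : (hcost TB (action chk) + hcost TB (HSetW 10 (WVar 5)) + size (compile_w (WVar 4) TB)
    + size (compile_w NE TB) + 12 <= D /\ hcost TB (level_step chk) + 12 <= D)%N.
  by rewrite /D /=; split; lia.
have [D1 D2] := Dge; set hl := hcost TB (level_step chk) in D2.
have key : (\sum_(l < L) \sum_(jj < K) (if 4 ^ (K - jj.+1) %| l then act_time (K - jj.+1) else 0)
   <= K * (25 * L * D))%N.
  rewrite exchange_big /= -[X in (_ <= X * _)%N]card_ord -sum_nat_const leq_sum // => jj _.
  set j := (K - jj.+1)%N.
  have ltj : (j <= K)%N by lia.
  rewrite (eq_bigr (fun l : 'I_L => (4 ^ j %| l) * act_time j))%N; last first.
    by move=> l _; case: ifP => _; rewrite ?mul1n ?mul0n.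
  rewrite -big_distrl /=.
  have EL : L = (N * 4 ^ (K - j) * 4 ^ j)%N by rewrite -mulnA -expnD subnK.
  rewrite -(big_mkord xpredT (fun i => nat_of_bool (4 ^ j %| i)%N)) {1}EL big_mkord.
  rewrite count_multiples ?expn_gt0 //.
  (* The left side is at most [2 * 2 ^ j + 3]; the square of [5] is the factor [25] used below. *)
  have h5 : ((lev j.+1).+2 <= 5 * 2 ^ j)%N.
    have : (0 < 2 ^ j)%N by rewrite expn_gt0.
    by rewrite /lev expnS; lia.
  have hact : (act_time j <= 25 * 4 ^ j * D)%N.
    rewrite /act_time; apply: leq_mul; last by lia.
    apply: leq_trans (leq_mul h5 h5) _.
    by rewrite mulnACA -expnMn.
  apply: leq_trans (leq_mul (leqnn _) hact) _.
  rewrite (_ : (25 * L * D = 25 * (N * 4 ^ (K - j) * 4 ^ j) * D)%N); last by rewrite -EL.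
  by apply/eq_leq; lia.
have E : (\sum_(l < L) (row_time l + 3) =
   L * (hcost TB (HSetW 10 (WVar 5)) + (K * (hl + 3) + (size (compile_w (WVar 4) TB) + 3)) + 3) +
   \sum_(l < L) \sum_(jj < K) (if 4 ^ (K - jj.+1) %| l then act_time (K - jj.+1) else 0))%N.
  rewrite -[X in (X * _)%N]card_ord -sum_nat_const -big_split /=; apply: eq_bigr => l _.
  rewrite /row_time -/hl.
  have -> : (\sum_(jj < K) (hl + (if 4 ^ (K - jj.+1) %| l then act_time (K - jj.+1) else 0) + 3) =
     K * (hl + 3) + \sum_(jj < K) (if 4 ^ (K - jj.+1) %| l then act_time (K - jj.+1) else 0))%N.
    rewrite -[X in (X * _)%N]card_ord -sum_nat_const -big_split /=; apply: eq_bigr => jj _.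
    by rewrite addnAC.
  by rewrite /=; lia.
rewrite E.
have a1 : (hcost TB (HSetW 10 (WVar 5)) + (K * (hl + 3) + (size (compile_w (WVar 4) TB) + 3)) + 3
    <= K.+1 * D)%N.
  have : (K * (hl + 3) <= K * D)%N by rewrite leq_mul2l; apply/orP; right; lia.
  by rewrite mulSn; lia.
have a2 : (K * (25 * L * D) <= 25 * (L * (K.+1 * D)))%N.
  have -> : (K * (25 * L * D) = 25 * (L * (K * D)))%N by lia.
  by rewrite leq_mul2l leq_mul2l leq_mul2r leqnSn !orbT.
have a3 : (D <= L * (K.+1 * D))%N by rewrite mulnA leq_pmull // muln_gt0 L0.
have a4 : (L * (hcost TB (HSetW 10 (WVar 5)) + (K * (hl + 3) + (size (compile_w (WVar 4) TB) + 3)) + 3)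
    <= L * (K.+1 * D))%N by rewrite leq_mul2l a1 orbT.
have -> : (60 * D * (L * K.+1) = 60 * (L * (K.+1 * D)))%N by lia.
by lia.
Qed.
End Phase.

(** * The checks of the two searches *)

Definition chk1 : hcmd := check upd1 post1.
Definition chk2 : hcmd := check upd2 post2.

Section Checks.
Variables (R : realType) (W d n B0 K m : nat).
Notation TB := (40 + d)%N.
Notation st := (state R).
Implicit Types (s : st).
Notation surely := (@surely R W TB).
Notation mat := (@mat R n B0).
Notation lvl := (@lvl R n B0 K m).
Hypothesis n_gt1 : (1 < n)%N.
Hypothesis HW : (B0 + K.+1 * (n * n) * 2 < W)%N.
Hypothesis m_gt0 : (0 < m)%N.
Variables (a b : 'I_n -> 'I_n -> R) (lmax : R).
Hypothesis a_sym : forall u v, a u v = a v u.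
Hypothesis b_sym : forall u v, b u v = b v u.
Hypothesis a_ge0 : forall u v, 0 <= a u v.
Hypothesis ab_ge0 : forall u v, 0 <= a u v + lmax * b u v.
Hypothesis lmax_gt0 : 0 < lmax.
Notation va := (cutv a).
Notation vb := (cutv b).
Variable C0 : {set 'I_n}.
Hypothesis C0min : lexmin a b C0.

Definition sound1 (A B l : R) (fl : nat) : Prop := exists2 C, is_cut C & A = va C /\ B = vb C.
Definition found1 (A B l : R) (fl : nat) : Prop := A = va C0 /\ B = vb C0.

Lemma chk1_ok s j r f : lvl j r s -> (j <= K)%N -> (r <= n)%N -> (1 < r)%N ->
  labelling f r -> represents (mat s 0 j) a f r -> represents (mat s 1 j) b f r ->
  vals sound1 s -> surely (r.+1 * hcost TB chk1) chk1 s (fun s' =>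
    [/\ vals sound1 s', (vals found1 s -> vals found1 s') & forall side, sided C0 f side ->
       vals found1 s' \/
       ready a b (mat s 0 j) (mat s 1 j) r (rreg s' 3) (rreg s' 4) (rreg s' 5) C0]).
Proof.
move=> Ls lj rn r2 lf ra rb snd; have w2 := W_gt2 n_gt1 HW.
have W0 : (0 < W)%N by lia.
have W1 : (1 < W)%N by lia.
pose Iv x A B (l : R) (fl : nat) := [/\ l = rreg s 2, fl = wreg s 20,
     (A = rreg s 0 /\ B = rreg s 1) \/ (exists2 y, (y < x)%N & A = mat s 0 j y y /\ B = mat s 1 j y y),
     lexle A B (rreg s 0) (rreg s 1) & forall y, (y < x)%N -> lexle A B (mat s 0 j y y) (mat s 1 j y y)].
apply: (@check_ok R W d n B0 K m n_gt1 HW m_gt0 j r lj rn r2 s upd1 post1 Iv _ Ls) => //.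
- exact: (allP (isT : all (mem [:: 0; 1; 2]%N) (written_r upd1))).
- by split=> //; [left|right].
- move=> x s' lx L' e10 e11 v.
  exact: (@upd1_ok R W d n B0 K m n_gt1 HW m_gt0 j r lj rn r2 (rreg s 0) (rreg s 1) (rreg s 2) (wreg s 20) (fun y => mat s 0 j y y) (fun y => mat s 1 j y y)).
move=> s' L' m' [el efl src le0 ley] e6 e7.
have snd' : sound1 (rreg s' 0) (rreg s' 1) (rreg s' 2) (wreg s' 20).
  case: src => [[-> ->]|[y ly [-> ->]]]; first exact: snd.
  have [c h1 h2] := fiber_val lf ra rb r2 ly.
  by exists (fiber f y).
have fnd' : vals found1 s -> vals found1 s'.
  move=> [eA eB]; have [C cC [eA' eB']] := snd'.
  have h : lexle (va C0) (vb C0) (rreg s' 0) (rreg s' 1).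
    by rewrite eA' eB'; case: C0min => _; apply.
  by rewrite -eA -eB in h; have [h1 h2] := lexle_anti le0 h; split; rewrite ?h1 ?h2.
set X : R := (\sum_(x <- iota 0 r) mat s 0 j x x != 0)%:R.
set Y : R := (\sum_(x <- iota 0 r) mat s 0 j x x == 0)%:R.
set tot := if \sum_(x <- iota 0 r) mat s 0 j x x == 0 then \sum_(x <- iota 0 r) mat s 1 j x x
   else \sum_(x <- iota 0 r) mat s 0 j x x.
have fin s'' : rreg s'' 0 = rreg s' 0 -> rreg s'' 1 = rreg s' 1 -> 
   rreg s'' 3 = X -> rreg s'' 4 = Y -> rreg s'' 5 = tot ->
   [/\ vals sound1 s'', (vals found1 s -> vals found1 s'') & forall side, sided C0 f side ->
       vals found1 s'' \/
       ready a b (mat s 0 j) (mat s 1 j) r (rreg s'' 3) (rreg s'' 4) (rreg s'' 5) C0].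
  move=> h0 h1 h3 h4 h5; split.
  - by case: snd' => C cC h; exists C; rewrite ?h0 ?h1.
  - by move=> /fnd' [h h']; split; rewrite ?h0 ?h1.
  - move=> side sC; rewrite h3 h4 h5.
    have := check1_ready a_sym b_sym a_ge0 ab_ge0 lmax_gt0 lf ra rb r2 C0min sC snd' ley.
    by case=> [[h h']|]; [left; split; rewrite ?h0 ?h1|right].
apply: surely_if => //=; rewrite ?W0 ?e6 //.
- move=> t0; apply: surely_setr_seq => //=; apply: surely_setr_seq => //=.
  by apply: surely_setr => //=; apply: fin => //=; rewrite /X /Y /tot ?t0.
- move=> t0; apply: surely_setr_seq => //=; apply: surely_setr_seq => //=.
  by apply: surely_setr => //=; apply: fin => //=; rewrite /X /Y /tot ?(negbTE t0) ?t0.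
Qed.

Definition sound2' (A B l : R) (fl : nat) : Prop :=
  [/\ A = va C0, B = vb C0 & sound2 a b lmax (va C0) (vb C0) l fl].
Definition found2' (A B l : R) (fl : nat) : Prop := found2 a b (va C0) (vb C0) l fl.

(** If nothing crosses up to [lmax], the initial incumbent is already final and [C1] is a mere
    placeholder; this is the first alternative of the first hypothesis. *)
Lemma chk2_ok C1 s j r f : found2 a b (va C0) (vb C0) lmax 0 \/ first_crossing a b lmax (va C0) (vb C0) C1 ->
  lvl j r s -> (j <= K)%N -> (r <= n)%N -> (1 < r)%N ->
  labelling f r -> represents (mat s 0 j) a f r -> represents (mat s 1 j) b f r ->
  vals sound2' s -> surely (r.+1 * hcost TB chk2) chk2 s (fun s' =>
    [/\ vals sound2' s', (vals found2' s -> vals found2' s') & forall side, sided C1 f side ->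
       vals found2' s' \/
       ready a b (mat s 0 j) (mat s 1 j) r (rreg s' 3) (rreg s' 4) (rreg s' 5) C1]).
Proof.
move=> fc Ls lj rn r2 lf ra rb [eA0 eB0 snd]; have w2 := W_gt2 n_gt1 HW.
have W0 : (0 < W)%N by lia.
have W1 : (1 < W)%N by lia.
have W3 : (3 < W)%N by apply: leq_ltn_trans HW; nia.
set A := va C0 in eA0 *; set B := vb C0 in eB0 *.
have [l0 llm src0 fl2] := snd.
pose Iv x A' B' (l : R) (fl : nat) := [/\ A' = A, B' = B, (l <= rreg s 2) /\ (fl < 2)%N,
     (l = rreg s 2 /\ fl = wreg s 20) \/
     (fl = 1%N /\ exists2 y, (y < x)%N & mat s 1 j y y < B /\ l * (B - mat s 1 j y y) = mat s 0 j y y - A)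
   & forall y, (y < x)%N -> cleared A B l fl (mat s 0 j y y) (mat s 1 j y y)].
apply: (@check_ok R W d n B0 K m n_gt1 HW m_gt0 j r lj rn r2 s upd2 post2 Iv _ Ls) => //.
- exact: (allP (isT : all (mem [:: 0; 1; 2]%N) (written_r upd2))).
- by split=> //; left.
- move=> x s' lx L' e10 e11 v.
  exact: (@upd2_ok R W d n B0 K m n_gt1 HW m_gt0 j r lj rn r2 A B (rreg s 2) (wreg s 20) (fun y => mat s 0 j y y) (fun y => mat s 1 j y y)).
move=> s' L' m' [eA eB [lel fl2'] src cl] e6 e7.
set l := rreg s' 2 in lel src cl *; set fl := wreg s' 20 in fl2' src cl *.
set ta := \sum_(x <- iota 0 r) mat s 0 j x x in e6; set tb := \sum_(x <- iota 0 r) mat s 1 j x x in e7.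
have lex C : is_cut C -> lexle A B (va C) (vb C) by case: C0min => _; apply.
have snd' : sound2 a b lmax A B l fl.
  case: src => [[-> ->]//|[-> [y ly [h1 h2]]]].
  have [c k1 k2] := fiber_val lf ra rb r2 ly.
  have lp : 0 < l.
    have p : 0 < B - mat s 1 j y y by rewrite subr_gt0.
    rewrite -(pmulr_lgt0 _ p) h2 subr_gt0 k1.
    by case: (lex _ c) => [//|[_]]; rewrite -k2 leNgt h1.
  split=> //; first exact: le_trans lel llm.
  by right; split=> //; exists (fiber f y); split; rewrite -?k1 -?k2.
have [lp llm' _ _] := snd'.
pose fl' := if (ta + l * tb == 0) && (3 < r)%N && (0 < ta) then 1%N else fl.
have snd'' : sound2 a b lmax A B l fl'.
  exact: (check2_sound a_sym a_ge0 ab_ge0 lmax_gt0 lf ra rb r2 C0min erefl erefl lp llm' snd' cl).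
have fnd' : vals found2' s -> found2 a b A B l fl'.
  move=> F C cC lt; have q : 0 < B - vb C by rewrite subr_gt0.
  have le2 : l * (B - vb C) <= rreg s 2 * (B - vb C) by rewrite ler_pM2r.
  have [h1|[h0 h1]] := F C cC lt; first by left; exact: le_lt_trans h1.
  move: le2; rewrite h1 le_eqVlt => /orP[/eqP e|]; last by left.
  right; split=> //; rewrite /fl'; case: ifP => // _.
  by case: src => [[_ ->]//|[]].
have fin s'' : rreg s'' 0 = rreg s' 0 -> rreg s'' 1 = rreg s' 1 -> rreg s'' 2 = l ->
   wreg s'' 20 = fl' -> rreg s'' 3 = 1 -> rreg s'' 4 = l -> rreg s'' 5 = ta + l * tb ->
   [/\ vals sound2' s'', (vals found2' s -> vals found2' s'') & forall side, sided C1 f side ->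
       vals found2' s'' \/
       ready a b (mat s 0 j) (mat s 1 j) r (rreg s'' 3) (rreg s'' 4) (rreg s'' 5) C1].
  move=> h0 h1 h2 h20 h3 h4 h5; split.
  - by split; rewrite ?h0 ?h1 ?h2 ?h20.
  - by move=> /fnd'; rewrite /vals /found2' h2 h20.
  - move=> side sC; rewrite h3 h4 h5 /vals /found2' h2 h20.
    case: fc => [F|F].
      left; apply: fnd'; rewrite /vals /found2'; case: src0 => [[-> ->] //|[_ [C [cC ltC eC]]]].
      have [|[//]] := F C cC ltC; rewrite -eC ltNge => /negP[].
      by rewrite ler_pM2r ?subr_gt0.
    exact: (check2_ready a_sym b_sym a_ge0 ab_ge0 lmax_gt0 lf ra rb r2 C0min erefl erefl lp llm' F sC snd' cl).
apply: surely_setr_seq => //=; apply: surely_setr_seq => //=; apply: surely_setr_seq => //=.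
have [_ _ er] := L'.
rewrite e6 e7 -/l.
apply: surely_if => //=; rewrite ?W0 // ?er.
- move=> t0; apply: surely_if => //=; rewrite ?W3 ?er //.
    move=> r4; apply: surely_if => //=; rewrite ?W0 // ?e6.
      by move=> tp; apply: surely_setw => //=; apply: fin => //=; rewrite /fl' t0 r4 tp.
    by move=> tp; apply: surely_skip; apply: fin => //=; rewrite /fl' t0 r4 (negbTE tp).
  by move=> r4; apply: surely_skip; apply: fin => //=; rewrite /fl' (negbTE r4) andbF.
- by move=> t0; apply: surely_skip; apply: fin => //=; rewrite /fl' (negbTE t0).
Qed.
End Checks.

(** * Extremal cuts and slope changes along the ray *)

Lemma arg_min_exists (R : realType) (T : finType) (P : pred T) (F : T -> R) :
  (exists x, P x) -> exists2 x, P x & forall y, P y -> F x <= F y.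
Proof.
move=> [x0 Px0]; have : P [arg min_(x < x0 | P x) F x]%O /\
  forall y, P y -> F [arg min_(x < x0 | P x) F x]%O <= F y by case: arg_minP.
by move=> [h1 h2]; exists [arg min_(x < x0 | P x) F x]%O.
Qed.

Lemma cut_vertex0 n : (1 < n)%N -> is_cut [set v : 'I_n | val v == 0%N].
Proof.
move=> n_gt1; apply/andP; split.
  by apply/set0Pn; exists (Ordinal (ltnW n_gt1)); rewrite inE.
rewrite properE finset.subsetT /=; apply/subsetPn.
by exists (Ordinal n_gt1); rewrite ?inE.
Qed.

Section Extrema.
Variables (R : realType) (n : nat) (a b : 'I_n -> 'I_n -> R).

Lemma lexmin_exists : (1 < n)%N -> exists C, lexmin a b C.
Proof.
move=> n_gt1.
have [|C cC mn] := @arg_min_exists R _ (@is_cut n) (cutv a).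
  by eexists; exact: cut_vertex0.
have [|C' /andP[cC' /eqP e] mn'] := @arg_min_exists R _
  (fun C' => is_cut C' && (cutv a C' == cutv a C)) (cutv b).
  by exists C; rewrite cC eqxx.
exists C'; split=> // D cD; rewrite /lexle e.
have := mn D cD; rewrite le_eqVlt => /orP[/eqP h|h]; [right|by left].
by split=> //; apply: mn'; rewrite cD h eqxx.
Qed.

Lemma first_crossing_exists lmax A B :
  (exists C, first_crossing a b lmax A B C) \/ found2 a b A B lmax 0.
Proof.
have [[C cC [ltC leC]]|no] := pselect (exists2 C, is_cut C &
  cutv b C < B /\ cutv a C - A <= lmax * (B - cutv b C)); [left|right]; last first.
  move=> C cC lt; left; rewrite ltNge; apply/negP => h; apply: no; exists C => //.
have [|C1 /andP[c1 lt1] mn] := @arg_min_exists R _ (fun C => is_cut C && (cutv b C < B))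
  (fun C => (cutv a C - A) / (B - cutv b C)); first by exists C; rewrite cC.
have p1 : 0 < B - cutv b C1 by rewrite subr_gt0.
exists C1; split=> //.
  have p : 0 < B - cutv b C by rewrite subr_gt0.
  rewrite -ler_pdivrMr //; apply: le_trans (mn C _) _; first by rewrite cC.
  by rewrite ler_pdivrMr.
move=> D cD ltD; have p : 0 < B - cutv b D by rewrite subr_gt0.
have := mn D; rewrite cD ltD => /(_ isT).
by rewrite ler_pdivrMr // mulrAC ler_pdivlMr.
Qed.
End Extrema.

Section Breakpoint.
Variables (R : realType) (d n : nat) (E : {set {set 'I_n}}).
Variable c : 'I_d.+1 -> {set 'I_n} -> int.
Hypotheses (n_gt1 : (1 < n)%N) (gE : simple_graph E).
Variables (mu nu : 'rV[R]_d).

(** As edges have two elements, a cut edge is the same as an ordered pair with its first end in [C]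
    and its second outside; orienting by the cut counts each edge once. *)
Lemma sum_cut_edges (F : {set 'I_n} -> R) C : \sum_(e in cut_edges E C) F e =
  cutv (fun u v => if [set u; v] \in E then F [set u; v] else 0) C.
Proof.
pose A := [set p : 'I_n * 'I_n | [&& p.1 \in C, p.2 \notin C & [set p.1; p.2] \in E]].
pose h (p : 'I_n * 'I_n) := [set p.1; p.2].
have hA : h @: A = cut_edges E C.
  apply/setP => e; apply/imsetP/idP => [[[u v]]|].
    rewrite inE /= => /and3P[uC vC uvE] ->; rewrite inE uvE /=; apply/andP; split.
      by apply/set0Pn; exists u; rewrite !inE eqxx.
    by apply/set0Pn; exists v; rewrite !inE vC eqxx orbT.
  rewrite inE => /and3P[eE /set0Pn[u ue] /set0Pn[v ve]].
  move: ue ve; rewrite !inE => /andP[ue uC] /andP[vC ve].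
  have ne : u != v by apply: contraTneq uC => ->.
  have ee : e = [set u; v].
    apply/eqP; rewrite eq_sym eqEcard (gE eE) cards2 ne andbT.
    by apply/fintype.subsetP => z; rewrite !inE => /orP[] /eqP->.
  by exists (u, v); rewrite // inE /= uC vC -ee.
have inj : {in A &, injective h}.
  move=> [u v] [u' v']; rewrite !inE /= => /and3P[uC vC _] /and3P[uC' vC' _] e.
  have : u \in [set u'; v'] by rewrite -[[set u'; v']]e !inE eqxx.
  have : v \in [set u'; v'] by rewrite -[[set u'; v']]e !inE eqxx orbT.
  rewrite !inE => /orP[/eqP e1|/eqP->]; first by rewrite e1 uC' in vC.
  by move=> /orP[/eqP->//|/eqP e2]; rewrite e2 (negbTE vC') in uC.
rewrite -hA big_imset //= /cutv pair_big_dep /= [RHS]big_mkcond [LHS]big_mkcond.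
apply: eq_bigr => -[u v] _ /=; rewrite !inE /=.
by case: (u \in C); case: (v \in C) => //=; case: ifP.
Qed.

Definition cost_a u v : R := if [set u; v] \in E then edge_cost c mu [set u; v] else 0.
Definition cost_b u v : R := if [set u; v] \in E then
  \sum_(i < d) nu 0 i * (c (lift ord0 i) [set u; v])%:~R else 0.

Lemma edge_cost_ray t e : edge_cost c (mu + t *: nu) e =
  edge_cost c mu e + t * \sum_(i < d) nu 0 i * (c (lift ord0 i) e)%:~R.
Proof.
rewrite /edge_cost -addrA; congr (_ + _); rewrite mulr_sumr -big_split /=.
by apply: eq_bigr => i _; rewrite !mxE; ring.
Qed.

Lemma cut_cost_ray t C : cut_cost E c (mu + t *: nu) C = cutv cost_a C + t * cutv cost_b C.
Proof.
rewrite /cut_cost; under eq_bigr do rewrite edge_cost_ray.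
by rewrite big_split /= -mulr_sumr !sum_cut_edges.
Qed.

Lemma min_cut_valueP (x : 'rV[R]_d) : (exists2 C, is_cut C & min_cut_value E c x = cut_cost E c x C) /\
  forall C, is_cut C -> min_cut_value E c x <= cut_cost E c x C.
Proof.
rewrite /min_cut_value; case: arg_minP.
  exact: cut_vertex0.
by move=> C cC h; split; [exists C|].
Qed.

Notation a := cost_a.
Notation b := cost_b.
Variables (M : 'rV[R]_d -> Prop) (lmax : R) (C0 : {set 'I_n}).
Hypotheses (lmax_gt0 : 0 < lmax) (lmaxP : forall l, 0 < l -> (M (mu + l *: nu) <-> l <= lmax)).
Hypothesis C0min : lexmin a b C0.
Let A := cutv a C0.
Let B := cutv b C0.
Let h t := min_cut_value E c (mu + t *: nu).

Lemma value_line t : (forall C, is_cut C -> A + t * B <= cutv a C + t * cutv b C) ->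
  h t = A + t * B.
Proof.
move=> H; have [[C cC e] le] := min_cut_valueP (mu + t *: nu).
apply/eqP; rewrite eq_le; apply/andP; split; last first.
  by rewrite /h e cut_cost_ray H.
by have := le C0 (proj1 C0min); rewrite cut_cost_ray.
Qed.

Lemma line_below l t C : 0 <= t <= l -> is_cut C ->
  (cutv b C < B -> l * (B - cutv b C) <= cutv a C - A) ->
  A + t * B <= cutv a C + t * cutv b C.
Proof.
move=> /andP[t0 tl] cC H; have [lt|ge] := ltP (cutv b C) B.
  have := H lt; have : t * (B - cutv b C) <= l * (B - cutv b C).
    by rewrite ler_pM2r ?subr_gt0.
  lra.
have : t * B <= t * cutv b C by rewrite ler_wpM2l.
by move=> hh; have := proj2 C0min C cC; rewrite -/A -/B => -[h1|[h1 _]]; lra.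
Qed.

Lemma linear_no_change l1 t : (forall t', 0 <= t' <= l1 -> h t' = A + t' * B) ->
  0 < t < l1 -> ~ changes_slope h t.
Proof.
move=> H /andP[t0 tl]; apply; exists B.
have ht : t \in `]0, l1[ by rewrite in_itv /= t0.
have := near_in_itvoo ht; apply: filterS => z; rewrite in_itv /= => /andP[z0 zl].
by rewrite !H; [ring|rewrite !ltW|rewrite !ltW].
Qed.

(** Up to [l] the value follows the line of slope [B]; after [l] it is at most the line of [C1],
    whose slope is smaller, so no affine function fits on both sides. *)
Lemma next_breakpoint_found l : 0 < l <= lmax -> found2 a b A B l 1 ->
  (exists C, crossing a b A B l C) ->
  is_next_breakpoint (min_cut_value E c) M mu nu (mu + l *: nu).
Proof.
move=> /andP[l0 llm] fd [C1 [cC1 ltB eC]].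
have lin t : 0 <= t <= l -> h t = A + t * B.
  move=> tl; apply: value_line => C cC; apply: (line_below tl cC) => lt.
  by have [/ltW|[_ ->]] := fd C cC lt.
exists l; split=> //; first exact/lmaxP.
  move=> [s /nbhs_ballP[e /= e0 He]].
  (* Half of the minimum keeps both [l - dl] and [l + dl] in the neighbourhood, and [l - dl] on the
     ray. *)
  pose dl := Num.min e l / 2.
  have m0 : 0 < Num.min e l by rewrite lt_min e0.
  have me : Num.min e l <= e by rewrite ge_min lexx.
  have ml : Num.min e l <= l by rewrite ge_min lexx orbT.
  have dl0 : 0 < dl by rewrite /dl; lra.
  have b1 : ball l e (l - dl).
    by rewrite /ball /= opprB addrCA subrr addr0 gtr0_norm // /dl; lra.
  have b2 : ball l e (l + dl).
    by rewrite /ball /= opprD addNKr normrN gtr0_norm // /dl; lra.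
  have := He _ b1; have := He _ b2; rewrite -/(h _) -/(h _) -/(h _).
  rewrite (lin l); last by rewrite lexx ltW.
  rewrite (lin (l - dl)); last by rewrite /dl; apply/andP; split; lra.
  have := (min_cut_valueP (mu + (l + dl) *: nu)).2 C1 cC1.
  rewrite cut_cost_ray -/(h _) => le2 e2 e1.
  have sB : s * dl = B * dl by lra.
  have : dl * cutv b C1 < dl * B by rewrite ltr_pM2l.
  by rewrite e2 in le2; lra.
move=> t tl; exact: (linear_no_change lin).
Qed.

(** A slope change at [lmax] itself must be excluded as well. There are finitely many cuts and the
    inequalities at [lmax] are strict, so nothing crosses up to some [l1 > lmax], and the value is
    linear around [lmax] too. *)
Lemma next_breakpoint_none : found2 a b A B lmax 0 ->
  ~ exists x, is_next_breakpoint (min_cut_value E c) M mu nu x.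
Proof.
move=> fd [x [l [l0 -> Ml ch _]]].
have llm : l <= lmax by apply/lmaxP.
have [l1 ltl1 H] : exists2 l1, lmax < l1 & forall C, C \in enum {set 'I_n} -> is_cut C ->
   cutv b C < B -> l1 * (B - cutv b C) <= cutv a C - A.
  elim: (enum _) => [|C Cs [l1 h1 h2]]; first by exists (lmax + 1); [lra|].
  have [/andP[cC ltB]|nC] := boolP (is_cut C && (cutv b C < B)); last first.
    exists l1 => // C'; rewrite inE => /orP[/eqP->|/h2//] cC lt.
    by rewrite cC lt in nC.
  have p : 0 < B - cutv b C by rewrite subr_gt0.
  exists (Num.min l1 ((cutv a C - A) / (B - cutv b C))).
    rewrite lt_min h1 ltr_pdivlMr //.
    by have [//|[]] := fd C cC ltB.
  move=> C'; rewrite inE => /orP[/eqP-> _ _|C's cC' lt'].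
    by rewrite -ler_pdivlMr // ge_min lexx orbT.
  apply: le_trans (h2 C' C's cC' lt'); rewrite ler_pM2r ?subr_gt0 // ge_min lexx //.
apply: ch; have nc := @linear_no_change l1 l; apply: contrapT => ch; apply: nc => //.
- move=> t tl; apply: value_line => C cC; apply: (line_below tl cC) => lt.
  by apply: H => //; rewrite mem_enum.
- by rewrite l0 /=; lra.
Qed.

Lemma no_ray_breakpoint : nu = 0 \/ (forall l, 0 < l -> ~ M (mu + l *: nu)) ->
  ~ exists x, is_next_breakpoint (min_cut_value E c) M mu nu x.
Proof.
case=> [n0|nM] [x [l [l0 -> Ml ch _]]]; last exact: nM Ml.
apply: ch; exists 0; apply/nbhs_ballP; exists 1 => //= t _; by rewrite mul0r addr0 n0 !scaler0.
Qed.

End Breakpoint.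

(* A program for the length of the ray inside the simplex *)
From mathcomp Require Import fingroup perm.

Definition rsum (l : seq rexpr) : rexpr := foldr (RBin RAdd) zeroR l.
Definition rprod (l : seq rexpr) : rexpr := foldr (RBin RMul) oneR l.
Definition hseq (l : seq hcmd) : hcmd := foldr HSeq HSkip l.

Definition signE (b : bool) : rexpr := if b then zeroR [-r] oneR else oneR.

Definition detE k (E : 'I_k -> 'I_k -> rexpr) : rexpr :=
  rsum (map (fun s : {perm 'I_k} =>
    signE (odd_perm s) [*r] rprod [seq E i (s i) | i <- enum 'I_k]) (enum {perm 'I_k})).

Definition adjE k (E : 'I_k -> 'I_k -> rexpr) (i j : 'I_k) : rexpr :=
  signE (odd (j + i)) [*r] detE (fun x y : 'I_k.-1 => E (lift j x) (lift i y)).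

Section RayProgram.
Variable d : nat.

Definition muE (i : 'I_d) : rexpr := RMem (WNum i).
Definition nuE (i : 'I_d) : rexpr := RMem (WNum (d + i)).
Definition pE (j : nat) (i : 'I_d) : rexpr := RMem (WNum (d + d + (j * d + i))).

Definition edgeE k (j : 'I_k) (i : 'I_d) : rexpr := pE j.+1 i [-r] pE 0 i.
(** The matrix of edges need not be square; its Gram matrix is, and it is invertible for affinely
    independent vertices. *)
Definition gramE k (j j' : 'I_k) : rexpr :=
  rsum [seq edgeE j i [*r] edgeE j' i | i <- enum 'I_d].

(* The coordinates of a vector in the basis of the edges of the simplex at its
   first vertex, by Cramer's rule for the Gram matrix. *)
Definition coordE k (xE : 'I_d -> rexpr) (j : 'I_k) : rexpr :=
  rsum [seq rsum [seq xE l [*r] edgeE i l | l <- enum 'I_d] [*r] adjE (@gramE k) i j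
       | i <- enum 'I_k] [/r] detE (@gramE k).

Definition startE k (j : 'I_k) : rexpr := coordE (fun i => muE i [-r] pE 0 i) j.
Definition dirE k (j : 'I_k) : rexpr := coordE nuE j.

(** Constant term and slope of each barycentric coordinate along the ray; the last pair belongs to
    the first vertex of the simplex. *)
Definition constraints k : seq (rexpr * rexpr) :=
  rcons [seq (startE j, dirE j) | j <- enum 'I_k]
    (oneR [-r] rsum [seq startE j | j <- enum 'I_k],
     zeroR [-r] rsum [seq dirE j | j <- enum 'I_k]).

(** Only a decreasing coordinate limits the ray. Register 24 tells whether register 12 holds a bound
    yet. *)
Definition bound_by (pq : rexpr * rexpr) : hcmd :=
  HSetR 13 pq.1 ;; HSetR 14 pq.2 ;;
  HIf (LtR (RVar 14) zeroR)
    (HSetR 10 ((zeroR [-r] RVar 13) [/r] RVar 14) ;;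
     HIf (EqW (WVar 24) (WNum 0)) (HSetR 12 (RVar 10) ;; HSetW 24 (WNum 1))
       (HIf (LtR (RVar 10) (RVar 12)) (HSetR 12 (RVar 10)) HSkip))
    HSkip.

(** Cramer's rule yields the coordinates of the orthogonal projection, so the equality can fail only
    for a direction that is not parallel to the simplex. *)
Definition residual k (i : 'I_d) : hcmd :=
  HIf (EqR (nuE i) (rsum [seq dirE j [*r] edgeE j i | j <- enum 'I_k])) HSkip
    (HSetW 24 (WNum 0)).

Definition ray_k k : hcmd :=
  hseq [seq bound_by pq | pq <- constraints k] ;;
  hseq [seq residual k i | i <- enum 'I_d] ;;
  HIf (LtR zeroR (RVar 12)) HSkip (HSetW 24 (WNum 0)).

(** The dimension of the simplex is known only at run time whereas the formulas are fixed
    expressions; hence one copy for each possible dimension. *)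
Fixpoint ray_upto k : hcmd :=
  if k is k'.+1 then
    HIf (EqW (WVar 21) (WNum k)) (ray_k k') (ray_upto k')
  else HSkip.
End RayProgram.

Section RayEval.
Variables (R : realType) (W d : nat).
Notation TB := (40 + d)%N.
Notation st := (state R).
Implicit Types (s : st) (e : rexpr).
Notation surely := (@surely R W TB).

(** Such expressions read only constants and fixed memory cells, so their values do not change while
    registers are updated. *)
Fixpoint pureE e : bool :=
  match e with
  | RWord (WNum c) | RMem (WNum c) => (c < W)%N
  | RBin _ a b => pureE a && pureE b
  | _ => false
  end.

Lemma pure_safe s e : pureE e -> rsafe W TB s e.
Proof.
by elim: e => [i|w|o e1 IH1 e2 IH2|w] //=; [case: w|move=> /andP[/IH1-> /IH2->]|case: w].
Qed.

Lemma pure_eval s s' e : pureE e -> rmem s' = rmem s -> reval s' e = reval s e.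
Proof.
move=> + E; elim: e => [i|w|o e1 IH1 e2 IH2|w] //=; first by case: w.
  by move=> /andP[/IH1-> /IH2->].
by case: w => //= c _; rewrite E.
Qed.

Hypothesis W_gt1 : (1 < W)%N.

Lemma pure_rsum I (l : seq I) (F : I -> rexpr) :
  (forall i, pureE (F i)) -> pureE (rsum [seq F i | i <- l]).
Proof. by move=> h; elim: l => [|i l IH] /=; [exact: ltnW|rewrite h]. Qed.

Lemma pure_rprod I (l : seq I) (F : I -> rexpr) :
  (forall i, pureE (F i)) -> pureE (rprod [seq F i | i <- l]).
Proof. by move=> h; elim: l => [|i l IH] //=; rewrite h. Qed.

Lemma reval_rsum s I (l : seq I) (F : I -> rexpr) :
  reval s (rsum [seq F i | i <- l]) = \sum_(i <- l) reval s (F i).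
Proof. by elim: l => [|i l IH]; rewrite ?big_nil ?big_cons //= IH. Qed.

Lemma reval_rprod s I (l : seq I) (F : I -> rexpr) :
  reval s (rprod [seq F i | i <- l]) = \prod_(i <- l) reval s (F i).
Proof. by elim: l => [|i l IH]; rewrite ?big_nil ?big_cons //= IH. Qed.

Lemma pure_sign b : pureE (signE b).
Proof. by case: b; rewrite /= ?W_gt1 ?(ltnW W_gt1). Qed.

Lemma reval_sign s b : reval s (signE b) = (-1) ^+ b :> R.
Proof. by case: b => /=; rewrite ?sub0r ?expr1. Qed.

Lemma pure_det k (E : 'I_k -> 'I_k -> rexpr) : (forall i j, pureE (E i j)) -> pureE (detE E).
Proof.
move=> h; apply: pure_rsum => p.
by apply: (introT andP); split; [exact: pure_sign|apply: pure_rprod].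
Qed.

Lemma reval_det s k (E : 'I_k -> 'I_k -> rexpr) :
  reval s (detE E) = \det (\matrix_(i, j) reval s (E i j)).
Proof.
rewrite /detE reval_rsum big_enum; apply: eq_bigr => p _.
rewrite -[LHS]/(reval s (signE p) * reval s (rprod _)) reval_sign reval_rprod big_enum.
by congr (_ * _); apply: eq_bigr => i _; rewrite mxE.
Qed.

Lemma pure_adj k (E : 'I_k -> 'I_k -> rexpr) i j :
  (forall i j, pureE (E i j)) -> pureE (adjE E i j).
Proof.
by move=> h; apply: (introT andP); split; [exact: pure_sign|apply: pure_det].
Qed.

Lemma reval_adj s k (E : 'I_k -> 'I_k -> rexpr) i j :
  reval s (adjE E i j) = (\adj (\matrix_(i, j) reval s (E i j))) i j.
Proof.
rewrite /adjE -[LHS]/(reval s (signE _) * reval s (detE _)) reval_sign reval_det.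
rewrite mxE /cofactor signr_odd; congr (_ * \det _).
by apply/matrixP => x y; rewrite !mxE.
Qed.

Hypothesis W_d : (d.+1 < W)%N.
Hypothesis W_big : (d + d + (d.+1 * d) < W)%N.

Lemma idx_lt k (j : nat) (i : 'I_d) : (k <= d)%N -> (j <= k)%N -> (d + d + (j * d + i) < W)%N.
Proof.
move=> kd jk; apply: leq_ltn_trans W_big; rewrite leq_add2l.
apply: (@leq_trans (j.+1 * d)); first by rewrite mulSn addnC leq_add2r ltnW.
by rewrite leq_mul2r; apply/orP; right; lia.
Qed.

Section Fixed.
Variables (k : nat).
Hypothesis kd : (k <= d)%N.

Lemma pure_edge (j : 'I_k) (i : 'I_d) : pureE (edgeE j i).
Proof. by rewrite /= !(@idx_lt k). Qed.

Lemma pure_gram (j j' : 'I_k) : pureE (gramE d j j').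
Proof.
by apply: pure_rsum => i; rewrite -[pureE _]/(pureE (edgeE j i) && pureE (edgeE j' i)) !pure_edge.
Qed.

Lemma pure_coord xE (j : 'I_k) : (forall i : 'I_d, pureE (xE i)) -> pureE (coordE xE j).
Proof.
move=> h; rewrite -[pureE _]/(pureE (rsum _) && pureE (detE _)) pure_det ?andbT; last exact: pure_gram.
apply: pure_rsum => i; rewrite -[pureE _]/(pureE (rsum _) && pureE (adjE _ _ _)).
rewrite pure_adj ?andbT; last exact: pure_gram.
by apply: pure_rsum => l; rewrite -[pureE _]/(pureE (xE l) && pureE (edgeE i l)) h pure_edge.
Qed.

Lemma pure_start (j : 'I_k) : pureE (startE d j).
Proof.
apply: pure_coord => i; rewrite /= (@idx_lt k) // andbT.
by apply: leq_ltn_trans W_big; have := ltn_ord i; lia.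
Qed.

Lemma pure_dir (j : 'I_k) : pureE (dirE d j).
Proof.
apply: pure_coord => i; rewrite /=.
by apply: leq_ltn_trans W_big; have := ltn_ord i; lia.
Qed.

Lemma pure_constraints : all (fun pq => pureE pq.1 && pureE pq.2) (constraints d k).
Proof.
rewrite /constraints all_rcons; apply/andP; split.
  rewrite -[pureE _ && _]/((1 < W)%N && pureE (rsum _) && ((0 < W)%N && pureE (rsum _))).
  by rewrite W_gt1 (ltnW W_gt1) !pure_rsum //; [exact: pure_dir|exact: pure_start].
rewrite all_map; apply/allP => j _.
by apply: (introT andP); split; [exact: pure_start|exact: pure_dir].
Qed.

(** Either no coordinate seen so far decreases, or register 12 is the largest parameter they all
    admit, attained by one of them. *)
Definition bounded_by (l : seq (R * R)) s : Prop :=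
  (wreg s 24 = 0%N /\ forall p, p \in l -> 0 <= p.2) \/
  [/\ wreg s 24 = 1%N, forall p, p \in l -> p.2 < 0 -> rreg s 12 * - p.2 <= p.1
    & exists2 p, p \in l & p.2 < 0 /\ rreg s 12 * - p.2 = p.1].

Lemma bound_by_ok s pq l : pureE pq.1 && pureE pq.2 -> bounded_by l s ->
  surely (hcost TB (bound_by pq)) (bound_by pq) s
    (bounded_by (rcons l (reval s pq.1, reval s pq.2))).
Proof.
move=> /andP[p1 p2] H; have W0 := ltnW W_gt1.
apply: surely_setr_seq => //; first exact: pure_safe.
apply: surely_setr_seq => //; first exact: pure_safe.
rewrite [reval (set_rreg _ _ _) pq.2](@pure_eval s) //.
set x := reval s pq.1; set y := reval s pq.2.
have mr (p : R * R) : p \in rcons l (x, y) -> p = (x, y) \/ p \in l.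
  by rewrite mem_rcons inE => /orP[/eqP|]; [left|right].
have ml (p : R * R) : p \in l -> p \in rcons l (x, y) by rewrite mem_rcons inE => ->; rewrite orbT.
have mx : (x, y) \in rcons l (x, y) by rewrite mem_rcons mem_head.
apply: surely_if => //=; rewrite ?W0 //; last first.
  rewrite -leNgt => y0; apply: surely_skip; case: H => [[h1 h2]|[h1 h2 [p pl h3]]].
    by left; split=> //= p /mr[->|/h2].
  right; split=> //=; last by exists p; rewrite ?ml.
  by move=> q /mr[->|ql] //=; [rewrite ltNge y0|exact: h2].
move=> y0; apply: surely_setr_seq => //=; rewrite ?W0 //.
have q0 : 0 < - y by lra.
set z := (0 - x) / y.
have zE : z * - y = x by rewrite /z; field; rewrite lt_eqF.
apply: surely_if => //=; rewrite ?W0 //.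
  move=> /eqP e24; apply: surely_setr_seq => //=; apply: surely_setw => //=.
  right; split=> //=; last by exists (x, y).
  case: H => [[_ h2]|[h1 _ _]]; last by rewrite h1 in e24.
  by move=> p /mr[->|/h2 h] /=; [rewrite zE|rewrite ltNge h].
move=> e24; case: H => [[h1 _]|[h1 h2 [p pl [h3 h4]]]]; first by rewrite h1 in e24.
apply: surely_if => //= h5.
  apply: surely_setr => //=; right; split=> //=; last by exists (x, y).
  move=> q /mr[->|ql] /= qn; first by rewrite zE.
  apply: le_trans (h2 q ql qn); rewrite ler_pM2r ?ltW //; lra.
apply: surely_skip; right; split=> //=; last by exists p; rewrite ?ml.
move=> q /mr[->|ql] /= qn; last exact: h2.
by rewrite -zE ler_pM2r // leNgt.
Qed.

Lemma hseq_ok T (f : T -> hcmd) (Q : T -> bool) (Inv : seq T -> st -> Prop) cs l s :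
  (forall c, ~~ stores (f c)) -> all Q cs ->
  (forall l c s', Q c -> rmem s' = rmem s -> Inv l s' ->
     surely (hcost TB (f c)) (f c) s' (Inv (rcons l c))) ->
  Inv l s ->
  surely (hcost TB (hseq (map f cs))) (hseq (map f cs)) s (Inv (l ++ cs)).
Proof.
move=> ns; move E: (rmem s) => rm.
elim: cs l s E => [|c cs IH] l s E /=; first by move=> _ _ I0; apply: surely_skip; rewrite cats0.
move=> /andP[qc qcs] H I0; apply: surely_seq (H l c s qc E I0) _ => s' F _ I1.
rewrite -cat_rcons; apply: IH => //.
by case: F => _ _ _ h; rewrite h.
Qed.

Definition cval s pq : R * R := (reval s pq.1, reval s pq.2).
Definition res_ok s : Prop := forall i : 'I_d, reval s (nuE i) =
  reval s (rsum [seq dirE d j [*r] edgeE j i | j : 'I_k <- enum 'I_k]).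

Definition ray_post (cv : seq (R * R)) (res : Prop) s : Prop :=
  [/\ wreg s 24 = 1%N, 0 < rreg s 12, res,
     forall p, p \in cv -> p.2 < 0 -> rreg s 12 * - p.2 <= p.1
   & exists2 p, p \in cv & p.2 < 0 /\ rreg s 12 * - p.2 = p.1] \/
  (wreg s 24 = 0%N /\ [\/ forall p, p \in cv -> 0 <= p.2, ~ res
     | exists2 p, p \in cv & p.2 < 0 /\ p.1 <= 0]).

Lemma ray_k_ok s : wreg s 24 = 0%N ->
  surely (hcost TB (ray_k d k)) (ray_k d k) s (fun s' => rmem s' = rmem s /\
    ray_post [seq cval s pq | pq <- constraints d k] (res_ok s) s').
Proof.
move=> e24; have W0 := ltnW W_gt1.
have bst pq : ~~ stores (bound_by pq) by [].
have hst T (f : T -> hcmd) cs : (forall c, ~~ stores (f c)) -> ~~ stores (hseq (map f cs)).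
  by move=> h; elim: cs => //= c cs IH; rewrite negb_or h.
set cv := [seq cval s pq | pq <- constraints d k].
apply: (surely_seq (P1 := bounded_by cv)).
  have := @hseq_ok _ (@bound_by) (fun pq => pureE pq.1 && pureE pq.2)
    (fun l s' => bounded_by [seq cval s pq | pq <- l] s') (constraints d k) [::] s bst pure_constraints.
  rewrite cat0s; apply; last by left.
  move=> l c s' pc em I0; rewrite map_rcons; have /andP[c1 c2] := pc.
  have := bound_by_ok pc I0; rewrite (pure_eval c1 em) (pure_eval c2 em); exact.
move=> s1 F1 _ H1; have m1 : rmem s1 = rmem s by case: F1 => _ _ _ h; rewrite h // hst.
pose rk (i : 'I_d) := reval s (nuE i) = reval s (rsum [seq dirE d j [*r] edgeE j i | j : 'I_k <- enum 'I_k]).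
pose Inv (l : seq 'I_d) s2 := rmem s2 = rmem s /\
  ((forall i, i \in l -> rk i) /\ bounded_by cv s2 \/
   (wreg s2 24 = 0%N /\ ~ res_ok s)).
apply: (surely_seq (P1 := Inv (enum 'I_d))).
  have rst (i : 'I_d) : ~~ stores (residual k i) by [].
  have := @hseq_ok 'I_d (fun i => residual k i) xpredT Inv (enum 'I_d) [::] s1 rst (all_predT _).
  rewrite cat0s; apply; last by split=> //; left; split.
  move=> l i s2 _ em [em' I0].
  have pn : pureE (nuE i).
    by rewrite /=; apply: leq_ltn_trans W_big; have := ltn_ord i; lia.
  have pr : pureE (rsum [seq dirE d j [*r] edgeE j i | j : 'I_k <- enum 'I_k]).
    apply: pure_rsum => j; rewrite -[pureE _]/(pureE (dirE d j) && pureE (edgeE j i)).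
    by rewrite pure_dir pure_edge.
  apply: surely_if.
  - by rewrite -[tsafe _ _ _ _]/(rsafe W TB s2 (nuE i) && rsafe W TB s2 (rsum _)) !pure_safe.
  - rewrite -[teval _ _]/(reval s2 (nuE i) == reval s2 (rsum _)) !(@pure_eval s) //.
    move=> /eqP e; apply: surely_skip; split=> //.
    case: I0 => [[h1 h2]|h]; [left|by right]; split=> // i'.
    by rewrite mem_rcons inE => /orP[/eqP->|/h1].
  - rewrite -[teval _ _]/(reval s2 (nuE i) == reval s2 (rsum _)) !(@pure_eval s) //.
    move=> /eqP e; apply: surely_setw; [by []|by rewrite /= W0|split; [by []|right; split; [by []|]]].
    by move=> h; apply: e; exact: h.
move=> s2 F2 _ [m2 H2].
apply: surely_if => //=; rewrite ?W0 // => h.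
  apply: surely_skip; split=> //; case: H2 => [[h1 [[e h2]|[e h2 h3]]]|[e h2]].
  - by right; split=> //; constructor 1.
  - by left; split=> // i; apply: h1; rewrite mem_enum.
  - by right; split=> //; constructor 2.
apply: surely_setw => //=; split=> //; right; split=> //.
rewrite -leNgt in h; case: H2 => [[h1 [[e h2]|[e h2 [p pc [h3 h4]]]]]|[e h2]].
- by constructor 1.
- constructor 3; exists p => //; split=> //; rewrite -h4.
  by rewrite mulr_le0_ge0 // oppr_ge0 ltW.
- by constructor 2.
Qed.
End Fixed.

Lemma ray_upto_ok s k K : (k < K)%N -> (K <= d.+1)%N -> wreg s 24 = 0%N -> wreg s 21 = k.+1 ->
  surely (hcost TB (ray_upto d K)) (ray_upto d K) s (fun s' => rmem s' = rmem s /\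
    ray_post [seq cval s pq | pq <- constraints d k] (res_ok k s) s').
Proof.
move=> ltk Kd e24 e21; elim: K ltk Kd => [//|K IH]; rewrite ltnS leq_eqVlt => /orP[/eqP<-|ltk] Kd.
  apply: surely_if => //=.
  - by rewrite (leq_ltn_trans _ W_d).
  - by move=> _; apply: ray_k_ok.
  - by rewrite e21 eqxx.
apply: surely_if => //=.
- by rewrite (leq_ltn_trans _ W_d).
- by rewrite e21 eqSS => /eqP e; rewrite e ltnn in ltk.
- by move=> _; apply: IH => //; exact: ltnW.
Qed.
End RayEval.

(** * Barycentric coordinates along the ray *)

Section Simplex.
Variables (R : realType) (d k : nat) (P : 'M[R]_(k.+1, d)) (mu nu : 'rV[R]_d).
Hypothesis indep : affinely_independent P.
Let A : 'M[R]_(k, d) := \matrix_(i < k) (row (lift ord0 i) P - row ord0 P).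
Let G := A *m A^T.
Let p0 := row ord0 P.

(** A vector [x] with [x *m G = 0] makes the squared norm of [x *m A] vanish, and the rows of [A]
    are independent. *)
Lemma gram_unit : G \in unitmx.
Proof.
rewrite -row_free_unit -kermx_eq0 -submx0; apply/row_subP => i.
set x := row i _; have : x *m G = 0 by rewrite /x -row_mul mulmx_ker row0.
move=> xG; have xA : x *m A = 0.
  have : (x *m A) *m (x *m A)^T = 0 by rewrite trmx_mul -!mulmxA (mulmxA A) -/G mulmxA xG mul0mx.
  move=> /matrixP /(_ 0 0); rewrite !mxE => /eqP.
  rewrite psumr_eq0 => [/allP h|j _]; last by rewrite [_^T _ _]mxE -expr2 sqr_ge0.
  apply/rowP => j; have := h j; rewrite mem_index_enum => /(_ isT) /=.
  by rewrite [_^T _ _]mxE -expr2 sqrf_eq0 => /eqP ->; rewrite mxE.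
by have := row_free_inj indep (etrans xA (esym (mul0mx _ A))) => ->; rewrite sub0mx.
Qed.

(** The Moore-Penrose pseudo-inverse of [A]: it recovers coordinates in the row space and projects
    other vectors onto it. *)
Definition coords (z : 'rV[R]_d) : 'rV[R]_k := z *m A^T *m invmx G.

Lemma coordsK (y : 'rV[R]_k) : coords (y *m A) = y.
Proof. by rewrite /coords -(mulmxA y A) -/G -mulmxA mulmxV ?gram_unit // mulmx1. Qed.

Lemma simplexP x : in_simplex P x <-> exists y : 'rV[R]_k,
  [/\ forall j, 0 <= y 0 j, \sum_j y 0 j <= 1 & x = p0 + y *m A].
Proof.
have comb (w : 'rV[R]_k.+1) : w *m P = w 0 ord0 *: p0 + \sum_j w 0 (lift ord0 j) *: row (lift ord0 j) P.
  apply/rowP => i; rewrite !mxE summxE big_ord_recl; congr (_ + _).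
  by apply: eq_bigr => j _; rewrite !mxE.
have yA (y : 'rV[R]_k) : y *m A = \sum_j y 0 j *: row (lift ord0 j) P - (\sum_j y 0 j) *: p0.
  apply/rowP => i; rewrite !mxE summxE mulr_suml -sumrB; apply: eq_bigr => j _.
  by rewrite !mxE; ring.
split=> [[w [w0 w1 ->]]|[y [y0 y1 ->]]].
  exists (\row_j w 0 (lift ord0 j)); split.
  - by move=> j; rewrite mxE.
  - by under eq_bigr do rewrite mxE; rewrite -w1 big_ord_recl lerDr.
  - set y := \row_j _; have ye j : y 0 j = w 0 (lift ord0 j) by rewrite mxE.
    rewrite yA (eq_bigr (fun j => w 0 (lift ord0 j) *: row (lift ord0 j) P)); last first.
      by move=> j _; rewrite ye.
    rewrite [\sum_j y 0 j](eq_bigr (fun j => w 0 (lift ord0 j))) => [|j _]; last by rewrite ye.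
    rewrite comb.
    have -> : \sum_j w 0 (lift ord0 j) = 1 - w 0 ord0 by rewrite -w1 big_ord_recl addrAC subrr add0r.
    by rewrite scalerBl scale1r; apply/rowP => i; rewrite !mxE; ring.
exists (\row_i (if unlift ord0 i is Some j then y 0 j else 1 - \sum_j y 0 j)); split.
- by move=> i; rewrite mxE; case: unliftP => [j _|_] //; rewrite subr_ge0.
- rewrite big_ord_recl mxE unlift_none [X in _ + X](eq_bigr (fun j => y 0 j)) ?subrK //.
  by move=> j _; rewrite mxE liftK.
- rewrite comb yA mxE unlift_none; rewrite [X in _ = _ + X](eq_bigr (fun j => y 0 j *: row (lift ord0 j) P)); last first.
    by move=> j _; rewrite mxE liftK.
  by rewrite scalerBl scale1r; apply/rowP => i; rewrite !mxE; ring.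
Qed.

Let p j := coords (mu - p0) 0 j.
Let q j := coords nu 0 j.
Let cv : seq (R * R) := rcons [seq (p j, q j) | j <- enum 'I_k]
   (1 - \sum_j p j, 0 - \sum_j q j).
Let res := coords nu *m A = nu.
Hypothesis mu_in : in_simplex P mu.

Lemma mu_coords : [/\ forall j, 0 <= p j, \sum_j p j <= 1 & mu = p0 + coords (mu - p0) *m A].
Proof.
have /simplexP[y [h1 h2 h3]] := mu_in.
have e : coords (mu - p0) = y by rewrite h3 addrAC subrr add0r coordsK.
by rewrite /p e.
Qed.

Lemma cv_ge0 c : c \in cv -> 0 <= c.1.
Proof.
have [h1 h2 _] := mu_coords.
rewrite mem_rcons inE => /orP[/eqP->/=|/mapP[j _ ->] //=]; by rewrite subr_ge0.
Qed.

Lemma simplex_ray l : 0 < l -> in_simplex P (mu + l *: nu) <->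
  res /\ forall c, c \in cv -> 0 <= c.1 + l * c.2.
Proof.
move=> l0; have [h1 h2 h3] := mu_coords; split=> [/simplexP[y [y0 y1 ye]]|[r hc]].
  have e : nu = (l^-1 *: (y - coords (mu - p0))) *m A.
    rewrite -scalemxAl mulmxBl; have -> : y *m A = mu + l *: nu - p0 by rewrite ye addrAC subrr add0r.
    have -> : coords (mu - p0) *m A = mu - p0 by rewrite {2}h3 addrAC subrr add0r.
    have -> : mu + l *: nu - p0 - (mu - p0) = l *: nu by apply/rowP => i; rewrite !mxE; ring.
    by rewrite scalerA mulVf ?scale1r // gt_eqF.
  have ec : coords nu = l^-1 *: (y - coords (mu - p0)) by rewrite {1}e coordsK.
  split; first by rewrite /res ec -e.
  have qE j : p j + l * q j = y 0 j.
    by rewrite /q ec /p; move: (coords (mu - p0)) => cm; rewrite !mxE; field; rewrite gt_eqF.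
  move=> c; rewrite mem_rcons inE => /orP[/eqP->/=|/mapP[j _ ->] /=]; last by rewrite qE.
  have -> : 1 - \sum_j p j + l * (0 - \sum_j q j) = 1 - \sum_j (p j + l * q j).
    by rewrite big_split /= -mulr_sumr; ring.
  by under eq_bigr do rewrite qE; rewrite subr_ge0.
have cE j : (coords (mu - p0) + l *: coords nu) 0 j = p j + l * q j.
  by rewrite /p /q; move: (coords _) (coords _) => c1 c2; rewrite !mxE.
apply/simplexP; exists (coords (mu - p0) + l *: coords nu); split.
- move=> j; rewrite cE; apply: (hc (p j, q j)).
  by rewrite mem_rcons inE map_f ?orbT // mem_enum.
- have := hc (1 - \sum_j p j, 0 - \sum_j q j); rewrite mem_rcons mem_head => /(_ isT) /= hh.
  rewrite (eq_bigr (fun j => p j + l * q j)) => [|j _]; last exact: cE.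
  by rewrite big_split /= -mulr_sumr; lra.
- by rewrite mulmxDl -scalemxAl r addrA -h3.
Qed.

(** A simplex is bounded: if no coordinate decreases along a parallel direction, the coordinates of
    the direction are nonnegative with sum at most [0], so the direction is [0]. *)
Lemma ray_correct (w : nat) (lam : R) :
  [/\ w = 1%N, 0 < lam, res, forall c, c \in cv -> c.2 < 0 -> lam * - c.2 <= c.1
   & exists2 c, c \in cv & c.2 < 0 /\ lam * - c.2 = c.1] \/
  (w = 0%N /\ [\/ forall c, c \in cv -> 0 <= c.2, ~ res
     | exists2 c, c \in cv & c.2 < 0 /\ c.1 <= 0]) ->
  [/\ w = 1%N, 0 < lam & forall l, 0 < l -> (in_simplex P (mu + l *: nu) <-> l <= lam)] \/
  (w = 0%N /\ (nu = 0 \/ forall l, 0 < l -> ~ in_simplex P (mu + l *: nu))).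
Proof.
case=> [[w1 l0 r hl [c cc [c2 ce]]]|[w0 H]]; [left|right]; split=> //.
  move=> l lp; rewrite simplex_ray //; split=> [[_ h]|le].
    have c2' : 0 < - c.2 by lra.
    by rewrite -(ler_pM2r c2') ce; have := h c cc; lra.
  split=> // c' cc'; have := cv_ge0 cc'.
  have [lt|ge] := ltP c'.2 0; last by move=> h; rewrite addr_ge0 // mulr_ge0 // ltW.
  have := hl c' cc' lt; have : l * - c'.2 <= lam * - c'.2 by rewrite ler_pM2r; lra.
  lra.
case: H => [h|nr|[c cc [c2 c1]]].
- have [r|nr] := pselect res; last by right=> l lp /(simplex_ray lp)[].
  left; have q0 j : 0 <= q j.
    by apply: (h (p j, q j)); rewrite mem_rcons inE map_f ?orbT // mem_enum.
  have := h (1 - \sum_j p j, 0 - \sum_j q j); rewrite mem_rcons mem_head => /(_ isT) /= qs.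
  have s0 : \sum_j q j = 0.
    by apply/eqP; rewrite eq_le sumr_ge0 // andbT; lra.
  have qz : coords nu = 0.
    apply/rowP => j; rewrite [RHS]mxE; move/eqP: s0; rewrite psumr_eq0 // => /allP /(_ j).
    by rewrite mem_index_enum => /(_ isT) /eqP.
  by rewrite -r qz mul0mx.
- by right=> l lp /(simplex_ray lp)[].
- right=> l lp /(simplex_ray lp)[_ hc]; have := hc c cc.
  have : l * c.2 < 0 by rewrite pmulr_rlt0.
  lra.
Qed.

Lemma coordsE z j : coords z 0 j =
  (\sum_i (\sum_l z 0 l * A i l) * (\adj G) i j) / \det G.
Proof.
rewrite /coords /invmx gram_unit -scalemxAr mxE mulrC mxE; congr (_ / _).
by apply: eq_bigr => i _; rewrite !mxE; congr (_ * _); apply: eq_bigr => l _; rewrite !mxE.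
Qed.
End Simplex.

(** * Composing success probabilities *)

Section Scale.
Variables (R : realType) (W TB : nat).
Notation P := (@prob_halts_within R W).

Lemma prob_cat (x : R) T Q Q' k t p s : 0 <= x ->
  (forall s0, x * (`[< Q s0 >])%:R <= P T Q' k s0) ->
  x * P t Q p s <= P (t + T) Q' (p ++ k) s.
Proof.
move=> x0 H; elim: t p s => [|t IH] [|c p] s.
- by rewrite [P 0 Q _ _]/= add0n; exact: H.
- by rewrite [P 0 Q _ _]/=; case: c => *; rewrite mulr0; exact: prob_ge0.
- rewrite [P _ Q _ _]/=; apply: le_trans (H s) _.
  by apply: prob_le; rewrite leq_addl.
have [k1 [ss [e1 e2]]] : exists k1 ss, step W (c :: p) s = Some (k1, ss) /\
    step W ((c :: p) ++ k) s = Some (k1 ++ k, ss).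
  case: c => [i|b p1 p2|b p1] /=; eexists; eexists; split; try reflexivity.
    by rewrite catA.
  by case: ifP => // _; rewrite -catA.
have PS u Q1 p1 : P u.+1 Q1 p1 s = match step W p1 s with None => (`[< Q1 s >])%:R
  | Some (k', s') => (\sum_(z <- s') P u Q1 k' z) / (size s')%:R end by [].
rewrite addSn !PS e1 e2 mulrA mulr_sumr ler_wpM2r ?invr_ge0 ?ler0n //.
by apply: ler_sum => z _; exact: IH.
Qed.

(** A bound on the success of [c] alone becomes one for [c] followed by a continuation worth [x]; in
    this form the success probabilities of the two phases multiply. *)
Lemma hoare_scale t c s (v x : R) Post : 0 <= x ->
  hoare W TB t c s v (fun s' => if `[< Post s' >] then 1 else 0) ->
  hoare W TB t c s (x * v) (fun s' => if `[< Post s' >] then x else 0).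
Proof.
move=> x0 H k T Q Hk s0 sm.
pose Q0 z := exists s', [/\ frame c s s', sim W TB s' z & Post s'].
have Hv : v <= P t Q0 (compile TB c) s0.
  have := H [::] 0%N Q0 _ s0 sm; rewrite cats0 addn0; apply.
  move=> s' z F S; rewrite [P _ _ _ _]/=; case: asboolP => [po|_]; last by rewrite ler0n.
  by rewrite asboolT //; exists s'.
apply: (@le_trans _ _ (x * P t Q0 (compile TB c) s0)); first by rewrite ler_wpM2l.
apply: prob_cat => // z; case: asboolP => [[s' [F S po]]|_]; last by rewrite mulr0 prob_ge0.
by rewrite mulr1; have := Hk s' z F S; rewrite asboolT.
Qed.
End Scale.

(** * The layout of the input in memory *)

Section Nth.
Variables (T : Type) (x0 : T).

Lemma nth_flatten_uniform q ss i j : all (fun s : seq T => size s == q) ss -> (j < q)%N ->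
  nth x0 (flatten ss) (i * q + j) = nth x0 (nth [::] ss i) j.
Proof.
elim: ss i => [|s ss IH] i /=; first by move=> _ _; rewrite !nth_nil.
move=> /andP[/eqP sz al] lj; rewrite nth_cat sz; case: i => [|i] /=; first by rewrite mul0n lj.
by rewrite mulSn -addnA ltnNge leq_addr /= addKn; exact: IH.
Qed.

Lemma size_flatten_uniform q (ss : seq (seq T)) : all (fun s => size s == q) ss ->
  size (flatten ss) = (size ss * q)%N.
Proof. by elim: ss => [|s ss IH] //= /andP[/eqP sz al]; rewrite size_cat sz IH. Qed.

Lemma nth_ord_map p (g : 'I_p -> T) (i : 'I_p) : nth x0 [seq g u | u <- enum 'I_p] i = g i.
Proof. by rewrite (nth_map i) ?size_enum_ord // nth_ord_enum. Qed.

Lemma size_ord_map p (g : 'I_p -> T) : size [seq g u | u <- enum 'I_p] = p.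
Proof. by rewrite size_map size_enum_ord. Qed.

Lemma nth_skip q (s1 s2 : seq T) i : size s1 = q -> nth x0 (s1 ++ s2) (q + i) = nth x0 s2 i.
Proof. by move=> <-; rewrite nth_cat ltnNge leq_addr /= addKn. Qed.

Lemma nth_ord_allpairs p q (f : 'I_p -> 'I_q -> T) (i : 'I_p) (j : 'I_q) :
  nth x0 [seq f u v | u <- enum 'I_p, v <- enum 'I_q] (i * q + j) = f i j.
Proof.
rewrite nth_flatten_uniform //; last first.
  by rewrite all_map; apply/allP => u _ /=; rewrite size_map size_enum_ord.
by rewrite (nth_map i) ?size_enum_ord // nth_ord_enum nth_ord_map.
Qed.
End Nth.

Lemma index_lt p q i j : (i < p)%N -> (j < q)%N -> (i * q + j < p * q)%N.
Proof.
move=> li lj; apply: (@leq_trans (i.+1 * q)); first by rewrite mulSn addnC ltn_add2r.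
by rewrite leq_mul2r li orbT.
Qed.

Section Input.
Variables (R : realType) (d n : nat) (I : instance R d n).
Notation k := (sdim I).
Notation rm := (rmem (initial_state I)).

Lemma mem_start (i : 'I_d) : rm i = start I 0 i.
Proof. by rewrite /= /input_reals nth_cat size_map size_enum_ord ltn_ord nth_ord_map. Qed.

Lemma mem_direction (i : 'I_d) : rm (d + i) = (direction I 0 i)%:~R.
Proof.
rewrite /= /input_reals nth_cat size_map size_enum_ord ltnNge leq_addr /= addKn.
by rewrite nth_cat size_map size_enum_ord ltn_ord nth_ord_map.
Qed.

Lemma mem_vertex (j : 'I_k.+1) (i : 'I_d) : rm (d + d + (j * d + i)) = vertices I j i.
Proof.
rewrite /= /input_reals -addnA nth_cat size_map size_enum_ord ltnNge leq_addr /= addKn.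
rewrite nth_cat size_map size_enum_ord ltnNge leq_addr /= addKn.
by rewrite nth_cat size_allpairs !size_enum_ord index_lt // nth_ord_allpairs.
Qed.

Let cost_rows : all (fun s => size s == n * n)%N [seq
    [seq if [set u; v] \in edges I then (cost I i [set u; v])%:~R else 0 : R
       | u <- enum 'I_n, v <- enum 'I_n] | i <- enum 'I_d.+1].
Proof. by rewrite all_map; apply/allP => i _ /=; rewrite size_allpairs !size_enum_ord. Qed.

Lemma mem_cost (i : 'I_d.+1) (u v : 'I_n) :
  rm (d + d + k.+1 * d + i * (n * n) + (u * n + v)) =
  if [set u; v] \in edges I then (cost I i [set u; v])%:~R else 0.
Proof.
rewrite -[LHS]/(nth 0 (input_reals I) _) /input_reals.
rewrite -(addnA _ (i * (n * n))%N) -(addnA _ (k.+1 * d)%N) -(addnA d d).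
rewrite (@nth_skip R 0 d) ?size_ord_map // (@nth_skip R 0 d) ?size_ord_map //.
rewrite (@nth_skip R 0 (k.+1 * d)) ?size_allpairs ?size_enum_ord //.
rewrite nth_flatten_uniform ?index_lt // (nth_map i) ?size_enum_ord // nth_ord_enum.
by rewrite nth_ord_allpairs.
Qed.

(** The Laplacians are accumulated in place, which relies on zeros behind the input. *)
Lemma mem_out q : (d + d + k.+1 * d + d.+1 * (n * n) <= q)%N -> rm q = 0.
Proof.
move=> h; rewrite -[LHS]/(nth 0 (input_reals I) _) nth_default // /input_reals 3!size_cat.
by rewrite (size_flatten_uniform cost_rows) !size_ord_map size_allpairs !size_enum_ord; move: h; lia.
Qed.
End Input.

Lemma sum_pairs (R : realType) m n (G : nat -> R) :
  \sum_(0 <= p < m * n) G p = \sum_(u < m) \sum_(v < n) G (u * n + v)%N.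
Proof.
elim: m => [|m IH]; first by rewrite mul0n big_geq // big_ord0.
rewrite big_ord_recr /= -IH mulSn addnC (@big_cat_nat _ _ _ (m * n)) ?leq_addr //=.
congr (_ + _); rewrite -{1}[(m * n)%N]add0n big_addn addKn big_mkord.
by apply: eq_bigr => v _; rewrite addnC.
Qed.

(** The index [p] encodes an ordered pair by quotient and remainder. Each pair adds its weight on
    the diagonal and subtracts it at its own position, so that loops cancel. *)
Lemma laplacian_sum (R : realType) n (g : 'I_n -> 'I_n -> R) (G : nat -> R) (x y : 'I_n) :
  (forall u v : 'I_n, G (u * n + v)%N = g u v) ->
  \sum_(0 <= p < n * n) (((x == (p %/ n)%N :> nat) && (y == (p %/ n)%N :> nat))%:R -
     ((x == (p %/ n)%N :> nat) && (y == (p %% n)%N :> nat))%:R) * G p = laplacian g x y.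
Proof.
move=> h; have n0 : (0 < n)%N by apply: leq_ltn_trans (ltn_ord x).
rewrite sum_pairs.
under eq_bigr => u _ do under eq_bigr => v _ do
  rewrite divnMDl // divn_small // addn0 modnMDl modn_small // h.
have ne_nat (z w : 'I_n) : w != z -> (z == w :> nat) = false.
  by move=> ne; apply/negbTE; rewrite -[_ == _]/(val z == val w) val_eqE eq_sym.
rewrite (bigD1 x) //= [X in _ + X]big1 ?addr0; last first.
  by move=> u ne; apply: big1 => v _; rewrite ne_nat // subrr mul0r.
rewrite /laplacian; under eq_bigr do rewrite eqxx /= mulrBl.
have -> : (x == y) = (y == x :> nat) by rewrite eq_sym -val_eqE.
rewrite sumrB; congr (_ - _).
  by case: (_ == _); [apply: eq_bigr => v _; rewrite mul1r|rewrite big1 // => v _; rewrite mul0r].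
rewrite (bigD1 y) //= eqxx mul1r big1 ?addr0 // => v ne.
by rewrite ne_nat // mul0r.
Qed.

(** * Initial registers and the Laplacians of the input *)

Definition setup_regs d : hcmd :=
  HSetW 1 (WMem (WNum 0)) ;; HSetW 21 (WMem (WNum 1)) ;;
  HSetW 23 (WNum (d + d) [+] WVar 21 [*] WNum d) ;;
  HSetW 2 (WVar 23 [+] WNum d.+1 [*] (WVar 1 [*] WVar 1)) ;;
  HSetW 3 ((WVar 1 [*] WVar 1) [*] (WVar 1 [*] WVar 1)) ;;
  HSetW 4 (WNum 1) ;; HSetW 5 (WNum 2).

(** There is no logarithm instruction; doubling is tried [n] times and stops having an effect at the
    first [K >= 1] with [n <= 2 ^ K + 1]. *)
Definition setup_log : hcmd :=
  HFor 15 16 (WVar 1) (HIf (LtW (WVar 5 [+] WNum 1) (WVar 1))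
    (HSetW 5 (WVar 5 [*] WNum 2) ;; HSetW 4 (WVar 4 [+] WNum 1)) HSkip).

Definition costE (i : nat) : rexpr :=
  RMem (WVar 23 [+] WNum i [*] (WVar 1 [*] WVar 1) [+] WVar 15).
Definition alphaE d : rexpr :=
  costE 0 [+r] rsum [seq muE i [*r] costE i.+1 | i : 'I_d <- enum 'I_d].
Definition betaE d : rexpr := rsum [seq nuE i [*r] costE i.+1 | i : 'I_d <- enum 'I_d].

Definition rowE : wexpr := WVar 15 [/] WVar 1.
Definition colE : wexpr := WVar 15 [%] WVar 1.

Definition add_entry (t : nat) (e : rexpr) : hcmd :=
  HSetR 10 e ;;
  HStore (adrE t (WVar 4) rowE colE) (RMem (adrE t (WVar 4) rowE colE) [-r] RVar 10) ;;
  HStore (adrE t (WVar 4) rowE rowE) (RMem (adrE t (WVar 4) rowE rowE) [+r] RVar 10).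

Definition build d : hcmd :=
  HFor 15 16 (WVar 1 [*] WVar 1) (add_entry 0 (alphaE d) ;; add_entry 1 (betaE d)).

Section Setup.
Variables (R : realType) (W d n k : nat).
Notation TB := (40 + d)%N.
Notation st := (state R).
Implicit Types (s : st).
Notation surely := (@surely R W TB).
Notation X := (n * n)%N.
Notation D0 := (d + d + k.+1 * d)%N.
Notation B0 := (D0 + d.+1 * X)%N.
Hypothesis n_gt1 : (1 < n)%N.
Hypothesis kd : (k <= d)%N.
Hypothesis WX : (X * X < W)%N.
Hypothesis WB : (B0 + 4 * d + 4 < W)%N.
Hypothesis Wn : (n * 2 + 2 < W)%N.

Lemma setup_regs_ok s : wmem s 0 = n -> wmem s 1 = k.+1 ->
  surely (hcost TB (setup_regs d)) (setup_regs d) s (fun s' =>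
    [/\ env n B0 1 (X * X) s', wreg s' 5 = 2, wreg s' 21 = k.+1 & wreg s' 23 = D0]).
Proof.
move=> m0 m1.
have X1 : (0 < X)%N by rewrite muln_gt0 (ltnW n_gt1).
have hX : (X < W)%N by apply: leq_ltn_trans WX; rewrite leq_pmulr.
have hn : (n < W)%N by lia.
have hk : (k.+1 < W)%N by lia.
have hd : (d < W)%N by lia.
have hdd : (d + d < W)%N by lia.
have hkd : (k.+1 * d < W)%N by lia.
have hD : (D0 < W)%N by lia.
have hdX : (d.+1 * X < W)%N by lia.
have hB : (B0 < W)%N by lia.
have hdS : (d.+1 < W)%N by lia.
have [w0 [w1 w2]] : (0 < W)%N /\ (1 < W)%N /\ (2 < W)%N by lia.
apply: surely_setw_seq => //; first by rewrite /= w0 m0 hn.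
apply: surely_setw_seq => //; first by rewrite /= w1 m1 hk.
apply: surely_setw_seq => //; first by rewrite /= m1 hdd hd hkd hD.
apply: surely_setw_seq => //; first by rewrite /= m1 m0 hdS hX hdX hB.
apply: surely_setw_seq => //; first by rewrite /= m0 hX WX.
apply: surely_setw_seq => //.
apply: surely_setw => //.
by split=> //; rewrite /= ?m0 ?m1.
Qed.

Lemma setup_log_ok s m : env n B0 1 m s -> wreg s 5 = 2 ->
  surely (n.+1 * hcost TB setup_log) setup_log s (fun s' => exists K,
    [/\ (0 < K)%N, (n <= (2 ^ K).+1)%N, (2 ^ K <= 2 * n)%N & env n B0 K m s' /\ wreg s' 5 = (2 ^ K)%N]).
Proof.
move=> Es e5; have [E1 E2 E3 E4] := Es.
(* As long as doubling goes on, [K] exceeds the number of iterations; after [n] of them [K < 2 ^ K]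
   yields the first alternative anyway. *)
pose Inv x s' := exists K, [/\ (0 < K)%N, wreg s' 4 = K, wreg s' 5 = (2 ^ K)%N, (2 ^ K <= 2 * n)%N
   & (n <= (2 ^ K).+1)%N \/ (x < K)%N].
have H : surely (n.+1 * hcost TB setup_log) setup_log s (Inv n); last first.
  apply: surely_le H (leqnn _) _ => s' [fw _ _ _] _ [K [K0 r4 r5 le H]]; exists K.
  have KK : (K < 2 ^ K)%N by rewrite ltn_expl.
  split=> //; first by case: H; lia.
  by split=> //; split=> //; rewrite fw.
apply: surely_forN => //.
- by exists 1%N; split=> //=; [lia|right].
- move=> x s' lx [fw _ _ _] _ _ _ [K [K0 r4 r5 le H]].
  have r1 : wreg s' 1 = n by rewrite fw.
  have KK : (K < 2 ^ K)%N by rewrite ltn_expl.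
  have e2 : (2 ^ K.+1 = 2 ^ K * 2)%N by rewrite expnS mulnC.
  apply: surely_if.
  + by rewrite /= r5; lia.
  + rewrite /= r5 r1 addn1 => lt.
    apply: surely_setw_seq => //; first by rewrite /= r5; lia.
    apply: surely_setw => //; first by rewrite /= r4; lia.
    by exists K.+1; split=> //=; rewrite ?r4 ?r5 ?addn1 ?e2 //; [lia|right; lia].
  + rewrite /= r5 r1 addn1 -leqNgt => ge; apply: surely_skip.
    by exists K; split=> //=; left.
Qed.

Variables (K m : nat).
Hypothesis HW : (B0 + K.+1 * X * 2 < W)%N.
Notation env := (env n B0 K m).
Notation adr := (adr n B0).

Lemma level_adr_ok s t x y xv yv : (t < 2)%N -> env s -> wsafe W TB s x -> weval s x = xv ->
  wsafe W TB s y -> weval s y = yv -> (xv < n)%N -> (yv < n)%N ->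
  wsafe W TB s (adrE t (WVar 4) x y) /\ weval s (adrE t (WVar 4) x y) = adr t K xv yv.
Proof.
move=> t2 [e1 e2 e3 e4] wx ex wy ey lx ly.
have H : (B0 + (((K * n + xv) * n + yv) * 2 + t) < W)%N :=
  @adr_lt W n B0 K n_gt1 HW t K xv yv t2 lx ly (leqnn K).
split; last by rewrite /= ex ey e1 e2 e4.
have l1 : (K * n + xv <= (K * n + xv) * n)%N by rewrite leq_pmulr // ltnW.
rewrite /= wx wy ex ey e1 e2 e4 /=.
move: l1 H; set c := ((K * n + xv) * n)%N; set aa := (K * n)%N => l1 H.
by do ?[apply/andP; split]; lia.
Qed.

Lemma add_entry_ok s t e p g : (t < 2)%N -> env s -> wreg s 15 = p -> (p < X)%N ->
  rsafe W TB s e -> reval s e = g ->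
  surely (hcost TB (add_entry t e)) (add_entry t e) s (fun s' => forall h, rmem s' h = rmem s h +
    ((h == adr t K (p %/ n) (p %/ n))%:R - (h == adr t K (p %/ n) (p %% n))%:R) * g).
Proof.
move=> t2 Es e15 lp se ee.
have pW : (p < W)%N by apply: ltn_trans lp _; apply: leq_ltn_trans WX; rewrite leq_pmulr // muln_gt0 (ltnW n_gt1).
have lu : (p %/ n < n)%N by rewrite ltn_divLR // ltnW.
have lv : (p %% n < n)%N by rewrite ltn_pmod // ltnW.
have rc s' : env s' -> wreg s' 15 = p ->
   [/\ wsafe W TB s' rowE, weval s' rowE = (p %/ n)%N, wsafe W TB s' colE & weval s' colE = (p %% n)%N].
  case=> r1 _ _ _ r15; rewrite /= r1 r15; split=> //.
    by apply: leq_ltn_trans pW; exact: leq_div.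
  by apply: leq_ltn_trans pW; exact: leq_mod.
pose s1 := set_rreg s 10 g.
have [a1 a2 a3 a4] := rc s1 Es e15.
have [w1 v1] := level_adr_ok t2 (Es : env s1) a1 a2 a3 a4 lu lv.
pose s2 := set_rmem s1 (adr t K (p %/ n) (p %% n)) (rmem s (adr t K (p %/ n) (p %% n)) - g).
have [b1 b2 _ _] := rc s2 Es e15.
have [w2 v2] := level_adr_ok t2 (Es : env s2) b1 b2 b1 b2 lu lu.
apply: surely_setr_seq => //; rewrite ee -/s1.
apply: surely_store_seq => //.
  by rewrite -[rsafe _ _ _ _]/(wsafe W TB s1 (adrE t (WVar 4) rowE colE) && true) w1.
rewrite -[reval _ _]/(rmem s1 (weval s1 (adrE t (WVar 4) rowE colE)) - g) v1 -/s2.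
apply: surely_store => //.
  by rewrite -[rsafe _ _ _ _]/(wsafe W TB s2 (adrE t (WVar 4) rowE rowE) && true) w2.
rewrite -[reval _ _]/(rmem s2 (weval s2 (adrE t (WVar 4) rowE rowE)) + g) v2 => h.
rewrite /s2 /=; set uu := adr _ _ _ (p %/ n); set uv := adr _ _ _ (p %% n).
have [->|n1] := eqVneq h uu.
  by have [->|n2] := eqVneq uu uv; rewrite /=; ring.
by have [->|n2] := eqVneq h uv; rewrite /=; ring.
Qed.

Lemma rsafe_rsum s (T : Type) (l : seq T) (F : T -> rexpr) : (0 < W)%N ->
  (forall i, rsafe W TB s (F i)) -> rsafe W TB s (rsum [seq F i | i <- l]).
Proof. by move=> w0 h; elim: l => [|i l IH] /=; rewrite ?h. Qed.

Variable rm : nat -> R.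
Definition entry_a p : R := rm (D0 + 0 * X + p) + \sum_(i < d) rm i * rm (D0 + i.+1 * X + p).
Definition entry_b p : R := \sum_(i < d) rm (d + i) * rm (D0 + i.+1 * X + p).

Lemma entries_ok s p : env s -> wreg s 15 = p -> wreg s 23 = D0 -> (p < X)%N ->
  (forall h, (h < B0)%N -> rmem s h = rm h) ->
  [/\ rsafe W TB s (alphaE d), reval s (alphaE d) = entry_a p,
      rsafe W TB s (betaE d) & reval s (betaE d) = entry_b p].
Proof.
move=> [e1 e2 e3 e4] e15 e23 lp low.
have X1 : (0 < X)%N by rewrite muln_gt0 (ltnW n_gt1).
have hX : (X < W)%N by apply: leq_ltn_trans WX; rewrite leq_pmulr.
have iX i : (i <= d)%N -> (i * X + p < d.+1 * X)%N by move=> li; apply: index_lt.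
have cs i : (i <= d)%N -> rsafe W TB s (costE i).
  move=> /[dup] li /iX h; rewrite /= e1 e15 e23 hX /=.
  move: h (WB); set z := (i * X)%N; set z' := (d.+1 * X)%N => h WB'.
  have -> : (i < W)%N by lia.
  have -> : (z < W)%N by lia.
  have -> : (D0 + z < W)%N by lia.
  by rewrite /=; lia.
have ce i : (i <= d)%N -> reval s (costE i) = rm (D0 + i * X + p).
  by move=> /iX h; rewrite /= e1 e15 e23 low // -addnA ltn_add2l.
have w0 : (0 < W)%N by lia.
have sd (i : 'I_d) : (i < W)%N /\ (d + i < W)%N by have := ltn_ord i; lia.
split.
- rewrite -[rsafe _ _ _ _]/(rsafe W TB s (costE 0) && rsafe W TB s (rsum _)) cs //=.
  apply: rsafe_rsum => // i; rewrite -[rsafe _ _ _ _]/((i < W)%N && rsafe W TB s (costE i.+1)).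
  by rewrite cs // (sd i).1.
- rewrite -[reval _ _]/(reval s (costE 0) + reval s (rsum _)) ce // reval_rsum big_enum /=.
  congr (_ + _); apply: eq_bigr => i _.
  rewrite -[LHS]/(rmem s i * reval s (costE i.+1)) ce // low //; have := ltn_ord i; lia.
- apply: rsafe_rsum => // i; rewrite -[rsafe _ _ _ _]/((d + i < W)%N && rsafe W TB s (costE i.+1)).
  by rewrite cs // (sd i).2.
- rewrite reval_rsum big_enum /=; apply: eq_bigr => i _.
  rewrite -[LHS]/(rmem s (d + i) * reval s (costE i.+1)) ce // low //; have := ltn_ord i; lia.
Qed.

Let Eh t h p : R := (h == adr t K (p %/ n) (p %/ n))%:R - (h == adr t K (p %/ n) (p %% n))%:R.

(** Costs are read below [B0] and stores go to [B0] and beyond, so the input stays available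
    throughout the accumulation. *)
Lemma build_sum_ok s : env s -> wreg s 23 = D0 -> rmem s = rm ->
  surely (X.+1 * hcost TB (build d)) (build d) s (fun s' => forall h, rmem s' h = rm h +
    (\sum_(0 <= p < X) Eh 0 h p * entry_a p + \sum_(0 <= p < X) Eh 1 h p * entry_b p)).
Proof.
move=> Es e23 em; have [E1 E2 E3 E4] := Es.
have X1 : (0 < X)%N by rewrite muln_gt0 (ltnW n_gt1).
have hX : (X < W)%N by apply: leq_ltn_trans WX; rewrite leq_pmulr.
have E0 t h p : (h < B0)%N -> Eh t h p = 0.
  move=> lh; rewrite /Eh; have ne x y : (h == adr t K x y) = false.
    by apply/negbTE; rewrite neq_ltn (leq_trans lh) ?leq_addr.
  by rewrite !ne subrr.
pose Inv q s' := forall h, rmem s' h = rm h +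
    (\sum_(0 <= p < q) Eh 0 h p * entry_a p + \sum_(0 <= p < q) Eh 1 h p * entry_b p).
apply: (@surely_forN R W TB 15 16 (WVar 1 [*] WVar 1) _ s X Inv) => //.
- by rewrite /= E1 hX.
- by rewrite /= E1.
- by move=> h /=; rewrite !big_geq // !addr0 em.
move=> p s' lp [fw _ _ _] _ e15 _ I0.
have Es' : env s' by split; rewrite fw.
have e23' : wreg s' 23 = D0 by rewrite fw.
have low h : (h < B0)%N -> rmem s' h = rm h.
  by move=> lh; rewrite I0 !big1 ?addr0 // => i _; rewrite E0 // mul0r.
have [sa ea _ _] := entries_ok Es' e15 e23' lp low.
apply: surely_seq (add_entry_ok (t := 0) isT Es' e15 lp sa ea) _ => s1 [fw1 _ _ _] _ H1.
have Es1 : env s1 by case: Es' => ? ? ? ?; split; rewrite fw1.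
have low1 h : (h < B0)%N -> rmem s1 h = rm h.
  by move=> lh; rewrite H1 -/(Eh 0 h p) E0 // mul0r addr0 low.
have e15' : wreg s1 15 = p by rewrite fw1.
have e23'' : wreg s1 23 = D0 by rewrite fw1.
have [_ _ sb eb] := entries_ok Es1 e15' e23'' lp low1.
apply: surely_le (add_entry_ok (t := 1) isT Es1 e15' lp sb eb) (leqnn _) _ => s2 _ _ H2 h /=.
by rewrite H2 H1 I0 !big_nat_recr //= -/(Eh 0 h p) -/(Eh 1 h p); ring.
Qed.

Lemma build_ok s (ga gb : 'I_n -> 'I_n -> R) : env s -> wreg s 23 = D0 -> rmem s = rm ->
  (forall h, (B0 <= h)%N -> rm h = 0) ->
  (forall u v : 'I_n, entry_a (u * n + v) = ga u v) ->
  (forall u v : 'I_n, entry_b (u * n + v) = gb u v) ->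
  surely (X.+1 * hcost TB (build d)) (build d) s (fun s' =>
    [/\ forall h, (h < B0)%N -> rmem s' h = rm h,
      represents (mat n B0 s' 0 K) ga val n & represents (mat n B0 s' 1 K) gb val n]).
Proof.
move=> Es e23 em out ha hb.
apply: surely_le (build_sum_ok Es e23 em) (leqnn _) _ => s' _ _ H.
have adr_eq t t' x y x' y' : (t < 2)%N -> (t' < 2)%N -> (x < n)%N -> (y < n)%N -> (x' < n)%N -> (y' < n)%N ->
   (adr t K x y == adr t' K x' y') = [&& t == t', x == x' & y == y'].
  move=> t2 t2' lx ly lx' ly'; apply/eqP/and3P => [e|[/eqP-> /eqP-> /eqP->] //].
  by have [-> _ -> ->] := adr_inj t2 t2' lx lx' ly ly' e.
have lu p : (p < X)%N -> (p %/ n < n)%N by rewrite ltn_divLR // ltnW.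
have lv p : (p %% n < n)%N by rewrite ltn_pmod // ltnW.
have fib (x : 'I_n) : fiber (val : 'I_n -> nat) x = [set x].
  by apply/setP => w; rewrite !inE -val_eqE.
have key t (t2 : (t < 2)%N) (x y : 'I_n) : rmem s' (adr t K x y) =
    laplacian (if t == 0%N then ga else gb) x y.
  rewrite H out ?add0r; last by rewrite leq_addr.
  have EE t' (G : nat -> R) : (t' < 2)%N -> \sum_(0 <= p < X) Eh t' (adr t K x y) p * G p =
    if t == t' then \sum_(0 <= p < n * n) (((x == (p %/ n)%N :> nat) && (y == (p %/ n)%N :> nat))%:R -
     ((x == (p %/ n)%N :> nat) && (y == (p %% n)%N :> nat))%:R) * G p else 0.
    move=> t2'; case: ifP => tt; last first.
      rewrite big_nat big1 // => p /andP[_ lp].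
      by rewrite /Eh !adr_eq ?lu ?lv // tt subrr mul0r.
    rewrite !big_nat; apply: eq_bigr => p /andP[_ lp].
    by rewrite /Eh !adr_eq ?lu ?lv // tt.
  rewrite !EE // (laplacian_sum _ _ ha) (laplacian_sum _ _ hb).
  by case: t t2 {EE} => [|[|]] //= _; rewrite ?addr0 ?add0r.
have rep t (t2 : (t < 2)%N) : represents (mat n B0 s' t K) (if t == 0%N then ga else gb) val n.
  move=> x y lx ly; rewrite /mat -[x]/(val (Ordinal lx)) -[y]/(val (Ordinal ly)) !fib /block.
  by rewrite !big_set1 key.
split; [|exact: (rep 0%N)|exact: (rep 1%N)].
move=> h lh; rewrite H !big1 ?addr0 // => p _; rewrite /Eh.
  all: have ne t x y : (h == adr t K x y) = false by
    apply/negbTE; rewrite neq_ltn (leq_trans lh) ?leq_addr.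
  all: by rewrite !ne subrr mul0r.
Qed.
End Setup.

(** * The complete algorithm and its success probability *)

Definition roundsE (A : nat) : wexpr :=
  WNum A [*] (WVar 4 [+] WNum 1) [*] (WVar 4 [+] WNum 1) [*] (WVar 5 [*] WVar 5).

(** The parameter is first saved in register [39 + d], because register 2 may be among the output
    registers [0, ..., d - 1]. *)
Definition report d : hcmd :=
  HIf (EqW (WVar 20) (WNum 1))
    (HSetR (39 + d) (RVar 2) ;;
     hseq [seq HSetR (i : 'I_d) (muE i [+r] RVar (39 + d) [*r] nuE i) | i <- enum 'I_d] ;;
     HSetW 0 (WNum 1)) HSkip.

Definition search d A : hcmd :=
  build d ;;
  (HSetR 0 (RMem (adrE 0 (WVar 4) (WNum 0) (WNum 0))) ;;
   HSetR 1 (RMem (adrE 1 (WVar 4) (WNum 0) (WNum 0)))) ;;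
  phase chk1 (roundsE A) ;;
  (HSetR 2 (RVar 12) ;; HSetW 20 (WNum 0)) ;;
  phase chk2 (roundsE A) ;;
  report d.

Definition algorithm d A : hcmd :=
  setup_regs d ;; setup_log ;; ray_upto d d.+1 ;;
  HIf (EqW (WVar 24) (WNum 1)) (search d A) HSkip.

Lemma written_ray_upto d K i : i != 24%N -> i \notin written_w (ray_upto d K).
Proof.
move=> ne; have hs T (f : T -> hcmd) cs : (forall c, i \notin written_w (f c)) ->
    i \notin written_w (hseq (map f cs)).
  by move=> h; elim: cs => //= c cs IH; rewrite mem_cat negb_or h.
elim: K => [//|K IH]; rewrite [written_w _]/= mem_cat negb_or IH andbT !mem_cat !negb_or.
rewrite !hs //= ?in_cons ?in_nil ?orbF ?ne //.
all: by move=> j /=; rewrite inE ne.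
Qed.

Section Correct.
Variables (R : realType) (d n : nat) (I : instance R d n).
Hypothesis adm : admissible I.
Hypothesis n_gt1 : (1 < n)%N.
Notation k := (sdim I).
Notation rm := (rmem (initial_state I)).
Notation TB := (40 + d)%N.
Notation st := (state R).
Implicit Types (s : st).
Notation mu := (start I).
Notation nu := (map_mx intr (direction I) : 'rV[R]_d).
Notation P := (vertices I).
Notation a := (cost_a (edges I) (cost I) mu).
Notation b := (cost_b (edges I) (cost I) nu).
Notation edge_matrix := (\matrix_(i < k) (row (lift ord0 i) P - row ord0 P)).

Lemma sdim_le : (k <= d)%N.
Proof. by have /eqP <- := adm_simplex adm; exact: rank_leq_col. Qed.

Lemma entry_aE (u v : 'I_n) : @entry_a R d n k rm (u * n + v) = a u v.
Proof.
rewrite /entry_a.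
have e0 : rm (d + d + k.+1 * d + 0 * (n * n) + (u * n + v)) = _ := mem_cost I ord0 u v.
have e1 (i : 'I_d) : rm (d + d + k.+1 * d + i.+1 * (n * n) + (u * n + v)) = _ :=
  mem_cost I (lift ord0 i) u v.
rewrite e0; under eq_bigr do rewrite e1 mem_start.
rewrite /cost_a /edge_cost; case: ifP => // _.
by rewrite big1 ?addr0 // => i _; rewrite mulr0.
Qed.

Lemma entry_bE (u v : 'I_n) : @entry_b R d n k rm (u * n + v) = b u v.
Proof.
rewrite /entry_b.
have e1 (i : 'I_d) : rm (d + d + k.+1 * d + i.+1 * (n * n) + (u * n + v)) = _ :=
  mem_cost I (lift ord0 i) u v.
under eq_bigr do rewrite e1 mem_direction.
rewrite /cost_b; case: ifP => _; last by rewrite big1 // => i _; rewrite mulr0.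
by apply: eq_bigr => i _; rewrite mxE.
Qed.

Lemma reval_edge s (i : 'I_k) l : rmem s = rm -> reval s (edgeE i l) = edge_matrix i l.
Proof.
move=> em; rewrite -[LHS]/(rmem s _ - rmem s _) em !mxE.
have e0 : rm (d + d + (0 * d + l)) = _ := mem_vertex ord0 l.
have e1 : rm (d + d + (i.+1 * d + l)) = _ := mem_vertex (lift ord0 i) l.
by rewrite e0 e1.
Qed.

Lemma reval_coord s xE (z : 'rV[R]_d) (j : 'I_k) : rmem s = rm ->
  (forall l, reval s (xE l) = z 0 l) -> reval s (coordE xE j) = coords P z 0 j.
Proof.
move=> em hx.
have gE : \matrix_(i, j) reval s (gramE d i j) = edge_matrix *m edge_matrix^T.
  apply/matrixP => i i'; rewrite mxE [RHS]mxE reval_rsum big_enum /=; apply: eq_bigr => l _.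
  rewrite -[LHS]/(reval s (edgeE i l) * reval s (edgeE i' l)) !reval_edge //.
  by rewrite [_^T _ _]mxE.
rewrite coordsE; last exact: adm_simplex adm.
rewrite -[LHS]/(reval s (rsum _) / reval s (detE _)) reval_det gE reval_rsum big_enum /=.
congr (_ / _); apply: eq_bigr => i _.
rewrite -[LHS]/(reval s (rsum _) * reval s (adjE _ _ _)) reval_adj gE reval_rsum big_enum /=.
congr (_ * _); apply: eq_bigr => l _.
by rewrite -[LHS]/(reval s (xE l) * reval s (edgeE i l)) reval_edge // hx.
Qed.

Variables (W : nat).
Notation surely := (@surely R W TB).
Notation hoare := (@hoare R W TB).
Notation X := (n * n)%N.
Notation D0 := (d + d + k.+1 * d)%N.
Notation B0 := (D0 + d.+1 * X)%N.
Hypothesis WX : (X * X < W)%N.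
Hypothesis WB : (B0 + d.+1 * d + 4 * d + 4 < W)%N.

Lemma ray_ok s : rmem s = rm -> wreg s 24 = 0%N -> wreg s 21 = k.+1 ->
  surely (hcost TB (ray_upto d d.+1)) (ray_upto d d.+1) s (fun s' => rmem s' = rm /\
   ([/\ wreg s' 24 = 1%N, 0 < rreg s' 12 &
       forall l, 0 < l -> (in_simplex P (mu + l *: nu) <-> l <= rreg s' 12)] \/
    (wreg s' 24 = 0%N /\ (nu = 0 \/ forall l, 0 < l -> ~ in_simplex P (mu + l *: nu))))).
Proof.
move=> em e24 e21; have kd := sdim_le.
have w1 : (1 < W)%N by lia.
have w2 : (d.+1 < W)%N by lia.
have w3 : (d + d + d.+1 * d < W)%N by lia.
apply: surely_le (@ray_upto_ok R W d w1 w2 w3 s k d.+1 kd (leqnn _) e24 e21) (leqnn _) _.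
move=> s' _ _ [em' H]; split; first by rewrite em'.
apply: ray_correct; [exact: adm_simplex adm|exact: adm_start adm|].
have pE j : reval s (startE d j) = coords P (mu - row ord0 P) 0 j.
  apply: reval_coord => // l; rewrite -[LHS]/(rmem s l - rmem s _) em mem_start !mxE.
  by have e0 : rm (d + d + (0 * d + l)) = _ := mem_vertex ord0 l; rewrite e0.
have qE j : reval s (dirE d j) = coords P nu 0 j.
  by apply: reval_coord => // l; rewrite -[LHS]/(rmem s _) em mem_direction mxE.
have cvE : [seq cval s pq | pq <- constraints d k] =
    rcons [seq (coords P (mu - row ord0 P) 0 j, coords P nu 0 j) | j <- enum 'I_k]
    (1 - \sum_j coords P (mu - row ord0 P) 0 j, 0 - \sum_j coords P nu 0 j).
  rewrite /constraints map_rcons -map_comp; congr rcons.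
    by apply: eq_map => j; rewrite -[LHS]/(reval s (startE d j), reval s (dirE d j)) pE qE.
  rewrite -[LHS]/(1 - reval s (rsum [seq startE d j | j <- enum 'I_k]),
    0 - reval s (rsum [seq dirE d j | j <- enum 'I_k])) !reval_rsum !big_enum /=.
  by rewrite (eq_bigr _ (fun j _ => pE j)) (eq_bigr _ (fun j _ => qE j)).
have rE : res_ok d k s = (coords P nu *m edge_matrix = nu).
  have h (i : 'I_d) : reval s (rsum [seq dirE d j [*r] edgeE j i | j : 'I_k <- enum 'I_k]) =
      (coords P nu *m edge_matrix) 0 i.
    rewrite reval_rsum big_enum mxE /=; apply: eq_bigr => j _.
    by rewrite -[LHS]/(reval s (dirE d j) * reval s (edgeE j i)) qE reval_edge.
  have h' (i : 'I_d) : reval s (nuE i) = nu 0 i.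
    by rewrite -[LHS]/(rmem s _) em mem_direction mxE.
  apply/propext; split=> [r|r i]; last by rewrite h h' r.
  by apply/rowP => i; rewrite -h -h' r.
by rewrite /ray_post cvE rE in H.
Qed.

Lemma report_ok s : (forall h, (h < d + d)%N -> rmem s h = rm h) ->
  surely (hcost TB (report d)) (report d) s (fun s' =>
   [/\ wreg s 20 = 1%N, wreg s' 0 = 1%N & forall i : 'I_d, rreg s' i = (mu + rreg s 2 *: nu) 0 i] \/
   (wreg s 20 <> 1%N /\ wreg s' 0 = wreg s 0)).
Proof.
move=> low; have w1 : (1 < W)%N by lia.
apply: surely_if; first by rewrite /= w1.
  rewrite -[teval _ _]/(wreg s 20 == 1%N) => /eqP e20.
  apply: surely_setr_seq; [by rewrite ltn_add2r|by []|].
  pose s1 := set_rreg s (39 + d) (rreg s 2).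
  pose Inv (l : seq 'I_d) s' := rreg s' (39 + d) = rreg s 2 /\
    forall i : 'I_d, i \in l -> rreg s' i = (mu + rreg s 2 *: nu) 0 i.
  apply: (surely_seq (P1 := Inv (enum 'I_d))).
    have nst (i : 'I_d) : ~~ stores (HSetR i (muE i [+r] RVar (39 + d) [*r] nuE i)) by [].
    have := @hseq_ok R W d 'I_d (fun i => HSetR i (muE i [+r] RVar (39 + d) [*r] nuE i))
      xpredT Inv (enum 'I_d) [::] s1 nst (all_predT _); rewrite cat0s; apply; last first.
      by split; rewrite //= eqxx.
    move=> l i s' _ em [h1 h2]; have li := ltn_ord i.
    apply: surely_setr => //.
    - by apply: leq_trans li _; rewrite leq_addl.
    - by rewrite /=; do ?[apply/andP; split]; lia.
    split; first by rewrite /= gtn_eqF //; lia.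
    move=> i'; rewrite mem_rcons inE /= => /orP[/eqP->|il].
      rewrite eqxx em h1 /s1 /= !low ?mem_start ?mem_direction ?mxE //; lia.
    case: eqP => [e|_]; last exact: h2.
    have -> : i' = i by apply: val_inj.
    rewrite em h1 /s1 /= !low ?mem_start ?mem_direction ?mxE //; lia.
  move=> s2 _ _ [_ h]; apply: surely_setw => //; left; split=> // i.
  by apply: h; rewrite mem_enum.
rewrite -[teval _ _]/(wreg s 20 == 1%N) => /eqP e20.
by apply: surely_skip; right.
Qed.

Variable A : nat.
Hypothesis A_gt0 : (0 < A)%N.
Hypothesis WA : (16 * A * (X * X) < W)%N.
Hypothesis WK : (B0 + 4 * (X * X) + d.+1 * d + 4 * d + 4 < W)%N.
Notation fail := (n%:R ^- A : R).
Notation q := (1 - fail).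

Let X1 : (0 < X)%N.
Proof. by rewrite muln_gt0 (ltnW n_gt1). Qed.

Let nXX : (n <= X * X)%N.
Proof. by apply: (@leq_trans X); rewrite leq_pmulr // ltnW. Qed.

Lemma fail_bounds : 0 <= fail <= 1.
Proof.
rewrite invr_ge0 exprn_ge0 ?ler0n //= invf_le1 ?exprn_gt0 ?ltr0n 1?ltnW //.
by rewrite exprn_ege1 // ler1n ltnW.
Qed.

(** This lets passes of linear and quadratic length be charged to the same time unit [U] as a
    phase. *)
Lemma time_unit_gt K U : (240 * A * (X * K.+1 ^ 3) <= U)%N -> (X < U)%N.
Proof.
apply: leq_trans.
have h1 : (X <= A * (X * K.+1 ^ 3))%N.
  by apply: (@leq_trans (X * K.+1 ^ 3)%N); rewrite ?leq_pmull // leq_pmulr // expn_gt0.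
apply: leq_ltn_trans h1 _; rewrite -(mulnA 240); apply: ltn_Pmull => //.
by rewrite muln_gt0 A_gt0 muln_gt0 X1 expn_gt0.
Qed.

Section Search.
Variables (K U : nat) (lmax : R).
Hypothesis K_gt0 : (0 < K)%N.
Hypothesis nK : (n <= (2 ^ K).+1)%N.
Hypothesis Kn : (2 ^ K <= 2 * n)%N.
Hypothesis hU : (240 * A * (X * K.+1 ^ 3) <= U)%N.
Hypothesis lmax_gt0 : 0 < lmax.
Hypothesis lmaxP : forall l, 0 < l -> (in_simplex P (mu + l *: nu) <-> l <= lmax).
Notation m := (X * X)%N.
Notation N := (A * K.+1 * K.+1)%N.

Let K2n : (K.+1 <= 2 * n)%N.
Proof. by apply: leq_trans Kn; rewrite ltn_expl. Qed.

Let level_space : (B0 + K.+1 * X * 2 < W)%N.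
Proof.
have k1 : (K.+1 * X <= 2 * n * X)%N by rewrite leq_mul2r K2n orbT.
have k2 : (n * X <= X * X)%N by rewrite leq_mul2r leq_pmulr ?orbT // ltnW.
move: k1 k2 (WK); rewrite -mulnA; move: (K.+1 * X)%N (n * X)%N (X * X)%N (B0) => x1 x2 x3 x4; lia.
Qed.

Let four_K : (4 ^ K <= 4 * X)%N.
Proof.
have -> : (4 ^ K = 2 ^ K * 2 ^ K)%N by rewrite -expnMn.
by apply: leq_trans (leq_mul Kn Kn) _; rewrite mulnACA.
Qed.

Let four_KW : (4 ^ K < W)%N.
Proof.
have : (X <= X * X)%N by rewrite leq_pmulr.
by move: four_K (WK); move: (X * X)%N (X) (4 ^ K)%N => ? ? ?; lia.
Qed.

Let two_KW : (2 ^ K < W.-1)%N.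
Proof. by move: Kn (WK) nXX; move: (X * X)%N (2 ^ K)%N => ? ?; lia. Qed.

Let rounds_bound : (N * 4 ^ K <= 16 * A * (X * X))%N.
Proof.
have hKK : (K.+1 * K.+1 <= 4 * X)%N.
  by apply: leq_trans (leq_mul K2n K2n) _; rewrite mulnACA.
rewrite -(mulnA A); apply: leq_trans (leq_mul (leq_mul (leqnn A) hKK) four_K) _.
by move: (X) => ?; lia.
Qed.

Let roundsW : (N * 4 ^ K < W)%N.
Proof. exact: leq_ltn_trans rounds_bound WA. Qed.

Lemma rounds_ok s : env n B0 K m s -> wreg s 5 = (2 ^ K)%N ->
  wsafe W TB s (roundsE A) /\ weval s (roundsE A) = (N * 4 ^ K)%N.
Proof.
move=> [_ _ _ r4] r5.
have e4 : (2 ^ K * 2 ^ K = 4 ^ K)%N by rewrite -expnMn.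
rewrite /= r4 r5 addn1 e4; split=> //.
have h1 : (A <= A * K.+1)%N by rewrite leq_pmulr.
have h2 : (A * K.+1 <= N)%N by rewrite leq_pmulr.
have h3 : (N <= N * 4 ^ K)%N by rewrite leq_pmulr // expn_gt0.
have h4 : (K.+1 <= A * K.+1)%N by rewrite leq_pmull.
move: roundsW two_KW four_KW h1 h2 h3 h4.
move: (N * 4 ^ K)%N (4 ^ K)%N (2 ^ K)%N => x1 x2 x3; move: (A * K.+1 * K.+1)%N => x4.
move: (A * K.+1)%N => x5 *.
by do ?[apply/andP; split]; lia.
Qed.

(** The constant [240] is the [60] of [phase_time] times the [4] of [4 ^ K <= 4 * n ^ 2]. *)
Lemma phase_fast chk : ~~ stores chk ->
  (\sum_(l < N * 4 ^ K) (row_time d n K chk l + 3) +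
   (size (compile_w (roundsE A) TB) + 3) <= U * hcost TB (phase chk (roundsE A)))%N.
Proof.
move=> cs.
have m0 : (0 < m)%N by rewrite muln_gt0 X1.
have N0 : (0 < N)%N by rewrite !muln_gt0 A_gt0.
apply: leq_trans (@phase_time W d n B0 K m n_gt1 level_space m0 two_KW chk cs four_KW (roundsE A) N N0) _.
rewrite (mulnC 60) -mulnA mulnC leq_mul2r; apply/orP; right; apply: leq_trans hU.
have -> : (K.+1 ^ 3 = K.+1 * K.+1 * K.+1)%N by rewrite !expnS expn0 muln1 mulnA.
have : (N * 4 ^ K * K.+1 <= N * (4 * X) * K.+1)%N by rewrite leq_mul2r leq_mul2l four_K !orbT.
by move: (4 ^ K)%N (X) (K.+1) => x1 x2 x3; lia.
Qed.

(** The facts that both phases preserve. Word register 0 already contains the negative answer, which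
    only [report] overwrites. *)
Definition prepared s : Prop :=
  [/\ env n B0 K m s, wreg s 5 = (2 ^ K)%N, wreg s 0 = 0%N, rreg s 12 = lmax &
   [/\ forall h, (h < B0)%N -> rmem s h = rm h,
     represents (mat n B0 s 0 K) a val n & represents (mat n B0 s 1 K) b val n]].

Lemma labelling_val : labelling (val : 'I_n -> nat) n.
Proof. by split=> [w|x lx]; [exact: ltn_ord|exists (Ordinal lx)]. Qed.

Lemma prepared_valid s : prepared s -> valid B0 a b s K n.
Proof. by case=> _ _ _ _ [_ ra rb]; exists val; split=> //; exact: labelling_val. Qed.

Lemma prepared_alive C s : prepared s -> alive B0 a b C s K n.
Proof.
case=> _ _ _ _ [_ ra rb]; exists val, (fun x => if insub x is Some u then u \in C else false).
by split=> //; [exact: labelling_val|move=> u; rewrite valK].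
Qed.

Lemma prepared_frame c s s' : prepared s -> frame c s s' ->
  all (fun i => i \notin written_w c) [:: 0; 1; 2; 3; 4; 5]%N -> 12%N \notin written_r c ->
  low_levels_only n B0 K s s' -> prepared s'.
Proof.
move=> [[E1 E2 E3 E4] r5 r0 r12 [low ra rb]] [fw fr _ _] /=.
move=> /and5P[h0 h1 h2 h3 /and3P[h4 h5 _]] h12 hl.
have top t x y : (t < 2)%N -> (x < n)%N -> (y < n)%N -> mat n B0 s' t K x y = mat n B0 s t K x y.
  move=> t2 lx ly; apply: hl => t' j x' y' lj t2' lx' ly' e.
  by have [_ ej _ _] := adr_inj t2 t2' lx lx' ly ly' e; rewrite ej ltnn in lj.
split; [split; rewrite fw //|by rewrite fw|by rewrite fw|by rewrite fr|].
split.
- move=> h lh; rewrite hl ?low // => t j x y _ _ _ _ e.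
  by move: lh; rewrite e ltnNge leq_addr.
- by move=> x y lx ly; rewrite top // ra.
- by move=> x y lx ly; rewrite top // rb.
Qed.

(** Only the two phases can fail, each with probability at most [fail]; hence the bound [q * q]. *)
Lemma search_ok s : env n B0 K m s -> wreg s 5 = (2 ^ K)%N -> wreg s 23 = D0 ->
  wreg s 0 = 0%N -> rmem s = rm -> rreg s 12 = lmax ->
  hoare (U * hcost TB (search d A)) (search d A) s (q * q)
    (fun s' => if `[< correct_output I s' >] then 1 else 0).
Proof.
move=> Es e5 e23 e0 em e12.
have m0 : (0 < m)%N by rewrite muln_gt0 X1.
have mE : (m%:R = n%:R ^+ 4 :> R) by rewrite !natrM; ring.
have kd := sdim_le.
have XU : (X.+1 <= U)%N.
  exact: time_unit_gt hU.
have U0 : (0 < U)%N by lia.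
have wn : (n * 2 + 2 < W)%N by move: nXX (WK); move: (X * X)%N => ?; lia.
have wb : (B0 + 4 * d + 4 < W)%N by move: (WB); move: (B0) (d.+1 * d)%N => ? ?; lia.
have /andP[f0 f1] := fail_bounds.
have q0 : 0 <= q by rewrite subr_ge0.
have a_sym u v : a u v = a v u by rewrite /cost_a finset.setUC.
have b_sym u v : b u v = b v u by rewrite /cost_b finset.setUC.
have a_ge0 u v : 0 <= a u v.
  by rewrite /cost_a; case: ifP => // h; exact: (adm_nonneg adm (adm_start adm)).
have lin : in_simplex P (mu + lmax *: nu) by apply/lmaxP.
have ab_ge0 u v : 0 <= a u v + lmax * b u v.
  rewrite /cost_a /cost_b; case: ifP => [h|_]; last by rewrite mulr0 addr0.
  by rewrite -edge_cost_ray; exact: (adm_nonneg adm lin).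
have [C0 C0m] := lexmin_exists a b n_gt1.
have fq : q <= 1 - (1 - tree_prob R K) ^+ N.
  rewrite lerD2l lerN2; apply: failure_prob; last exact: ltnW.
  by apply: leq_trans nK _; rewrite expnS mul2n -addnn -addn1 leq_add2l expn_gt0.
apply: (hoare_seqN (V1 := fun s' => if `[< prepared s' >] then q * q else 0)).
  have H : surely (X.+1 * hcost TB (build d)) (build d) s (fun s' =>
    [/\ forall h, (h < B0)%N -> rmem s' h = rm h,
      represents (mat n B0 s' 0 K) a val n & represents (mat n B0 s' 1 K) b val n]).
    eapply build_ok; try eassumption; try done.
    - exact: mem_out.
    - exact: entry_aE.
    - exact: entry_bE.
  apply: surely_hoare (surely_time H _) (mulr_ge0 q0 q0) _; first by rewrite leq_mul2r XU orbT.
  move=> s' [fw fr _ _] _ H'; rewrite asboolT //.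
  have [E1 E2 E3 E4] := Es.
  by split; [split; rewrite fw|rewrite fw|rewrite fw|rewrite fr|].
move=> s1 F1 _; case: asboolP => [R1 _|_]; last by rewrite ltxx.
apply: (hoare_seqN (V1 := fun s' => if `[< prepared s' /\ vals (sound1 a b) s' >] then q * q else 0)).
  have [Es1 _ _ _ [_ ra rb]] := R1.
  have W0 : (0 < W)%N by lia.
  have n0 := ltnW n_gt1.
  have la t : (t < 2)%N -> wsafe W TB s1 (adrE t (WVar 4) (WNum 0) (WNum 0)) /\
      weval s1 (adrE t (WVar 4) (WNum 0) (WNum 0)) = adr n B0 t K 0 0.
    by move=> t2; eapply level_adr_ok; try eassumption; done.
  have [w0 v0] := la 0%N isT; have [w1 v1] := la 1%N isT.
  set c := (HSetR 0 _ ;; _).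
  have H : surely (hcost TB c) c s1 (fun s' => [/\ rmem s' = rmem s1,
     rreg s' 0 = mat n B0 s1 0 K 0 0 & rreg s' 1 = mat n B0 s1 1 K 0 0]).
    apply: surely_setr_seq; [by []|exact: w0|].
    apply: surely_setr; [by []|exact: w1|].
    by split; [by []|exact: (congr1 (rmem s1) v0)|exact: (congr1 (rmem s1) v1)].
  apply: surely_hoare (surely_time H _) (mulr_ge0 q0 q0) _; first by rewrite leq_pmull.
  move=> s' F' _ [em' h0 h1]; rewrite asboolT //; split.
    by apply: prepared_frame R1 F' isT isT _ => z _; rewrite em'.
  have [c0 k0 k1] := fiber_val labelling_val ra rb n_gt1 n0.
  by exists (fiber val 0%N) => //; rewrite h0 h1 k0 k1.
move=> s2 F2 _; case: asboolP => [[R2 snd2] _|_]; last by rewrite ltxx.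
apply: (hoare_seqN (V1 := fun s' => if `[< prepared s' /\ vals (found1 a b C0) s' >] then q else 0)).
  have ck s' j r f := @chk1_ok R W d n B0 K m n_gt1 level_space m0 a b lmax a_sym b_sym a_ge0 ab_ge0
    lmax_gt0 C0 C0m s' j r f.
  have [Es2 r5 _ _ _] := R2; have [ws we] := rounds_ok Es2 r5.
  have cw : {subset written_w chk1 <= [:: 15; 16; 20]%N}.
    exact: (allP (isT : all (mem [:: 15; 16; 20]%N) (written_w chk1))).
  have H := @phase_ok R W d n B0 K m n_gt1 level_space m0 mE two_KW a b C0 chk1 _ _ a_sym b_sym cw isT
    ck four_KW (roundsE A) N s2 K_gt0 nK Es2 r5 ws we roundsW snd2 (prepared_valid R2)
    (or_intror (prepared_alive C0 R2)).
  apply: hoare_le (hoare_scale q0 H) (@phase_fast chk1 isT) _ _; first by rewrite ler_wpM2l.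
  move=> s' F' _; case: asboolP => [[_ _ [_ ll] fd] _|_]; last by rewrite ltxx.
  by rewrite asboolT //; split=> //; exact: prepared_frame R2 F' isT isT ll.
move=> s3 F3 _; case: asboolP => [[R3 fd3] _|_]; last by rewrite ltxx.
apply: (hoare_seqN (V1 := fun s' =>
    if `[< prepared s' /\ vals (sound2' a b lmax C0) s' >] then q else 0)).
  set c := (HSetR 2 _ ;; _).
  have H : surely (hcost TB c) c s3 (fun s' => s' = setw (set_rreg s3 2 (rreg s3 12)) 20 0).
    apply: surely_setr_seq; [by []|by []|].
    by apply: surely_setw; [by []|rewrite /=; lia|].
  apply: surely_hoare (surely_time H _) q0 _; first by rewrite leq_pmull.
  move=> s' F' _ es; rewrite asboolT //; split.
    by apply: prepared_frame R3 F' isT isT _ => z _; rewrite es.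
  have [_ _ _ r12 _] := R3; have [hA hB] := fd3.
  by rewrite es /vals /= r12; split=> //; split=> //; left.
move=> s4 F4 _; case: asboolP => [[R4 snd4] _|_]; last by rewrite ltxx.
have [C1 fc] : exists C1, found2 a b (cutv a C0) (cutv b C0) lmax 0 \/
    first_crossing a b lmax (cutv a C0) (cutv b C0) C1.
  have [[C h]|h] := first_crossing_exists a b lmax (cutv a C0) (cutv b C0).
    by exists C; right.
  by exists finset.set0; left.
apply: (hoare_seqN (V1 := fun s' => if `[< [/\ prepared s', vals (sound2' a b lmax C0) s' &
    vals (found2' a b C0) s'] >] then 1 else 0)).
  have ck s' j r f := @chk2_ok R W d n B0 K m n_gt1 level_space m0 a b lmax a_sym b_sym a_ge0 ab_ge0
    lmax_gt0 C0 C0m C1 s' j r f fc.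
  have [Es4 r5 _ _ _] := R4; have [ws we] := rounds_ok Es4 r5.
  have cw : {subset written_w chk2 <= [:: 15; 16; 20]%N}.
    exact: (allP (isT : all (mem [:: 15; 16; 20]%N) (written_w chk2))).
  have H := @phase_ok R W d n B0 K m n_gt1 level_space m0 mE two_KW a b C1 chk2 _ _ a_sym b_sym cw isT
    ck four_KW (roundsE A) N s4 K_gt0 nK Es4 r5 ws we roundsW snd4 (prepared_valid R4)
    (or_intror (prepared_alive C1 R4)).
  apply: hoare_le H (@phase_fast chk2 isT) fq _.
  move=> s' F' _; case: asboolP => [[_ _ [sn ll] fd] _|_]; last by rewrite ltxx.
  by rewrite asboolT //; split=> //; exact: prepared_frame R4 F' isT isT ll.
move=> s5 F5 _; case: asboolP => [[R5 snd5 fd5] _|_]; last by rewrite ltxx.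
have [_ _ r0 _ [low _ _]] := R5.
have low' h : (h < d + d)%N -> rmem s5 h = rm h.
  by move=> lh; apply: low; apply: leq_trans lh _; rewrite -addnA leq_addr.
apply: surely_hoare (surely_time (report_ok low') _) ler01 _; first by rewrite leq_pmull.
have [_ _ [l1 l2 src _]] := snd5.
move=> s' _ _ H; rewrite asboolT //; case: H => [[h20 h0 hr]|[h20 h0]]; [left|right]; split=> //.
- case: src => [[h _]|[_ cr]]; first by rewrite h in h20.
  have -> : \row_(i < d) rreg s' i = mu + rreg s5 2 *: nu.
    by apply/rowP => i; rewrite mxE hr.
  apply: (next_breakpoint_found n_gt1 (adm_graph adm) lmaxP C0m _ _ cr); first by rewrite l1.
  by move: fd5; rewrite /vals h20.
- by rewrite h0.
- case: src => [[h e]|[h _]]; last by rewrite h in h20.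
  apply: (next_breakpoint_none n_gt1 (adm_graph adm) lmaxP C0m).
  by move: fd5; rewrite /vals h e.
Qed.
End Search.

(** The hypothesis ranges over all admissible [K] because the program finds [K] only while running,
    whereas its time limit is fixed beforehand. *)
Lemma algorithm_ok U :
  (forall K, (2 ^ K <= 2 * n)%N -> (240 * A * (X * K.+1 ^ 3) <= U)%N) ->
  hoare (U * hcost TB (algorithm d A)) (algorithm d A) (initial_state I) (q * q)
    (fun s' => if `[< correct_output I s' >] then 1 else 0).
Proof.
move=> hU; have kd := sdim_le.
have /andP[f0 f1] := fail_bounds.
have q0 : 0 <= q by rewrite subr_ge0.
have qq := mulr_ge0 q0 q0.
have XU : (X.+1 <= U)%N.
  by apply: (@time_unit_gt 0%N U); apply: hU; rewrite expn0; lia.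
have nU : (n.+1 <= U)%N by apply: leq_trans XU; rewrite ltnS leq_pmulr // ltnW.
have U0 : (0 < U)%N by lia.
have wn : (n * 2 + 2 < W)%N by move: nXX (WK); move: (X * X)%N => ?; lia.
have wb : (B0 + 4 * d + 4 < W)%N by move: (WB); move: (B0) (d.+1 * d)%N => ? ?; lia.
pose keep s' := [/\ wreg s' 21 = k.+1, wreg s' 23 = D0, wreg s' 0 = 0%N, wreg s' 24 = 0%N & rmem s' = rm].
apply: (hoare_seqN (V1 := fun s' => if `[< [/\ env n B0 1 (X * X) s', wreg s' 5 = 2 & keep s'] >]
    then q * q else 0)).
  have H : surely (hcost TB (setup_regs d)) (setup_regs d) (initial_state I) (fun s' =>
    [/\ env n B0 1 (X * X) s', wreg s' 5 = 2, wreg s' 21 = k.+1 & wreg s' 23 = D0]).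
    by apply: setup_regs_ok.
  apply: surely_hoare (surely_time H _) qq _; first by rewrite leq_pmull.
  move=> s' [fw _ _ fm] _ [h1 h2 h3 h4]; rewrite asboolT //; split=> //.
  by split=> //; rewrite ?fw ?fm.
move=> s1 _ _; case: asboolP => [[E1 r5 [h21 h23 h0 h24 em]] _|_]; last by rewrite ltxx.
apply: (hoare_seqN (V1 := fun s' => if `[< (exists K, [/\ (0 < K)%N, (n <= (2 ^ K).+1)%N,
    (2 ^ K <= 2 * n)%N & env n B0 K (X * X) s' /\ wreg s' 5 = (2 ^ K)%N]) /\ keep s' >]
    then q * q else 0)).
  have H : surely (n.+1 * hcost TB setup_log) setup_log s1 (fun s' => exists K,
    [/\ (0 < K)%N, (n <= (2 ^ K).+1)%N, (2 ^ K <= 2 * n)%N &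
      env n B0 K (X * X) s' /\ wreg s' 5 = (2 ^ K)%N]).
    by apply: setup_log_ok.
  apply: surely_hoare (surely_time H _) qq _; first by rewrite leq_mul2r nU orbT.
  move=> s' [fw _ _ fm] _ h; rewrite asboolT //; split=> //.
  by split; rewrite ?fw ?fm.
move=> s2 _ _; case: asboolP => [[[K [K0 nK Kn [E2 e5]]] [g21 g23 g0 g24 gm]] _|_]; last by rewrite ltxx.
pose ray s' := [/\ wreg s' 24 = 1%N, 0 < rreg s' 12 &
       forall l, 0 < l -> (in_simplex P (mu + l *: nu) <-> l <= rreg s' 12)] \/
    (wreg s' 24 = 0%N /\ (nu = 0 \/ forall l, 0 < l -> ~ in_simplex P (mu + l *: nu))).
apply: (hoare_seqN (V1 := fun s' => if `[< [/\ env n B0 K (X * X) s', wreg s' 5 = (2 ^ K)%N,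
    wreg s' 23 = D0, wreg s' 0 = 0%N & rmem s' = rm /\ ray s'] >] then q * q else 0)).
  apply: surely_hoare (surely_time (ray_ok gm g24 g21) _) qq _; first by rewrite leq_pmull.
  move=> s' [fw _ _ _] _ h; rewrite asboolT //; have [d1 d2 d3 d4] := E2.
  by split; [split; rewrite fw ?written_ray_upto //|rewrite fw ?written_ray_upto //|
    rewrite fw ?written_ray_upto //|rewrite fw ?written_ray_upto //|exact: h].
move=> s3 _ _; case: asboolP => [[E3 f5 f23 f0' [fm H]] _|_]; last by rewrite ltxx.
have W1 : (1 < W)%N by lia.
apply: hoare_le (@hoare_if R W TB (EqW (WVar 24) (WNum 1)) (search d A) HSkip s3 (q * q)
  (fun s' => if `[< correct_output I s' >] then 1 else 0) (U * hcost TB (search d A)) 0 _ _ _) _ (lexx _) _.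
- by rewrite /= W1.
- rewrite -[teval _ _]/(wreg s3 24 == 1%N) => /eqP e24; case: H => [[_ l0 lP]|[h _]]; last by rewrite h in e24.
  exact: (search_ok K0 nK Kn (hU K Kn) l0 lP).
- rewrite -[teval _ _]/(wreg s3 24 == 1%N) => /eqP e24; case: H => [[h _ _]|[_ h]]; first by rewrite h in e24.
  apply: hoare_le (@hoare_skip R W TB s3 (q * q)) (leqnn _) (lexx _) _ => s' _ _.
  case: asboolP => [-> _|_]; last by rewrite ltxx.
  rewrite asboolT; first by rewrite mulr_ile1 // gerBl.
  by right; split=> //; exact: no_ray_breakpoint h.
- rewrite -[hcost TB (HIf _ _ _)]/((size (compile_t (EqW (WVar 24) (WNum 1)) TB).1).+1 +
    (hcost TB (search d A) + 0))%N !addn0 mulnDr leq_add2r leq_pmull //.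
- by [].
Qed.

Lemma algorithm_success U :
  (forall K, (2 ^ K <= 2 * n)%N -> (240 * A * (X * K.+1 ^ 3) <= U)%N) ->
  q * q <= success_prob W (U * hcost TB (algorithm d A)) (compile TB (algorithm d A)) I.
Proof.
move=> hU; have := @algorithm_ok U hU [::] 0%N (correct_output I) _ (initial_state I).
rewrite cats0 addn0; apply; last first.
  by split; [exact: agree_refl|move=> i _ /=; lia].
move=> s' s0 _ [[hw hr _ _] _]; rewrite [prob_halts_within _ _ _ _ _]/=.
case: asboolP => [co|_]; last by rewrite ler0n.
rewrite asboolT //; have w0 : wreg s0 0 = wreg s' 0 by rewrite hw.
have rE : \row_(i < d) rreg s0 i = \row_(i < d) rreg s' i.
  by apply/rowP => i; rewrite !mxE hr // (leq_trans (ltn_ord i)) // leq_addl.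
by case: co => [[h1 h2]|[h1 h2]]; [left|right]; rewrite w0 ?rE.
Qed.
End Correct.

Lemma log_factor_bound n K : (1 < n)%N -> (2 ^ K <= 2 * n)%N -> (K.+1 <= trunc_log 2 n + 3)%N.
Proof.
move=> n_gt1; case: K => [|K] h; first by lia.
have : (K <= trunc_log 2 n)%N by apply: trunc_log_max => //; rewrite expnS leq_pmul2l in h.
lia.
Qed.

(** The constant factors depending on [d] and [A] must be dominated by a power of [n] even for
    [n = 2]: [c < n ^ c] takes care of them, and the exponent [4] of the rest. *)
Lemma word_space (d n k A : nat) : (1 < n)%N -> (k <= d)%N -> (0 < A)%N ->
  let X := (n * n)%N in let W := (n ^ (100 * (d + 3) * (d + 3) * A + 4))%N in
  let B0 := (d + d + k.+1 * d + d.+1 * X)%N in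
  [/\ (X * X < W)%N, (16 * A * (X * X) < W)%N,
      (B0 + 4 * (X * X) + d.+1 * d + 4 * d + 4 < W)%N & (B0 + d.+1 * d + 4 * d + 4 < W)%N].
Proof.
move=> n1 kd A0 X W B0; set c := (100 * (d + 3) * (d + 3) * A)%N in W *.
have x1 : (0 < X * X)%N by rewrite !muln_gt0 ltnW.
have xx : (X <= X * X)%N by rewrite leq_pmulr // muln_gt0 ltnW.
have cW : (c * (X * X) < W)%N.
  have -> : W = (n ^ c * (X * X))%N by rewrite /W expnD; congr (_ * _)%N; rewrite /X !expnS expn0 muln1 !mulnA.
  by rewrite ltn_pmul2r // ltn_expl.
have c100 : (100 * (d + 3) * (d + 3) <= c)%N by rewrite /c leq_pmulr.
have cA : (16 * A <= c)%N by rewrite /c leq_mul2r; apply/orP; right; lia.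
have kdd : (k.+1 * d <= d.+1 * d)%N by rewrite leq_mul2r ltnS kd orbT.
have dX : (d.+1 * X <= d.+1 * (X * X))%N by rewrite leq_mul2l xx orbT.
have key : ((6 * d + 2 * (d.+1 * d) + d.+1 + 8) * (X * X) < W)%N.
  apply: leq_ltn_trans cW; rewrite leq_mul2r; apply/orP; right; apply: leq_trans c100; lia.
have big : (B0 + 4 * (X * X) + d.+1 * d + 4 * d + 4 < W)%N.
  have gen (y y1 y2 y4 : nat) : (y1 <= y4)%N -> (y2 <= d.+1 * y)%N -> (0 < y)%N ->
    (d + d + y1 + y2 + 4 * y + y4 + 4 * d + 4 <= (6 * d + 2 * y4 + d.+1 + 8) * y)%N.
    by move=> h1 h2 h3; have := leq_pmulr (6 * d) h3; have := leq_pmulr (2 * y4) h3; lia.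
  by apply: leq_ltn_trans key; apply: gen.
split=> //.
- by apply: leq_ltn_trans cW; rewrite leq_pmull //; lia.
- by apply: leq_ltn_trans cW; rewrite leq_mul2r cA orbT.
- by move: big; move: (B0) (X * X)%N (d.+1 * d)%N => ? ? ?; lia.
Qed.

(** * The asymptotic time bound and the theorem *)

Local Open Scope classical_set_scope.
Local Open Scope ring_scope.

Lemma bigO_square_log3 (R : realType) (C : nat) :
  (fun n : nat => (C * (n * n * (trunc_log 2 n + 3) ^ 3))%:R : R^o) =O_\oo
  (fun n : nat => n%:R ^+ 2 * ln n%:R ^+ 3 : R^o).
Proof.
have ln2 : 0 < ln (2 : R) by rewrite ln_gt0 // ltr1n.
(* For [n >= 2] the binary logarithm is at least [1], so adding [3] to it at most quadruples it. *)
pose r : R := 4 / ln 2.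
have r0 : 0 < r by rewrite divr_gt0.
apply/eqO_exP; exists (C%:R * r ^+ 3 + 1).
  by rewrite ltr_wpDl // mulr_ge0 ?ler0n ?exprn_ge0 // ltW.
exists 2%N => // n /= n2.
have n0 : (0 < n)%N by apply: leq_trans n2.
have l2n : ln (2 : R) <= ln n%:R by rewrite ler_ln ?posrE ?ltr0n // ler_nat.
have lL : ln (2 : R) * (trunc_log 2 n)%:R <= ln n%:R.
  rewrite mulr_natr -lnXn ?ltr0n // ler_ln ?posrE ?exprn_gt0 ?ltr0n // -natrX ler_nat.
  exact: trunc_logP.
have lb : (trunc_log 2 n + 3)%:R <= r * ln n%:R.
  rewrite /r mulrAC ler_pdivlMr // natrD mulrDl; rewrite mulrC in lL; lra.
have e0 : 0 <= n%:R ^+ 2 * ln n%:R ^+ 3 :> R.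
  by rewrite mulr_ge0 ?exprn_ge0 ?ler0n // (le_trans (ltW ln2)).
rewrite ger0_norm ?ler0n // [X in _ * X]ger0_norm //.
apply: (@le_trans _ _ (C%:R * r ^+ 3 * (n%:R ^+ 2 * ln n%:R ^+ 3))); last first.
  by rewrite ler_wpM2r // lerDl.
have -> : C%:R * r ^+ 3 * (n%:R ^+ 2 * ln n%:R ^+ 3) = C%:R * (n%:R ^+ 2 * (r * ln n%:R) ^+ 3).
  have gen (x y z w : R) : x * y ^+ 3 * (z * w ^+ 3) = x * (z * (y * w) ^+ 3) by ring.
  exact: gen.
rewrite natrM ler_wpM2l ?ler0n // natrM ler_pM ?ler0n //; first by rewrite natrM expr2.
by rewrite natrX lerXn2r ?nnegrE ?ler0n // (le_trans _ lb) ?ler0n.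
Qed.

Theorem theorem2 (R : realType) (d : nat) (hd : (1 <= d)%N) (a : nat) :
  exists (p : program) (b : nat) (T : nat -> nat),
    ((fun n : nat => (T n)%:R : R^o) =O_\oo
       (fun n : nat => n%:R ^+ 2 * ln n%:R ^+ 3 : R^o)) /\
    (forall (n : nat) (I : instance R d n), (2 <= n)%N -> admissible I ->
       1 - n%:R ^- a <= success_prob (n ^ b) (T n) p I).
Proof.
(* The two phases together fail with probability at most [2 * n ^- A], and one extra power of
   [n >= 2] pays for the factor [2]. *)
pose A := a.+1; pose h := hcost (40 + d) (algorithm d A).
exists (compile (40 + d) (algorithm d A)), (100 * (d + 3) * (d + 3) * A + 4)%N,
  (fun n => 240 * A * h * (n * n * (trunc_log 2 n + 3) ^ 3))%N.
split; first exact: bigO_square_log3.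
move=> n I n2 adm.
have [w1 w2 w3 w4] := word_space n2 (sdim_le adm) (isT : (0 < A)%N).
have hU K : (2 ^ K <= 2 * n)%N ->
    (240 * A * (n * n * K.+1 ^ 3) <= 240 * A * (n * n * (trunc_log 2 n + 3) ^ 3))%N.
  by move=> /(log_factor_bound n2) hK; rewrite !leq_mul2l leq_exp2r // hK !orbT.
have := algorithm_success adm n2 w1 w4 (isT : (0 < A)%N) w2 w3 hU.
rewrite -/h (mulnAC (240 * A) h); apply: le_trans.
have g0 : 0 <= n%:R ^- a :> R by rewrite invr_ge0 exprn_ge0.
have n_half : (n%:R : R)^-1 <= 2^-1.
  by rewrite lef_pV2 ?posrE ?ltr0n ?ler_nat // (leq_trans _ n2).
have f2 : n%:R ^- A <= 2^-1 * n%:R ^- a :> R by rewrite /A exprS invfM ler_wpM2r.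
have : 0 <= (n%:R ^- A : R) ^+ 2 by rewrite sqr_ge0.
rewrite expr2; lra.
Qed.
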